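(* Let $0<\alpha\le 1$, let $d>0$, let $p,q,r>0$ be real constants with $q>p$, and consider the generalized Mackey-Glass equation with two fractional derivatives $$\left(\alpha-\tfrac12\right)D^{\alpha}x(t)+d\,D^{2\alpha}x(t)=-p\,x(t)+q\,\frac{x(t-\tau)}{1+x(t-\tau)^r},\qquad t>0.$$ Then the equilibrium point $x_1^*=0$ is unstable for every delay $\tau\ge 0$.
   Context: For $\mu>0$ and $\eta\in\mathbb{N}$ with $\eta-1<\mu\le\eta$, $D^\mu$ is the Caputo derivative: $D^\mu f=f^{(\eta)}$ if $\mu=\eta$, and $D^\mu f(t)=\frac{1}{\Gamma(\eta-\mu)}\int_0^t (t-s)^{\eta-\mu-1}f^{(\eta)}(s)\,ds$ if $\eta-1<\mu<\eta$. The equation is posed with initial data $x(t)=\phi(t)$ for $-\tau\le t\le 0$, where $\phi:[-\tau,0]\to\mathbb{R}$ (when $2\alpha>1$ a value of $\dot x$ at $0$ is prescribed as well); the solution is denoted $x(t,\phi)$ and $\|\phi\|=\sup_{-\tau\le t\le 0}|\phi(t)|$. When $r$ is not an integer, $x^r$ is the usual real power and the equation is considered where it is defined. An equilibrium point $x_*$ (a constant solution) is stable if for every $\epsilon>0$ there is $\delta>0$ such that $\|\phi-x_*\|<\delta$ implies $|x(t,\phi)-x_*|<\epsilon$ for all $t\ge 0$; it is unstable if it is not stable. *)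

(* Defs.v *)
From HB Require Import structures.
From mathcomp Require Import all_boot all_order all_algebra.
From mathcomp Require Import all_classical all_reals all_analysis.

Set Implicit Arguments.
Unset Strict Implicit.
Unset Printing Implicit Defensive.

Import Order.TTheory GRing.Theory Num.Theory.
Import numFieldNormedType.Exports.

Local Open Scope classical_set_scope.
Local Open Scope ring_scope.

Definition Gamma {R : realType} (z : R) : R :=
  \int[lebesgue_measure]_(s in `[0, +oo[) (s `^ (z - 1) * expR (- s)).

(* For mu > 0, the natural number eta with eta - 1 < mu <= eta. *)
Definition caputo_order {R : realType} (mu : R) : nat := `|Num.ceil mu|%N.

Definition caputo_integrand {R : realType} (mu : R) (f : R -> R) (t s : R) : R :=
  (t - s) `^ ((caputo_order mu)%:R - mu - 1) * derive1n (caputo_order mu) f s.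

Definition caputo {R : realType} (mu : R) (f : R -> R) (t : R) : R :=
  let eta := caputo_order mu in
  if mu == eta%:R then derive1n eta f t
  else (Gamma (eta%:R - mu))^-1 *
       \int[lebesgue_measure]_(s in `[0, t]) caputo_integrand mu f t s.

(* Local absolute continuity up to 0, in the form "f is a primitive of its
   locally summable derivative".  The value f 0 is not used: below, f may be a
   derivative of a function whose left and right derivatives at 0 differ. *)
Definition ac_pos {R : realType} (f : R -> R) : Prop :=
  (forall T : R, 0 < T ->
     (@lebesgue_measure R).-integrable `[0, T] (fun s : R => (derive1 f s)%:E)) /\
  (forall a b, 0 < a -> a <= b ->
     f b - f a = \int[lebesgue_measure]_(s in `[a, b]) derive1 f s).

(* D^mu f is defined at every t > 0.  [derive1n] and the integral are total in
   the library, so the existence of the derivatives and of the integral has to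
   be required.  For non-integer mu the top derivative f^(eta) is only asked to
   exist almost everywhere: solutions of fractional equations are typically
   not of class C^eta at 0 and at the multiples of the delay. *)
Definition caputo_derivable {R : realType} (mu : R) (f : R -> R) : Prop :=
  let eta := caputo_order mu in
  if mu == eta%:R then
    forall k, (k < eta)%N -> forall t, 0 < t -> derivable (derive1n k f) t 1
  else
    [/\ forall k, (k.+1 < eta)%N -> forall t, 0 < t -> derivable (derive1n k f) t 1,
        ac_pos (derive1n eta.-1 f) &
        forall t, 0 < t ->
          (@lebesgue_measure R).-integrable `[0, t]
            (fun s : R => (caputo_integrand mu f t s)%:E)].

(* y ^ r for r > 0: the ring power when r is a natural number (y arbitrary),
   and the usual real power otherwise, meaningful only for y >= 0; [powR] takes
   junk values on negative bases, hence the guard in [mg_defined]. *)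
Definition rpow {R : realType} (y r : R) : R :=
  if r \is a Num.nat then y ^+ Num.truncn r else y `^ r.

(* y / (1 + y ^ r) is defined. *)
Definition mg_defined {R : realType} (r y : R) : Prop :=
  (r \is a Num.nat \/ 0 <= y) /\ 1 + rpow y r != 0.

(* x is a solution on [- tau, +oo[ with x = phi on [- tau, 0] and, when
   2 alpha > 1, with (right) derivative v at 0.  Only the values of x on
   [- tau, +oo[ matter. *)
Definition mg_solution {R : realType} (alpha d p q r tau : R)
    (phi : R -> R) (v : R) (x : R -> R) : Prop :=
  [/\ (forall t, - tau <= t <= 0 -> x t = phi t),
      {within `[- tau, +oo[, continuous x},
      (1 < 2 * alpha -> h^-1 * (x h - x 0) @[h --> 0^'+] --> v),
      caputo_derivable alpha x /\ caputo_derivable (2 * alpha) x &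
      forall t, 0 < t -> mg_defined r (x (t - tau)) /\
        (alpha - 2^-1) * caputo alpha x t + d * caputo (2 * alpha) x t =
        - p * x t + q * (x (t - tau) / (1 + rpow (x (t - tau)) r))].

Definition mg_equilibrium {R : realType} (alpha d p q r tau xs : R) : Prop :=
  mg_solution alpha d p q r tau (cst xs) 0 (cst xs).

Definition init_norm {R : realType} (tau : R) (phi : R -> R) : R :=
  sup [set `|phi t| | t in `[- tau, 0]].

(* Initial functions for which the equation makes sense.  Lipschitz continuity
   is a smoothness requirement under which (local) solutions do exist in the
   sense of [mg_solution]: for merely continuous phi and alpha < 1/2 the
   solution of the associated Volterra equation may fail to be absolutely
   continuous.  Shrinking the class makes instability a stronger property. *)
Definition mg_initial {R : realType} (r tau : R) (phi : R -> R) : Prop :=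
  [lipschitz phi t | t in `[- tau, 0]] /\
  (forall t, - tau <= t <= 0 -> mg_defined r (phi t)).

(* "|x(t, phi) - xs| < eps for all t >= 0" includes that the solution exists
   for all t >= 0.  Only phi is perturbed: the prescribed value of x' at 0 (used
   when 2 alpha > 1) is that of the constant solution, namely 0. *)
Definition mg_stable {R : realType} (alpha d p q r tau xs : R) : Prop :=
  forall eps, 0 < eps -> exists2 delta, 0 < delta &
    forall phi, mg_initial r tau phi ->
      init_norm tau (fun t => phi t - xs) < delta ->
      exists2 x, mg_solution alpha d p q r tau phi 0 x &
        forall t, 0 <= t -> `|x t - xs| < eps.

Definition mg_unstable {R : realType} (alpha d p q r tau xs : R) : Prop :=
  ~ mg_stable alpha d p q r tau xs.

(* Main.v *)
From HB Require Import structures.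
Require Import Defs.
From mathcomp Require Import all_boot all_order all_algebra.
From mathcomp Require Import all_classical all_reals all_analysis.
From mathcomp Require Import measurable_realfun complex ring lra.

(**
  Suppose 0 is stable and start from a small constant c > 0.  With a = alpha - 1/2,
  y = x - c and h the nonlinear remainder, the Laplace transforms Y and H satisfy
    Delta(s) Y(s) = c (q - p) / s + q H(s),  Re s > 0,
    Delta(s) = a s^alpha + d s^(2 alpha) + p - q exp (- s tau).
  As Delta(0) = p - q < 0, Delta has a root lam > 0.  The zeros of Delta are countable,
  so some line Re s = sg with 0 < sg < lam is zero-free, and |Delta| is bounded below on it.
  Parseval's inequality on that line, together with |h| <= k (|y(t - tau)| + c) for a k as
  small as the stability neighbourhood allows, bounds y in L^2 (exp (- 2 sg t) dt) by a
  multiple of c that does not depend on k.  At s = lam the left-hand side vanishes, hence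
  c (q - p) / lam = - q H(lam) = O(k c), which is absurd for small k.
*)

Set Implicit Arguments.
Unset Strict Implicit.
Unset Printing Implicit Defensive.

Import Order.TTheory GRing.Theory Num.Theory.
Import numFieldNormedType.Exports.
Import ComplexField.Normc.

Local Open Scope classical_set_scope.
Local Open Scope ring_scope.

Local Notation Re := complex.Re.
Local Notation Im := complex.Im.

(** * Integrable functions on the line and convolution *)

Local Notation mu := (@lebesgue_measure _).

(** Stability only gives [|y| <= 2 e], where [e] is fixed before [c] and [c] may be far smaller. A
    priori the remainder is of size [k e], not [k c], and this does not contradict the value of
    [H(lam)]. A bound on [y] that is linear in [c] is needed, hence the detour through a line where
    [Delta] can be inverted and where a remainder of size [k |y|] can be absorbed. The line lies
    strictly to the left of [lam], so that [exp (- lam t) = exp (- (lam - sg) t) exp (- sg t)], and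
    the square integrability of the first factor turns the weighted L^2 bound into a bound on
    [H(lam)]. Nothing is known about the other zeros of [Delta]; countability makes their location
    irrelevant. It comes from an elimination: on an uncountable set of zeros of a
    complex-differentiable function, the derivative vanishes on an uncountable subset too. The
    equation is integrated in time before it is transformed: a Caputo derivative of [x] is not known
    to have a transform, whereas after enough integrations only convolutions of power kernels with
    the bounded [y] remain. *)

Section affine_change.
Context {R : realType}.
Implicit Types (a b : R) (f : R -> R).

Definition L1 f := (@lebesgue_measure R).-integrable setT (EFin \o f).

Lemma measurable_affine a b : measurable_fun [set: R] (fun x : R => a * x + b).
Proof. by apply: measurable_funD => //; exact: measurable_funM. Qed.

(** Lebesgue measure is determined by its values on half-open intervals, so only these have to be
    pulled back. For negative [a] the preimage is closed on the left and open on the right, with the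
    same length. *)
Lemma lebesgue_measure_affine a b (A : set (measurableTypeR R)) :
  a != 0 -> measurable A ->
  (@lebesgue_measure R A =
   `|a|%:E * @lebesgue_measure R ((fun x : R => a * x + b)%R @^-1` A))%E.
Proof.
move=> a0 mA.
pose k : {nonneg R} := NngNum (normr_ge0 a).
pose ph : R -> measurableTypeR R := fun x => a * x + b.
have mph : measurable_fun (setT : set (measurableTypeR R)) ph := measurable_affine a b.
apply: (lebesgue_measure_unique (mu := mscale k (pushforward (@lebesgue_measure R) ph))) => // _ [[c d]/= _ <-].
rewrite /mscale/= /pushforward.
have [a1|a1|a1] := ltgtP a 0; last by rewrite a1 eqxx in a0.
- have -> : ph @^-1` `]c, d] = `[(d - b) / a, (c - b) / a[%classic.
    apply/seteqP; split => x /=; rewrite !in_itv/= /ph.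
      by rewrite ler_ndivrMr// ltr_ndivlMr// => /andP[? ?]; apply/andP; split; lra.
    by rewrite ler_ndivrMr// ltr_ndivlMr// => /andP[? ?]; apply/andP; split; lra.
  rewrite !lebesgue_measure_itv/= !lte_fin.
  rewrite ltr_nM2r ?invr_lt0// ltrD2r.
  case: ifPn => cd; last by rewrite mule0.
  by rewrite -EFinD -EFinM ltr0_norm//; congr EFin; field.
- have -> : ph @^-1` `]c, d] = `](c - b) / a, (d - b) / a]%classic.
    apply/seteqP; split => x /=; rewrite !in_itv/= /ph.
      by rewrite ler_pdivlMr// ltr_pdivrMr// => /andP[? ?]; apply/andP; split; lra.
    by rewrite ler_pdivlMr// ltr_pdivrMr// => /andP[? ?]; apply/andP; split; lra.
  rewrite !lebesgue_measure_itv/= !lte_fin.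
  rewrite ltr_pM2r ?invr_gt0// ltrD2r.
  case: ifPn => cd; last by rewrite mule0.
  by rewrite -EFinD -EFinM gtr0_norm//; congr EFin; field.
Qed.

Lemma ge0_integral_affine a b (f : R -> \bar R) : a != 0 ->
  measurable_fun setT f -> (forall x, 0 <= f x)%E ->
  (\int[mu]_x f x = `|a|%:E * \int[mu]_x f (a * x + b)%R)%E.
Proof.
move=> a0 mf f0.
pose k : {nonneg R} := NngNum (normr_ge0 a).
pose ph : R -> measurableTypeR R := fun x => a * x + b.
have mph : measurable_fun (setT : set (measurableTypeR R)) ph := measurable_affine a b.
pose P : {measure set (measurableTypeR R) -> \bar R} := pushforward (@lebesgue_measure R) ph.
transitivity (\int[mscale k (P mph)]_x f x)%E.
  apply: eq_measure_integral => A mA _.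
  exact: (lebesgue_measure_affine b a0).
rewrite ge0_integral_mscale//=; congr (_ * _)%E.
by rewrite ge0_integral_pushforward.
Qed.

Lemma L1P f : L1 f <-> measurable_fun setT f /\ (\int[mu]_x `|f x|%:E < +oo)%E.
Proof.
split => [/integrableP[/measurable_EFinP mf ?]//|[mf ?]].
by apply/integrableP; split => //; exact/measurable_EFinP.
Qed.

Lemma L1_affine a b f : a != 0 -> L1 f -> L1 (fun x => f (a * x + b)).
Proof.
move=> a0 /L1P[mf intf]; apply/L1P; split.
  exact: (measurableT_comp mf (measurable_affine a b)).
have := @ge0_integral_affine a b (fun x => `|f x|%:E) a0.
move=> H; rewrite H// in intf; last first.
  by apply/measurable_EFinP; exact: measurableT_comp.
rewrite lt_neqAle leey andbT; apply/eqP => E; move: intf; rewrite E.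
by rewrite mulry gtr0_sg ?normr_gt0// mul1e ltxx.
Qed.

Lemma integral_affine a b f : a != 0 -> L1 f ->
  \int[mu]_x f x = `|a| * \int[mu]_x f (a * x + b).
Proof.
move=> a0 intf.
have if2 := L1_affine b a0 intf.
have mf : measurable_fun setT f by case/L1P : intf.
have mfp : measurable_fun setT (fun x => (f x)%:E) by exact/measurable_EFinP.
pose g := fun x => f (a * x + b).
have gp x : ((fun x => (f x)%:E)^\+ (a * x + b)%R = (EFin \o g)^\+ x)%E.
  by rewrite -[LHS]/(((EFin \o f)^\+%E \o (fun x => a * x + b)) x) -funepos_comp.
have gn x : ((fun x => (f x)%:E)^\- (a * x + b)%R = (EFin \o g)^\- x)%E.
  by rewrite -[LHS]/(((EFin \o f)^\-%E \o (fun x => a * x + b)) x) -funeneg_comp.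
have hp : (\int[mu]_x (EFin \o f)^\+ x = `|a|%:E * \int[mu]_x (EFin \o g)^\+ x)%E.
  rewrite (@ge0_integral_affine a b _ a0 (measurable_funepos mfp))//.
  by congr (_ * _)%E; apply: eq_integral => x _; exact: gp.
have hn : (\int[mu]_x (EFin \o f)^\- x = `|a|%:E * \int[mu]_x (EFin \o g)^\- x)%E.
  rewrite (@ge0_integral_affine a b _ a0 (measurable_funeneg mfp))//.
  by congr (_ * _)%E; apply: eq_integral => x _; exact: gn.
have h1 := integrable_pos_fin_num measurableT if2.
have h2 := integrable_neg_fin_num measurableT if2.
have -> : \int[mu]_x f x = fine (\int[mu]_x (EFin \o f)^\+ x - \int[mu]_x (EFin \o f)^\- x)%E.
  by rewrite /Rintegral integralE.
have -> : \int[mu]_x f (a * x + b) = fine (\int[mu]_x (EFin \o g)^\+ x - \int[mu]_x (EFin \o g)^\- x)%E.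
  by rewrite /Rintegral integralE.
by rewrite hp hn -(fineK h1) -(fineK h2) -!EFinM -!EFinB/= mulrBr.
Qed.

End affine_change.

Section fubini_conv.
Context {R : realType}.
Implicit Types (f g : R -> R).

(** Tonelli, with the inner integrals dominated by [G], gives integrability on the product. The rest
    passes between extended and real integrals. *)
Lemma fubini_dom (F : R * R -> R) (G : R -> R) :
  measurable_fun setT F -> L1 G ->
  (forall y, (\int[mu]_x `|F (x, y)|%:E <= (G y)%:E)%E) ->
  [/\ L1 (fun x => \int[mu]_y F (x, y)), L1 (fun y => \int[mu]_x F (x, y)) &
   \int[mu]_x \int[mu]_y F (x, y) = \int[mu]_y \int[mu]_x F (x, y)].
Proof.
move=> mF iG FG.
have iF : (product_measure1 (@lebesgue_measure R) (@lebesgue_measure R)).-integrable setT (EFin \o F).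
  apply/integrable21ltyP; first exact/measurable_EFinP.
  have /L1P[mG] := iG; apply: le_lt_trans; apply: ge0_le_integral => //.
  - by move=> y _; exact: integral_ge0.
  - have := @measurable_fun_fubini_tonelli_G _ _ _ _ R (@lebesgue_measure R) (fun z => `|F z|%:E).
    by apply => //; do 2 apply: measurableT_comp => //.
  - by do 2 apply: measurableT_comp => //.
  - move=> y _; apply: (le_trans (FG y)); rewrite lee_fin; exact: ler_norm.
have fin1 := integrable_fubini_F iF.
have fin2 : (@lebesgue_measure R).-integrable setT (fubini_G (@lebesgue_measure R) (EFin \o F)).
  apply: (le_integrable _ _ _ iG) => //; first by apply: (measurable_fubini_G iF).
  move=> y _; apply: (@le_trans _ _ (G y)%:E); last by rewrite lee_fin ler_norm.
  apply: le_trans (FG y); apply: le_abse_integral => //.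
  by apply/measurable_EFinP; apply: (measurableT_comp mF); exact: measurable_fun_pair.
have E1 : (fun x => (\int[mu]_y F (x, y))%:E) = EFin \o fine \o (fubini_F (@lebesgue_measure R) (EFin \o F)) by [].
have E2 : (fun y => (\int[mu]_x F (x, y))%:E) = EFin \o fine \o (fubini_G (@lebesgue_measure R) (EFin \o F)) by [].
(* [fine] replaces infinite values by 0; an integrable [h] is infinite only on a null set, so its
   integral does not change. *)
have finL (h : R -> \bar R) : (@lebesgue_measure R).-integrable setT h ->
    L1 (fine \o h) /\ \int[mu]_x (fine (h x)) = fine (\int[mu]_x h x)%E.
  move=> ih.
  have mh : measurable_fun setT (EFin \o (fine \o h)).
    apply/measurable_EFinP; apply: measurableT_comp; last exact: (measurable_int mu).
    exact: fine_measurable.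
  have i1 : L1 (fine \o h).
    by apply: le_integrable ih => // x _ /=; case: (h x) => [r| |] /=; rewrite ?normr0 ?leey ?lexx.
  split=> //; congr fine; apply: ae_eq_integral => //.
  - exact: (measurable_int mu).
  - by apply: filterS (integrable_ae measurableT ih) => x /(_ Logic.I) hx _ /=; rewrite fineK.
have [? e1] := finL _ fin1; have [? e2] := finL _ fin2.
split => //; rewrite e1 e2; congr fine; exact: (Fubini iF).
Qed.

Lemma L1D f g : L1 f -> L1 g -> L1 (fun x => f x + g x).
Proof. by move=> fi gi; exact: (integrableD measurableT fi gi). Qed.

Lemma L1Zl (k : R) f : L1 f -> L1 (fun x => k * f x).
Proof. by move=> fi; exact: (integrableZl measurableT k fi). Qed.

Lemma L1_norm f : L1 f -> L1 (fun x => `|f x|).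
Proof. exact: integrable_norm. Qed.

Lemma L1_le f g : measurable_fun setT f -> (forall x, `|f x| <= g x) -> L1 g -> L1 f.
Proof.
move=> mf fg ig; apply: le_integrable ig => //; first exact/measurable_EFinP.
by move=> x _ /=; rewrite lee_fin (le_trans (fg x))// ler_norm.
Qed.

Lemma L1_measurable f : L1 f -> measurable_fun setT f.
Proof. by case/L1P. Qed.

Lemma L1_EFin f : L1 f -> (\int[mu]_x (f x)%:E = (\int[mu]_x f x)%:E)%E.
Proof. by move=> fi; rewrite /Rintegral fineK//; exact: integrable_fin_num. Qed.

Lemma L1_bounded f (h : R -> R) (M : R) : measurable_fun setT h -> (forall x, `|h x| <= M) ->
  L1 f -> L1 (fun x => h x * f x).
Proof.
move=> mh hM fi; apply: (@L1_le _ (fun x => M * `|f x|)).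
- by apply: measurable_funM => //; exact: L1_measurable.
- by move=> x; rewrite normrM ler_wpM2r.
- exact/L1Zl/L1_norm.
Qed.

(** Default value: the positive or the negative part has an infinite integral, hence the difference
    is infinite and [fine] sends it to 0. *)
Lemma Rintegral_notL1 f : measurable_fun setT f -> ~ L1 f -> \int[mu]_x f x = 0.
Proof.
move=> mf nf; have mf' : measurable_fun setT (EFin \o f) by exact/measurable_EFinP.
rewrite /Rintegral integralE.
have hp : (0 <= \int[mu]_x (EFin \o f)^\+ x)%E by apply: integral_ge0.
have hn : (0 <= \int[mu]_x (EFin \o f)^\- x)%E by apply: integral_ge0.
have : ~ ((\int[mu]_x (EFin \o f)^\+ x < +oo)%E /\ (\int[mu]_x (EFin \o f)^\- x < +oo)%E).
  move=> [h1 h2]; apply: nf; apply/integrableP; split => //.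
  have -> : (fun x => `|(EFin \o f) x|)%E = ((EFin \o f)^\+ \+ (EFin \o f)^\-)%E.
    by rewrite -[LHS]/(abse \o (EFin \o f)) -fune_abse.
  rewrite ge0_integralD//; [exact: lte_add_pinfty|exact: measurable_funepos|exact: measurable_funeneg].
rewrite -/(EFin \o f).
move: hp hn; case: (integral _ _ _) => [r| |]//; case: (integral _ _ _) => [r'| |]// _ _ []; split; exact: ltry.
Qed.

(** Without integrability both sides are 0. Identities between convolutions thus hold at every
    point, also on the null set where the inner integral diverges. *)
Lemma RintegralZl_meas (k : R) f : measurable_fun setT f ->
  \int[mu]_x (k * f x) = k * \int[mu]_x f x.
Proof.
move=> mf; have [fi|nf] := pselect (L1 f); first exact: RintegralZl.
rewrite (Rintegral_notL1 mf nf) mulr0.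
have [->|k0] := eqVneq k 0.
  by under eq_Rintegral do rewrite mul0r; rewrite Rintegral_cst// mul0r.
apply: Rintegral_notL1; first exact: measurable_funM.
move=> /(L1Zl k^-1) h; apply: nf; move: h; congr L1; apply/funext => x.
by rewrite mulKf.
Qed.

Definition conv f g (t : R) := \int[mu]_v (f (t - v) * g v).

Lemma measurable_conv_integrand f g : measurable_fun setT f -> measurable_fun setT g ->
  measurable_fun setT (fun z : R * R => f (z.1 - z.2) * g z.2).
Proof.
move=> mf mg; apply: measurable_funM.
  apply: (measurableT_comp mf); apply: measurable_funB; [exact: measurable_fst|exact: measurable_snd].
by apply: (measurableT_comp mg); exact: measurable_snd.
Qed.

Lemma L1_shift f (a : R) : L1 f -> L1 (fun x => f (x - a)).
Proof.
move=> fi; have := @L1_affine R 1 (- a) f (oner_neq0 _) fi.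
by congr L1; apply/funext => x; rewrite mul1r.
Qed.

Lemma integral_shift f (a : R) : L1 f -> \int[mu]_x f (x - a) = \int[mu]_x f x.
Proof.
move=> fi; rewrite (@integral_affine R 1 (- a) f (oner_neq0 _) fi) normr1 mul1r.
by congr Rintegral; apply/funext => x; rewrite mul1r.
Qed.

Lemma integral_refl f (a : R) : L1 f -> \int[mu]_x f (a - x) = \int[mu]_x f x.
Proof.
move=> fi; rewrite (@integral_affine R (-1) a f _ fi) ?oppr_eq0 ?oner_neq0// normrN1 mul1r.
by congr Rintegral; apply/funext => x; rewrite mulN1r addrC.
Qed.

Lemma L1_refl f (a : R) : L1 f -> L1 (fun x => f (a - x)).
Proof.
move=> fi; have := @L1_affine R (-1) a f _ fi; rewrite oppr_eq0 oner_neq0 => /(_ isT).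
by congr L1; apply/funext => x; rewrite mulN1r addrC.
Qed.

(** Fubini with a bounded weight. The weights [cos] and [sin] give the transform of a convolution;
    the indicator of an interval gives the iterated integrals of [integral_frac]. *)
Lemma conv_weight f g (w : R -> R) (M : R) : L1 f -> L1 g -> measurable_fun setT w ->
  (forall x, `|w x| <= M) ->
  [/\ L1 (conv f g), L1 (fun v => (\int[mu]_t (w t * f (t - v))) * g v) &
    \int[mu]_t (w t * conv f g t) = \int[mu]_v ((\int[mu]_t (w t * f (t - v))) * g v)].
Proof.
move=> fi gi mw wM.
have mf := L1_measurable fi; have mg := L1_measurable gi.
have mF := measurable_conv_integrand mf mg.
have M0 : 0 <= M by apply: le_trans (wM 0).
have dom (w' : R -> R) (M' : R) : measurable_fun setT w' -> (forall x, `|w' x| <= M') ->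
  [/\ L1 (fun t => \int[mu]_v (w' t * (f (t - v) * g v))),
   L1 (fun v => \int[mu]_t (w' t * (f (t - v) * g v))) &
   \int[mu]_t \int[mu]_v (w' t * (f (t - v) * g v)) = \int[mu]_v \int[mu]_t (w' t * (f (t - v) * g v))].
  move=> mw' wM'.
  apply: (@fubini_dom (fun z => w' z.1 * (f (z.1 - z.2) * g z.2)) (fun v => (M' * \int[mu]_x `|f x|) * `|g v|)).
  - apply: measurable_funM => //; apply: (measurableT_comp mw'); exact: measurable_fst.
  - exact/L1Zl/L1_norm.
  - move=> v /=.
    have i1 : L1 (fun t => M' * `|g v| * `|f (t - v)|) by apply/L1Zl/L1_norm/L1_shift.
    apply: (@le_trans _ _ (\int[mu]_t (M' * `|g v| * `|f (t - v)|)%:E)%E).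
      apply: ge0_le_integral => //.
      + do 2 apply: measurableT_comp => //.
        apply: measurable_funM => //; apply: measurable_funM => //.
        exact: L1_measurable (L1_shift v fi).
      + exact: (measurable_int mu).
      + move=> t _; rewrite lee_fin !normrM mulrA -mulrA (mulrC _ `|g v|) mulrA.
        by rewrite ler_wpM2r// ler_wpM2r.
    rewrite (L1_EFin i1) lee_fin RintegralZl//; last exact: L1_norm (L1_shift v fi).
    by rewrite (integral_shift v (L1_norm fi)) mulrAC.
(* The weight 1 gives the integrability of the convolution itself. *)
have c1 : L1 (fun t => \int[mu]_v (cst 1 t * (f (t - v) * g v))).
  by have [] := dom (cst 1) 1 _ _ => // x; rewrite /= normr1.
have [w1 w2 w3] := dom w M mw wM.
have E1 : (fun t => \int[mu]_v (cst 1 t * (f (t - v) * g v))) = conv f g.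
  by apply/funext => t; apply: eq_Rintegral => v _; rewrite mul1r.
have ci : L1 (conv f g) by rewrite -E1.
have E2 v : \int[mu]_t (w t * (f (t - v) * g v)) = (\int[mu]_t (w t * f (t - v))) * g v.
  rewrite -RintegralZr//; first by apply: eq_Rintegral => t _; rewrite mulrA.
  exact: (L1_bounded mw wM (L1_shift v fi)).
split=> //; first by rewrite -(funext E2).
have mF' t : measurable_fun setT (fun v : R => f (t - v) * g v).
  by apply: measurable_funM => //; apply: (measurableT_comp mf); exact: measurable_funB.
transitivity (\int[mu]_v \int[mu]_t (w t * (f (t - v) * g v))); last first.
  by apply: eq_Rintegral => v _; exact: E2.
by rewrite -w3; apply: eq_Rintegral => t _; rewrite RintegralZl_meas.
Qed.

End fubini_conv.

(** * Complex exponential and Laplace transform *)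

Section cexp.
Context {R : realType}.
Local Open Scope complex_scope.
Implicit Types (z w : R[i]) (b : R).

Definition cexp z : R[i] :=
  (expR (Re z) * cos (Im z)) +i* (expR (Re z) * sin (Im z)).

Lemma cexpD z w : cexp (z + w) = cexp z * cexp w.
Proof.
case: z w => [x y] [x' y']; rewrite /cexp/= expRD cosD sinD.
by apply/eqP; rewrite eq_complex/=; apply/andP; split; apply/eqP; ring.
Qed.

Lemma cexp0 : cexp 0 = 1.
Proof. by rewrite /cexp/= expR0 cos0 sin0 mulr1 mulr0. Qed.

Lemma cexp_neq0 z : cexp z != 0.
Proof.
have h : cexp z * cexp (- z) = 1 by rewrite -cexpD subrr cexp0.
by apply: contra_eq_neq h => ->; rewrite mul0r eq_sym oner_eq0.
Qed.

Lemma normc_cexp z : normc (cexp z) = expR (Re z).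
Proof.
rewrite /normc/= !exprMn -mulrDr cos2Dsin2 mulr1 sqrtr_sqr ger0_norm//.
Qed.

(* The principal logarithm for [0 < Re z] only. *)
Definition clog z : R[i] := ln (normc z) +i* atan (Im z / Re z).

Lemma clogK z : 0 < Re z -> cexp (clog z) = z.
Proof.
case: z => x y /= x0; rewrite /cexp/=.
have n0 : 0 < x ^+ 2 + y ^+ 2 by rewrite ltr_pwDl ?exprn_gt0 ?sqr_ge0.
have s0 : 0 < Num.sqrt (x ^+ 2 + y ^+ 2) by rewrite sqrtr_gt0.
rewrite lnK ?posrE//.
have c : cos (atan (y / x)) = x / Num.sqrt (x ^+ 2 + y ^+ 2).
  rewrite cos_atan.
  have -> : 1 + (y / x) ^+ 2 = (x ^+ 2 + y ^+ 2) / x ^+ 2 by field; lra.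
  rewrite sqrtrM ?ltW// sqrtrV ?sqr_ge0// sqrtr_sqr gtr0_norm// invfM invrK mulrC//.
have s : sin (atan (y / x)) = y / Num.sqrt (x ^+ 2 + y ^+ 2).
  have := atanK (y / x); rewrite /tan => /(congr1 (fun u => u * cos (atan (y / x)))).
  rewrite mulfVK; last by rewrite c mulf_neq0 ?invr_eq0 ?gt_eqF.
  by move=> ->; rewrite c; field; rewrite ?gt_eqF//.
rewrite c s; apply/eqP; rewrite eq_complex/=.
by apply/andP; split; apply/eqP; field; rewrite gt_eqF.
Qed.

Definition cpow z b : R[i] := cexp (b%:C * clog z).

Lemma cpowD z b b' : cpow z (b + b') = cpow z b * cpow z b'.
Proof. by rewrite /cpow -cexpD rmorphD mulrDl. Qed.

Lemma cpow1 z : 0 < Re z -> cpow z 1 = z.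
Proof. by move=> z0; rewrite /cpow mul1r clogK. Qed.

Lemma cpow0 z : cpow z 0 = 1.
Proof. by rewrite /cpow mul0r cexp0. Qed.

Lemma cpow_neq0 z b : cpow z b != 0. Proof. exact: cexp_neq0. Qed.

Lemma normc_cpow z b : 0 < Re z -> normc (cpow z b) = normc z `^ b.
Proof.
move=> z0; rewrite normc_cexp/= mul0r subr0 /powR gt_eqF//.
by case: z z0 => x y /= x0; rewrite sqrtr_gt0 ltr_pwDl ?exprn_gt0 ?sqr_ge0.
Qed.

Lemma cpow_real (x : R) b : 0 < x -> cpow x%:C b = (x `^ b)%:C.
Proof.
move=> x0; rewrite /cpow/cexp/clog/= !mul0r atan0 !mulr0 addr0 subr0 cos0 sin0 mulr0 mulr1.
rewrite (expr0n R 2)/= addr0 sqrtr_sqr gtr0_norm// /powR gt_eqF//.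
Qed.

Lemma cexp_real (x : R) : cexp x%:C = (expR x)%:C.
Proof. by rewrite /cexp/= cos0 sin0 mulr0 mulr1. Qed.

End cexp.

Section lap.
Context {R : realType}.
Local Open Scope complex_scope.
Implicit Types (f g : R -> R) (s : R[i]).

Definition damp (c : R) f (t : R) : R := expR (- (c * t)) * f t.
Definition lapable (c : R) f := L1 (damp c f).
Definition wcos (w : R) (t : R) : R := cos (w * t).
Definition wsin (w : R) (t : R) : R := sin (w * t).

(** Two-sided, and split into real and imaginary parts so that real integrals suffice. It is the
    usual transform on functions that vanish for [t <= 0], such as [pker], [heaviside] or those
    built with [causal]. *)
Definition lap s f : R[i] :=
  (\int[mu]_t (wcos (Im s) t * damp (Re s) f t)) -i*
  (\int[mu]_t (wsin (Im s) t * damp (Re s) f t)).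

Lemma measurable_wcos w : measurable_fun setT (wcos w).
Proof.
apply: (@measurableT_comp _ _ _ _ _ _ cos) => //
; apply: continuous_measurable_fun; exact: continuous_cos.
Qed.

Lemma measurable_wsin w : measurable_fun setT (wsin w).
Proof.
apply: (@measurableT_comp _ _ _ _ _ _ sin) => //
; apply: continuous_measurable_fun; exact: continuous_sin.
Qed.

Lemma wcos_le1 w t : `|wcos w t| <= 1. Proof. exact: cos_max. Qed.
Lemma wsin_le1 w t : `|wsin w t| <= 1. Proof. exact: sin_max. Qed.

Lemma measurable_exp_lin (c : R) : measurable_fun setT (fun t : R => expR (- (c * t))).
Proof. by apply: measurableT_comp => //; apply: measurableT_comp => //. Qed.

Lemma lapable_measurable c f : lapable c f -> measurable_fun setT f.
Proof.
move=> /L1_measurable h.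
have -> : f = (fun t => expR (- (- c * t)) * damp c f t).
  by apply/funext => t; rewrite /damp mulrA -expRD mulNr opprK subrr expR0 mul1r.
by apply: measurable_funM => //; exact: measurable_exp_lin.
Qed.

Lemma L1_wcos w f : L1 f -> L1 (fun t => wcos w t * f t).
Proof. by move=> fi; apply: (@L1_bounded R f _ 1) => //; [exact: measurable_wcos|exact: wcos_le1]. Qed.

Lemma L1_wsin w f : L1 f -> L1 (fun t => wsin w t * f t).
Proof. by move=> fi; apply: (@L1_bounded R f _ 1) => //; [exact: measurable_wsin|exact: wsin_le1]. Qed.

Lemma dampD c f g : damp c (fun t => f t + g t) = fun t => damp c f t + damp c g t.
Proof. by apply/funext => t; rewrite /damp mulrDr. Qed.

Lemma dampZ c k f : damp c (fun t => k * f t) = fun t => k * damp c f t.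
Proof. by apply/funext => t; rewrite /damp mulrCA. Qed.

Lemma lapableD c f g : lapable c f -> lapable c g -> lapable c (fun t => f t + g t).
Proof. by move=> fi gi; rewrite /lapable dampD; exact: L1D. Qed.

Lemma lapableZ c k f : lapable c f -> lapable c (fun t => k * f t).
Proof. by move=> fi; rewrite /lapable dampZ; exact: L1Zl. Qed.

Lemma lapD s f g : lapable (Re s) f -> lapable (Re s) g ->
  lap s (fun t => f t + g t) = lap s f + lap s g.
Proof.
move=> fi gi; apply/eqP; rewrite eq_complex/= dampD; apply/andP; split; apply/eqP.
  rewrite -RintegralD//; [|exact: L1_wcos|exact: L1_wcos].
  by apply: eq_Rintegral => t _; rewrite mulrDr.
rewrite -opprD -RintegralD//; [|exact: L1_wsin|exact: L1_wsin].
by congr (- _); apply: eq_Rintegral => t _; rewrite mulrDr.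
Qed.

Lemma lapZ s k f : lapable (Re s) f ->
  lap s (fun t => k * f t) = k%:C * lap s f.
Proof.
move=> fi; apply/eqP; rewrite eq_complex/= dampZ !mul0r subr0 addr0; apply/andP; split; apply/eqP.
  rewrite -RintegralZl//; last exact: L1_wcos.
  by apply: eq_Rintegral => t _; rewrite mulrCA.
rewrite mulrN -RintegralZl//; last exact: L1_wsin.
by congr (- _); apply: eq_Rintegral => t _; rewrite mulrCA.
Qed.

Lemma damp_conv c f g : measurable_fun setT f -> measurable_fun setT g ->
  damp c (conv f g) = conv (damp c f) (damp c g).
Proof.
move=> mf mg; apply/funext => t; rewrite /damp /conv -RintegralZl_meas.
  apply: eq_Rintegral => v _; rewrite mulrACA -expRD.
  by congr (expR _ * _); ring.
apply: measurable_funM => //; apply: (measurableT_comp mf); exact: measurable_funB.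
Qed.

Lemma lapable_conv c f g : lapable c f -> lapable c g -> lapable c (conv f g).
Proof.
move=> fi gi; rewrite /lapable damp_conv; try exact: lapable_measurable; eauto using lapable_measurable.
by have [] := conv_weight fi gi (measurable_wcos 0) (wcos_le1 0).
Qed.

Lemma integral_w_shift f (w : R -> R) (v : R) (M : R) : measurable_fun setT w ->
  (forall t, `|w t| <= M) -> L1 f ->
  \int[mu]_t (w t * f (t - v)) = \int[mu]_t (w (t + v) * f t).
Proof.
move=> mw wM fi.
have h : L1 (fun t => w (t + v) * f t).
  apply: (@L1_bounded R f _ M) => //; apply: (measurableT_comp mw); exact: measurable_funD.
by rewrite -(integral_shift v h); apply: eq_Rintegral => t _; rewrite subrK.
Qed.

Lemma integral_wcos_shift f (w v : R) : L1 f -> \int[mu]_t (wcos w t * f (t - v)) =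
  cos (w * v) * (\int[mu]_t (wcos w t * f t)) - sin (w * v) * (\int[mu]_t (wsin w t * f t)).
Proof.
move=> fi; rewrite (integral_w_shift v (measurable_wcos w) (wcos_le1 w) fi).
rewrite -RintegralZl//; last exact: L1_wcos.
rewrite -RintegralZl//; last exact: L1_wsin.
rewrite -RintegralB//; [|exact: L1Zl (L1_wcos _ _)|exact: L1Zl (L1_wsin _ _)].
by apply: eq_Rintegral => t _; rewrite /wcos /wsin mulrDr cosD; ring.
Qed.

Lemma integral_wsin_shift f (w v : R) : L1 f -> \int[mu]_t (wsin w t * f (t - v)) =
  sin (w * v) * (\int[mu]_t (wcos w t * f t)) + cos (w * v) * (\int[mu]_t (wsin w t * f t)).
Proof.
move=> fi; rewrite (integral_w_shift v (measurable_wsin w) (wsin_le1 w) fi).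
rewrite -RintegralZl//; last exact: L1_wcos.
rewrite -RintegralZl//; last exact: L1_wsin.
rewrite -RintegralD//; [|exact: L1Zl (L1_wcos _ _)|exact: L1Zl (L1_wsin _ _)].
by apply: eq_Rintegral => t _; rewrite /wcos /wsin mulrDr sinD; ring.
Qed.

Lemma lap_conv s f g : lapable (Re s) f -> lapable (Re s) g ->
  lap s (conv f g) = lap s f * lap s g.
Proof.
case: s => c w /= fi gi; apply/eqP; rewrite eq_complex/=.
rewrite damp_conv; eauto using lapable_measurable.
have [_ _ ->] := conv_weight fi gi (measurable_wcos w) (wcos_le1 w).
have [_ _ ->] := conv_weight fi gi (measurable_wsin w) (wsin_le1 w).
under eq_Rintegral do rewrite integral_wcos_shift//.
under [X in _ && (- X == _)]eq_Rintegral do rewrite integral_wsin_shift//.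
set C := (\int[mu]_t (wcos w t * damp c f t)).
set S := (\int[mu]_t (wsin w t * damp c f t)).
have gc := L1_wcos w gi; have gs := L1_wsin w gi.
apply/andP; split; apply/eqP.
  rewrite mulrNN -!RintegralZl// -RintegralB//; [|exact: L1Zl|exact: L1Zl].
  by apply: eq_Rintegral => t _; rewrite /wcos /wsin; ring.
rewrite mulrN mulNr -!RintegralZl// -opprD -RintegralD//; [|exact: L1Zl|exact: L1Zl].
by congr (- _); apply: eq_Rintegral => t _; rewrite /wcos /wsin; ring.
Qed.

Lemma damp_shift c f (v : R) :
  damp c (fun t => f (t - v)) = fun t => expR (- (c * v)) * damp c f (t - v).
Proof.
by apply/funext => t; rewrite /damp mulrA -expRD; congr (expR _ * _); ring.
Qed.

Lemma lapable_shift c f (v : R) : lapable c f -> lapable c (fun t => f (t - v)).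
Proof. by move=> fi; rewrite /lapable damp_shift; exact/L1Zl/L1_shift. Qed.

Lemma lap_shift s f (v : R) : lapable (Re s) f ->
  lap s (fun t => f (t - v)) = cexp (- (s * v%:C)) * lap s f.
Proof.
case: s => c w /= fi; apply/eqP; rewrite eq_complex/= damp_shift.
rewrite !mulr0 subr0 add0r cosN sinN.
set e := expR _.
under eq_Rintegral do rewrite mulrCA.
under [X in _ && (- X == _)]eq_Rintegral do rewrite mulrCA.
rewrite !RintegralZl//; [|exact: L1_wsin (L1_shift v fi)|exact: L1_wcos (L1_shift v fi)].
by rewrite integral_wcos_shift// integral_wsin_shift//; apply/andP; split; apply/eqP; ring.
Qed.

End lap.

(** * Improper integrals of power functions at 0 *)

Section improper.
Context {R : realType}.
Implicit Types (F f : R -> R).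

Lemma continuous_FTC2_derive F f (a b : R) : a < b ->
  (forall t : R, a <= t <= b -> {for t, continuous f}) ->
  (forall t : R, a <= t <= b -> is_derive t 1 F (f t)) ->
  (\int[mu]_(x in `[a, b]) (f x)%:E = (F b)%:E - (F a)%:E)%E.
Proof.
move=> ab cf dF.
have cF t : a <= t <= b -> {for t, continuous F}.
  by move=> /dF h; apply/differentiable_continuous/derivable1_diffP; exact: ex_derive.
apply: continuous_FTC2 => //.
- apply: continuous_in_subspaceT => t; rewrite inE/= in_itv/=; exact: cf.
- split.
  + move=> t; rewrite in_itv/= => /andP[a1 a2].
    by have h := dF t; apply: ex_derive; apply: h; rewrite !ltW.
  + by apply: cvg_at_right_filter; apply: cF; rewrite lexx ltW.
  + by apply: cvg_at_left_filter; apply: cF; rewrite lexx ltW.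
- move=> t; rewrite in_itv/= => /andP[a1 a2].
  by rewrite derive1E; have h := dF t; apply: derive_val; apply: h; rewrite !ltW.
Qed.

(** Monotone convergence along [[b / (n + 1), b]], where the fundamental theorem of calculus gives
    [F b - F (b / (n + 1))], bounded by [M]. *)
Lemma ge0_integrable_right F f (b M : R) : 0 < b ->
  (forall t : R, 0 < t <= b -> 0 <= f t) ->
  (forall t : R, 0 < t <= b -> {for t, continuous f}) ->
  (forall t : R, 0 < t <= b -> is_derive t 1 F (f t)) ->
  (forall t : R, 0 < t <= b -> F b - F t <= M) ->
  (@lebesgue_measure R).-integrable `]0, b] (EFin \o f).
Proof.
move=> b0 f0 cf dF FM.
pose D n : set R := `[b * (n.+1%:R)^-1, b]%classic.
have Dsub n : D n `<=` `]0, b]%classic.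
  move=> t; rewrite /D/= !in_itv/= => /andP[h ->]; rewrite andbT (lt_le_trans _ h)//.
  by rewrite mulr_gt0// invr_gt0.
have bD : \bigcup_n D n = `]0, b]%classic.
  apply/seteqP; split=> [t [n _]|t]; first exact: Dsub.
  rewrite /= in_itv/= => /andP[t0 tb].
  exists (Num.truncn (b / t)) => //; rewrite /D/= in_itv/= tb andbT.
  by rewrite ler_pdivrMr// mulrC -ler_pdivrMr// ltW// truncnS_gt.
have mf : measurable_fun `]0, b] f.
  rewrite -bD; apply/measurable_fun_bigcup; first by move=> n; exact: measurable_itv.
  move=> n; apply: subspace_continuous_measurable_fun => //; first exact: measurable_itv.
  apply: continuous_in_subspaceT => t; rewrite inE => /Dsub; rewrite /= in_itv/=; exact: cf.
apply/integrableP; split; first exact/measurable_EFinP.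
have -> : (\int[mu]_(x in `]0%R, b]) `|(EFin \o f) x| = \int[mu]_(x in `]0%R, b]) (f x)%:E)%E.
  by apply: eq_integral => t; rewrite inE/= in_itv/= => h; rewrite ger0_norm// f0.
have cv : (\int[mu]_(x in D i) (f x)%:E @[i --> \oo] --> \int[mu]_(x in `]0%R, b]) (f x)%:E)%E.
  rewrite -bD; apply: ge0_nondecreasing_set_cvg_integral.
  - move=> m n mn; rewrite subsetEset => t; rewrite /D/= !in_itv/= => /andP[h ->]; rewrite andbT.
    by apply: le_trans h; rewrite ler_pM2l// lef_pV2 ?posrE// ler_nat.
  - by move=> n; exact: measurable_itv.
  - by move=> n; apply/measurable_EFinP; apply: measurable_funS mf => //; exact: Dsub.
  - by move=> n t /Dsub; rewrite /= in_itv/= lee_fin; exact: f0.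
apply: (@le_lt_trans _ _ (`|M|)%:E); last exact: ltry.
rewrite -(cvg_lim _ cv)//; apply: lime_le; first by apply/cvg_ex; eexists; exact: cv.
near=> n; have hn : b * (n.+1%:R)^-1 < b.
  rewrite gtr_pMr// invf_lt1// ltr1n ltnS; near: n; exact: nbhs_infty_gt.
have h0 : 0 < b * (n.+1%:R)^-1 by rewrite mulr_gt0// invr_gt0.
have -> : (\int[mu]_(x in D n) (f x)%:E = (F b)%:E - (F (b * (n.+1%:R)^-1))%:E)%E.
  apply: continuous_FTC2_derive => //.
  - by move=> t /andP[h1 h2]; apply: cf; rewrite h2 (lt_le_trans h0).
  - by move=> t /andP[h1 h2]; apply: dF; rewrite h2 (lt_le_trans h0).
by rewrite -EFinB lee_fin (le_trans (FM _ _))// ?ler_norm// h0 ltW.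
Unshelve. all: by end_near. Qed.

Lemma integrable_powR (m b : R) : 0 < m -> 0 < b ->
  (@lebesgue_measure R).-integrable `]0, b] (EFin \o (fun t => t `^ (m - 1))).
Proof.
move=> m0 b0; apply: (@ge0_integrable_right (fun t => m^-1 * t `^ m) _ _ (m^-1 * b `^ m)) => //.
- by move=> t _; exact: powR_ge0.
- move=> t /andP[t0 _]; apply/differentiable_continuous/derivable1_diffP.
  by apply: ex_derive; exact: is_derive1_powR.
- move=> t /andP[t0 _]; have h := is_derive1_powR m t0.
  apply: is_derive_eq; rewrite -[LHS]/(m^-1 * (m * t `^ (m - 1))) mulKf// gt_eqF//.
- by move=> t _; rewrite gerBl mulr_ge0 ?invr_ge0 ?powR_ge0// ltW.
Qed.

End improper.

(** * Differentiation of Laplace integrals with respect to the parameter *)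

Section pker.
Context {R : realType}.
Implicit Types (m c a b w t : R) (f : R -> R).

Lemma is_derive_cos_comp (g : R -> R) (x g' : R) : is_derive x 1 g g' ->
  is_derive x 1 (fun p => cos (g p)) (- sin (g x) * g').
Proof. by move=> h; apply: (@is_derive1_comp R cos g). Qed.

Lemma is_derive_sin_comp (g : R -> R) (x g' : R) : is_derive x 1 g g' ->
  is_derive x 1 (fun p => sin (g p)) (cos (g x) * g').
Proof. by move=> h; apply: (@is_derive1_comp R sin g). Qed.

Lemma is_derive_expR_comp (g : R -> R) (x g' : R) : is_derive x 1 g g' ->
  is_derive x 1 (fun p => expR (g p)) (expR (g x) * g').
Proof. by move=> h; apply: (@is_derive1_comp R expR g). Qed.

Lemma is_derive_mul (f g : R -> R) (x f' g' : R) : is_derive x 1 f f' -> is_derive x 1 g g' ->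
  is_derive x 1 (fun p => f p * g p) (f x * g' + g x * f').
Proof. by move=> h1 h2; exact: (@is_deriveM R R f g x 1 f' g' h1 h2). Qed.

Lemma is_derive_wcos_damp a b c w t (y p : R) :
  is_derive p 1 (fun p : R => wcos (w + p * b) t * (expR (- ((c + p * a) * t)) * y))
   (- b * (wsin (w + p * b) t * (expR (- ((c + p * a) * t)) * (t * y)))
    - a * (wcos (w + p * b) t * (expR (- ((c + p * a) * t)) * (t * y)))).
Proof.
rewrite /wcos /wsin.
have h1 : is_derive p 1 (fun p : R => (w + p * b) * t) (b * t).
  by apply: is_derive_eq; rewrite -![_ *: _]/(_ * _); ring.
have h2 : is_derive p 1 (fun p : R => - ((c + p * a) * t)) (- (a * t)).
  by apply: is_derive_eq; rewrite -![_ *: _]/(_ * _); ring.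
have h3 := is_derive_cos_comp h1.
have h4 := is_derive_mul (is_derive_expR_comp h2) (is_derive_cst y p 1).
have h5 := is_derive_mul h3 h4.
apply: is_derive_eq h5 _; rewrite /=; ring.
Qed.

Lemma is_derive_wsin_damp a b c w t (y p : R) :
  is_derive p 1 (fun p : R => wsin (w + p * b) t * (expR (- ((c + p * a) * t)) * y))
   (b * (wcos (w + p * b) t * (expR (- ((c + p * a) * t)) * (t * y)))
    - a * (wsin (w + p * b) t * (expR (- ((c + p * a) * t)) * (t * y)))).
Proof.
rewrite /wcos /wsin.
have h1 : is_derive p 1 (fun p : R => (w + p * b) * t) (b * t).
  by apply: is_derive_eq; rewrite -![_ *: _]/(_ * _); ring.
have h2 : is_derive p 1 (fun p : R => - ((c + p * a) * t)) (- (a * t)).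
  by apply: is_derive_eq; rewrite -![_ *: _]/(_ * _); ring.
have h3 := is_derive_sin_comp h1.
have h4 := is_derive_mul (is_derive_expR_comp h2) (is_derive_cst y p 1).
have h5 := is_derive_mul h3 h4.
apply: is_derive_eq h5 _; rewrite /=; ring.
Qed.

(** Differentiation under the integral sign along [p |-> (c + i w) + p (a + i b)]. The cosine and
    sine integrals share their domination, hence the disjunction on [F]. *)
Lemma is_derive_lap_path (F F' : R -> R -> R) f a b c w :
  (forall t p : R, F p t = wcos (w + p * b) t * damp (c + p * a) f t /\
     F' p t = - b * (wsin (w + p * b) t * damp (c + p * a) (fun t => t * f t) t)
        - a * (wcos (w + p * b) t * damp (c + p * a) (fun t => t * f t) t)) \/
  (forall t p : R, F p t = wsin (w + p * b) t * damp (c + p * a) f t /\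
     F' p t = b * (wcos (w + p * b) t * damp (c + p * a) (fun t => t * f t) t)
        - a * (wsin (w + p * b) t * damp (c + p * a) (fun t => t * f t) t)) ->
  0 < c -> (forall t, t <= 0 -> f t = 0) ->
  (forall c, 0 < c -> lapable c f) -> (forall c, 0 < c -> lapable c (fun t => t * f t)) ->
  is_derive (0 : R) 1 (fun p => \int[mu]_t (F p t)) (\int[mu]_t (F' 0 t)).
Proof.
move=> FE c0 f0 lf ltf.
(* For [|p| < e] the damping rate [c + p * a] stays above [c / 2], which gives the integrable bound
   [G]. *)
pose e := (c / 2) / (1 + `|a|).
have a1 : 0 < 1 + `|a| by rewrite ltr_wpDr.
have e0 : 0 < e by rewrite !divr_gt0.
have Ie (p : R) : `](- e), e[%classic p -> c / 2 <= c + p * a.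
  rewrite /= in_itv/= -ltr_norml => pe.
  have : `|p * a| <= e * (1 + `|a|).
    by rewrite normrM ler_pM// ?ltW// ltrDr.
  rewrite /e mulfVK ?gt_eqF// ler_norml => /andP[h _]; lra.
pose G t := (`|b| + `|a|) * `|damp (c / 2) (fun t => t * f t) t|.
have dF (p t : R) : is_derive p 1 (F ^~ t) (F' p t).
  case: FE => FE.
    have -> : F ^~ t = fun p => wcos (w + p * b) t * damp (c + p * a) f t.
      by apply/funext => q; rewrite (FE t q).1.
    by rewrite (FE t p).2; exact: is_derive_wcos_damp.
  have -> : F ^~ t = fun p => wsin (w + p * b) t * damp (c + p * a) f t.
    by apply/funext => q; rewrite (FE t q).1.
  by rewrite (FE t p).2; exact: is_derive_wsin_damp.
have p1 (p t : R) : partial1of2 F p t = F' p t.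
  by rewrite partial1of2E; have h := dF p t; exact: derive_val.
have I0 : `](- e), e[%classic (0 : R) by rewrite /= in_itv/= oppr_lt0 e0.
have iF (p : R) : `](- e), e[%classic p -> L1 (F p).
  move=> /Ie pe; have cp : 0 < c + p * a by apply: lt_le_trans pe; rewrite divr_gt0.
  case: FE => FE.
    have -> : F p = fun t => wcos (w + p * b) t * damp (c + p * a) f t.
      by apply/funext => q; rewrite (FE q p).1.
    exact/L1_wcos/lf.
  have -> : F p = fun t => wsin (w + p * b) t * damp (c + p * a) f t.
    by apply/funext => q; rewrite (FE q p).1.
  exact/L1_wsin/lf.
have G0 t : 0 <= G t by rewrite mulr_ge0// addr_ge0.
have iG : L1 G by apply/L1Zl/L1_norm/ltf; rewrite divr_gt0.
have bG (p t : R) : `](- e), e[%classic p -> [set: R] t -> `|partial1of2 F p t| <= G t.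
  move=> /Ie pe _; rewrite p1.
  (* A larger rate damps more only for positive [t]; elsewhere [f] vanishes. *)
  have hd : `|damp (c + p * a) (fun t => t * f t) t| <= `|damp (c / 2) (fun t => t * f t) t|.
    rewrite /damp; have [t0|t0] := leP t 0; first by rewrite f0// !mulr0.
    rewrite !normrM ler_wpM2r ?mulr_ge0// !ger0_norm ?expR_ge0//.
    by rewrite ler_expR lerN2 ler_wpM2r// ltW.
  have hh (u v x y z B A : R) : `|u| <= 1 -> `|v| <= 1 -> `|z| <= y ->
      `|B * (u * z) - A * (v * z)| <= (`|B| + `|A|) * y.
    move=> u1 v1 zy; rewrite mulrDl (le_trans (ler_normB _ _))// lerD// !normrM ler_wpM2l//.
      by rewrite -[leRHS]mul1r ler_pM.
    by rewrite -[leRHS]mul1r ler_pM.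
  have wc := wcos_le1 (w + p * b) t; have ws := wsin_le1 (w + p * b) t.
  case: FE => FE; rewrite (FE t p).2 /G.
    by rewrite -(normrN b); exact: hh.
  exact: hh.
have D : derivable (fun p => \int[mu]_t (F p t)) 0 1.
  apply: (@derivable_under_integral R _ _ (@lebesgue_measure R) F setT measurableT 0 (- e) e I0 iF _ G G0 iG bG).
  by move=> p t _ _; have h := dF p t; exact: ex_derive.
apply: DeriveDef => //; rewrite -derive1E.
rewrite (@differentiation_under_integral R _ _ (@lebesgue_measure R) F setT measurableT 0 (- e) e I0 iF _ G G0 iG bG).
  by apply: eq_Rintegral => t _; rewrite -p1.
by move=> p t _ _; have h := dF p t; exact: ex_derive.
Qed.

End pker.

(** * Laplace transform of power kernels *)

Section kernel.
Context {R : realType}.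
Local Open Scope complex_scope.
Implicit Types (m a b c w t : R) (f : R -> R).

(** Up to the factor [1 / Gamma m], the kernel of the fractional integral of order [m]. The guard
    makes it causal, as [powR] does not vanish on negative bases. *)
Definition pker m t := if 0 < t then t `^ (m - 1) else 0.

Lemma pker_ge0 m t : 0 <= pker m t.
Proof. by rewrite /pker; case: ifP => // _; exact: powR_ge0. Qed.

Lemma pker_le0 m t : t <= 0 -> pker m t = 0.
Proof. by rewrite /pker ltNge => ->. Qed.

Lemma measurable_pker m : measurable_fun [set: R] (pker m).
Proof.
apply: measurable_fun_if => //; first exact: measurable_fun_ltr.
apply: measurable_funTS; exact: measurable_powR.
Qed.

Definition heaviside t : R := if 0 < t then 1 else 0.

Lemma pker1 : pker 1 = heaviside.
Proof. by apply/funext => t; rewrite /pker /heaviside subrr powRr0. Qed.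

(** The damped step function is the exponential density divided by [c], almost everywhere. *)
Lemma lapable_heaviside c : 0 < c -> lapable c heaviside.
Proof.
move=> c0; have h := integrable_exponential_pdf c0.
apply: (@L1_le R _ (fun t => c^-1 * exponential_pdf c t)).
- apply: measurable_funM; first exact: measurable_exp_lin.
  by rewrite -pker1; exact: measurable_pker.
- move=> t; rewrite /damp /heaviside; case: ifPn => t0; last first.
    rewrite mulr0 normr0; apply: mulr_ge0; [by rewrite invr_ge0 ltW|exact: (exponential_pdf_ge0 (ltW c0))].
  rewrite exponential_pdfE ?(ltW t0)// mulKf ?gt_eqF// mulr1 ger0_norm ?expR_ge0//.
  by rewrite mulNr.
- by apply: L1Zl; exact: h.
Qed.

(** Near 0 the power is integrable since [m > 0]; beyond 1 it is at most 1 since [m <= 1], and the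
    exponential suffices. *)
Lemma lapable_pker m c : 0 < m <= 1 -> 0 < c -> lapable c (pker m).
Proof.
move=> /andP[m0 m1] c0.
have md : measurable_fun setT (damp c (pker m)).
  by apply: measurable_funM; [exact: measurable_exp_lin|exact: measurable_pker].
have i1 : L1 ((fun t : R => t `^ (m - 1)) \_ `]0, 1]).
  have := integrable_powR m0 (@ltr01 R).
  by rewrite integrable_mkcond// restrict_EFin.
apply: (@L1_le R _ (fun t => ((fun t : R => t `^ (m - 1)) \_ `]0, 1]) t + damp c heaviside t)) => //; last first.
  by apply: L1D => //; exact: lapable_heaviside.
move=> t; rewrite /damp /pker /heaviside ger0_norm; last first.
  by rewrite mulr_ge0 ?expR_ge0//; exact: (pker_ge0 m).
case: ifPn => t0; last first.
  by rewrite !mulr0 addr0 patchE; case: ifP => // _; exact: powR_ge0.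
rewrite patchE mem_setE in_itv/= t0/=; case: ifPn => t1.
  rewrite ler_wpDr ?mulr_ge0 ?expR_ge0//.
  by rewrite ler_piMl ?powR_ge0// -expR0 ler_expR oppr_le0 mulr_ge0 ?(ltW c0) ?(ltW t0).
rewrite add0r ler_wpM2l ?expR_ge0//.
rewrite -[leRHS](powRr0 t) ler_powR//; last by rewrite subr_le0.
by rewrite ltW// ltNge.
Qed.

Lemma mul_pker m : 0 < m -> (fun t => t * pker m t) = pker (m + 1).
Proof.
move=> m0; apply/funext => t; rewrite /pker; case: ifPn => t0; last by rewrite mulr0.
by rewrite addrK mulr_powRB1// ltW.
Qed.

(** Half of the damping absorbs the factor [t]: [t exp (- c t / 2) <= 2 / c], from
    [1 + u <= exp u]. *)
Lemma lapable_mul_pker m c : 0 < m <= 1 -> 0 < c -> lapable c (fun t => t * pker m t).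
Proof.
move=> m01 c0.
have i1 : lapable (c / 2) (pker m) by apply: lapable_pker; rewrite ?divr_gt0.
apply: (@L1_le R _ (fun t => 2 / c * damp (c / 2) (pker m) t)); last exact: L1Zl.
  by apply: measurable_funM; [exact: measurable_exp_lin|rewrite mul_pker ?(andP m01).1//; exact: measurable_pker].
move=> t; rewrite /damp; have [t0|t0] := leP t 0.
  by rewrite pker_le0// !mulr0 normr0.
rewrite !mulrA ger0_norm; last by rewrite !mulr_ge0 ?expR_ge0 ?pker_ge0 ?(ltW t0).
rewrite ler_wpM2r ?pker_ge0//.
have -> : - (c * t) = - (c / 2 * t) + - (c / 2 * t) by field.
rewrite expRD mulrAC ler_wpM2r ?expR_ge0//.
have h := expR_ge1Dx (c / 2 * t).
rewrite expRN ler_pdivrMl ?expR_gt0// mulrC.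
apply: (@le_trans _ _ (2 / c * (c / 2 * t))); last first.
  by rewrite ler_wpM2l ?divr_ge0 ?(ltW c0)//; apply: le_trans h; rewrite lerDr.
by rewrite mulrA mulf_div [2 * c]mulrC divff ?mulf_neq0 ?gt_eqF// mul1r.
Qed.

(** Substitution of [a t] for [t]. Differentiating in [a] at [a = 1] later yields Euler's
    identity. *)
Lemma lap_pker_scale m c w a : 0 < m <= 1 -> 0 < c -> 0 < a ->
  lap ((a * c) +i* (a * w)) (pker m) = (a `^ (- m))%:C * lap (c +i* w) (pker m).
Proof.
move=> m01 c0 a0.
have ac0 : 0 < a * c by rewrite mulr_gt0.
have hd t : damp c (pker m) (a * t + 0) = a `^ (m - 1) * damp (a * c) (pker m) t.
  rewrite addr0 /damp [RHS]mulrCA; congr (_ * _); first by congr expR; ring.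
  rewrite /pker pmulr_rgt0//; case: ifPn => t0; last by rewrite mulr0.
  by rewrite powRM// ltW.
have hk : a * a `^ (m - 1) = a `^ m.
  by rewrite mulr_powRB1 ?(ltW a0)//; case/andP : m01.
have i1 := lapable_pker m01 c0; have i2 := lapable_pker m01 ac0.
have C : \int[mu]_t (wcos w t * damp c (pker m) t) =
    a `^ m * \int[mu]_t (wcos (a * w) t * damp (a * c) (pker m) t).
  apply: (etrans (integral_affine 0 (lt0r_neq0 a0) (L1_wcos w i1))); rewrite (gtr0_norm a0).
  apply: esym; apply: (etrans (congr1 (fun u => u * _) (esym hk))); rewrite -mulrA.
  apply: (etrans (congr1 (fun u => a * u) (esym (RintegralZl (a `^ (m - 1)) measurableT (L1_wcos (a * w) i2))))).
  congr (_ * _); apply: eq_Rintegral => t _; rewrite hd [RHS]mulrCA; congr (_ * (_ * _)).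
  by rewrite addr0 /wcos; congr cos; ring.
have S : \int[mu]_t (wsin w t * damp c (pker m) t) =
    a `^ m * \int[mu]_t (wsin (a * w) t * damp (a * c) (pker m) t).
  apply: (etrans (integral_affine 0 (lt0r_neq0 a0) (L1_wsin w i1))); rewrite (gtr0_norm a0).
  apply: esym; apply: (etrans (congr1 (fun u => u * _) (esym hk))); rewrite -mulrA.
  apply: (etrans (congr1 (fun u => a * u) (esym (RintegralZl (a `^ (m - 1)) measurableT (L1_wsin (a * w) i2))))).
  congr (_ * _); apply: eq_Rintegral => t _; rewrite hd [RHS]mulrCA; congr (_ * (_ * _)).
  by rewrite addr0 /wsin; congr sin; ring.
have am : a `^ m != 0 by rewrite gt_eqF// powR_gt0.
apply/eqP; rewrite eq_complex/= C S powRN !mul0r subr0 addr0 mulrN !mulKf// !eqxx//.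
Qed.

End kernel.

Section lap_kernel.
Context {R : realType}.
Local Open Scope complex_scope.
Implicit Types (m a b c w t : R) (f : R -> R).

Let Ic m c w := \int[mu]_t (wcos w t * damp c (pker m) t).
Let Is m c w := \int[mu]_t (wsin w t * damp c (pker m) t).
Let Tc m c w := \int[mu]_t (wcos w t * damp c (fun t => t * pker m t) t).
Let Ts m c w := \int[mu]_t (wsin w t * damp c (fun t => t * pker m t) t).

Let derive_Ic_path m a b c w : 0 < m <= 1 -> 0 < c ->
  is_derive (0 : R) 1 (fun p => Ic m (c + p * a) (w + p * b)) (- b * Ts m c w - a * Tc m c w).
Proof.
move=> m01 c0.
have h := @is_derive_lap_path R
  (fun p t => wcos (w + p * b) t * damp (c + p * a) (pker m) t)
  (fun p t => - b * (wsin (w + p * b) t * damp (c + p * a) (fun t => t * pker m t) t)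
        - a * (wcos (w + p * b) t * damp (c + p * a) (fun t => t * pker m t) t)) (pker m) a b c w
  (or_introl (fun t p => conj erefl erefl)) c0 (fun t => @pker_le0 R m t)
  (fun c h => @lapable_pker R m c m01 h) (fun c h => @lapable_mul_pker R m c m01 h).
apply: is_derive_eq h _.
under eq_Rintegral do rewrite !mul0r !addr0.
have i1 := L1_wsin w (lapable_mul_pker m01 c0); have i2 := L1_wcos w (lapable_mul_pker m01 c0).
rewrite RintegralB//; [|exact: L1Zl|exact: L1Zl].
by rewrite RintegralZl// RintegralZl.
Qed.

Let derive_Is_path m a b c w : 0 < m <= 1 -> 0 < c ->
  is_derive (0 : R) 1 (fun p => Is m (c + p * a) (w + p * b)) (b * Tc m c w - a * Ts m c w).
Proof.
move=> m01 c0.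
have h := @is_derive_lap_path R
  (fun p t => wsin (w + p * b) t * damp (c + p * a) (pker m) t)
  (fun p t => b * (wcos (w + p * b) t * damp (c + p * a) (fun t => t * pker m t) t)
        - a * (wsin (w + p * b) t * damp (c + p * a) (fun t => t * pker m t) t)) (pker m) a b c w
  (or_intror (fun t p => conj erefl erefl)) c0 (fun t => @pker_le0 R m t)
  (fun c h => @lapable_pker R m c m01 h) (fun c h => @lapable_mul_pker R m c m01 h).
apply: is_derive_eq h _.
under eq_Rintegral do rewrite !mul0r !addr0.
have i1 := L1_wsin w (lapable_mul_pker m01 c0); have i2 := L1_wcos w (lapable_mul_pker m01 c0).
rewrite RintegralB//; [|exact: L1Zl|exact: L1Zl].
by rewrite RintegralZl// RintegralZl.
Qed.

(* Euler's identity for the homogeneous function [lap _ (pker m)] of degree - m. *)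
Let euler m c w : 0 < m <= 1 -> 0 < c ->
  w * Ts m c w + c * Tc m c w = m * Ic m c w /\
  c * Ts m c w - w * Tc m c w = m * Is m c w.
Proof.
move=> m01 c0.
have hp : is_derive (0 : R) 1 (fun p : R => (1 + p) `^ (- m)) (- m).
  have h1 : is_derive (0 : R) 1 (fun p : R => 1 + p) 1 by apply: is_derive_eq; rewrite add0r ?mulr1.
  have h2 : is_derive (1 + 0 : R) 1 (fun x : R => x `^ (- m)) (- m).
    by have := @is_derive1_powR R (- m) 1 ltr01; rewrite addr0 powR1 mulr1.
  by have := @is_derive1_comp R _ _ _ _ _ h2 h1; rewrite mulr1.
have near1 : \forall p \near (0 : R), 0 < 1 + p.
  near=> p; have : `|p| < 1 by near: p; exists 1 => //= y; rewrite /ball/= sub0r normrN.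
  by rewrite ltr_norml => /andP[]; lra.
have sc (p : R) : 0 < 1 + p ->
    Ic m (c + p * c) (w + p * w) = (1 + p) `^ (- m) * Ic m c w /\
    Is m (c + p * c) (w + p * w) = (1 + p) `^ (- m) * Is m c w.
  move=> p0; have := lap_pker_scale w m01 c0 p0.
  rewrite !mulrDl !mul1r => /eqP; rewrite eq_complex/= !mul0r subr0 addr0 => /andP[/eqP h1 /eqP].
  by rewrite mulrN => /oppr_inj h2; split; [exact: h1|exact: h2].
(* Two expressions of one derivative at 0: [d], obtained under the integral sign, and the one that
   the scaling law gives near 0. *)
have key (g : R -> R) (k d : R) : (forall p, 0 < 1 + p -> g p = (1 + p) `^ (- m) * k) ->
    is_derive (0 : R) 1 g d -> d = - m * k.
  move=> gE hg.
  have h := is_derive_mul hp (is_derive_cst k (0 : R) 1).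
  have h' : is_derive (0 : R) 1 g ((1 + 0) `^ (- m) * 0 + k * - m).
    by apply: near_eq_is_derive h; near=> p; apply/esym/gE; near: p.
  by have [_ <-] := hg; have [_ ->] := h'; rewrite mulr0 add0r mulrC.
have e1 := key _ _ _ (fun p p0 => (sc p p0).1) (derive_Ic_path c w w m01 c0).
have e2 := key _ _ _ (fun p p0 => (sc p p0).2) (derive_Is_path c w w m01 c0).
split; [rewrite -[RHS]opprK -mulNr -e1|rewrite -[RHS]opprK -[in RHS]mulNr -e2]; ring.
Unshelve. all: by end_near. Qed.

Lemma Gamma_lap m : 0 < m <= 1 -> Gamma m = \int[mu]_t damp 1 (pker m) t.
Proof.
move=> m01; have [m0 _] := andP m01.
have i1 : L1 (damp 1 (pker m)) by exact: lapable_pker.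
have E : damp 1 (pker m) = (fun s : R => s `^ (m - 1) * expR (- s)) \_ `]0, +oo[.
  apply/funext => t; rewrite patchE mem_setE in_itv/= andbT /damp /pker mul1r.
  by case: ifP => _; rewrite ?mulr0// mulrC.
rewrite E -Rintegral_mkcond /Gamma Rintegral_itv_obnd_cbnd//.
have := i1; rewrite E /L1 -restrict_EFin.
move=> h; have [_] := @integrable_mkcond _ _ R (@lebesgue_measure R) `]0, +oo[%classic (EFin \o (fun s : R => s `^ (m - 1) * expR (- s))) (measurable_itv _); exact.
Qed.

(** Instead of rotating a contour: on the line [Re s = c], Euler's identity makes the derivative in
    [w] of [cpow s m * lap s (pker m)] vanish, and the constant is found at [w = 0]. *)
Lemma lap_pker m (s : R[i]) : 0 < m <= 1 -> 0 < Re s ->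
  lap s (pker m) = (Gamma m)%:C * cpow s (- m).
Proof.
case: s => c w /= m01 c0; have [m0 m1] := andP m01.
have n0 x : 0 < c ^+ 2 + x ^+ 2 by rewrite ltr_pwDl ?exprn_gt0 ?sqr_ge0.
pose l x := 2^-1 * ln (c ^+ 2 + x ^+ 2).
pose th x := atan (x / c).
have clogE x : clog (c +i* x) = l x +i* th x.
  rewrite /clog /= -powR12_sqrt; last by rewrite ltW.
  by rewrite ln_powR.
have dl (x : R) : is_derive x 1 l (x / (c ^+ 2 + x ^+ 2)).
  have h1 : is_derive x 1 (fun x : R => c ^+ 2 + x ^+ 2) (2 * x).
    by apply: is_derive_eq; rewrite -![_ *: _]/(_ * _); ring.
  have h2 := @is_derive1_comp R (@ln R) (fun x : R => c ^+ 2 + x ^+ 2) x _ _ (is_derive1_ln (n0 x)) h1.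
  have h3 := is_derive_mul (is_derive_cst (2^-1 : R) x 1) h2.
  apply: is_derive_eq h3 _; rewrite /=; field; rewrite gt_eqF//.
have dth (x : R) : is_derive x 1 th (c / (c ^+ 2 + x ^+ 2)).
  have h1 : is_derive x 1 (fun x : R => x / c) c^-1.
    by apply: is_derive_eq; rewrite -![_ *: _]/(_ * _); ring.
  have h2 := @is_derive1_comp R (@atan R) (fun x : R => x / c) x _ _ (is_derive1_atan (x / c)) h1.
  apply: is_derive_eq h2 _; field; rewrite !gt_eqF//.
have shift (g : R -> R) (x d : R) : is_derive (0 : R) 1 (fun p => g (x + p * 1)) d -> is_derive x 1 g d.
  move=> h; have h1 : is_derive x 1 (fun y : R => y - x) 1.
    by apply: is_derive_eq; rewrite subr0 ?mulr1.
  rewrite -(subrr x) in h; have := @is_derive1_comp R (fun p : R => g (x + p * 1)) (fun y : R => y - x) x _ _ h h1; rewrite mulr1.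
  by congr (is_derive _ _ _ _); apply/funext => y /=; rewrite mulr1 addrC subrK.
have dC (x : R) : is_derive x 1 (Ic m c) (- Ts m c x).
  have h : is_derive (0 : R) 1 (fun p : R => Ic m c (x + p * 1)) (- Ts m c x).
    have -> : (fun p : R => Ic m c (x + p * 1)) = (fun p => Ic m (c + p * 0) (x + p * 1)).
      by apply/funext => p; rewrite mulr0 addr0.
    by apply: (is_derive_eq (derive_Ic_path 0 1 x m01 c0)); rewrite (mul0r (Tc m c x)) subr0 mulN1r.
  exact: (shift (Ic m c) x _ h).
have dS (x : R) : is_derive x 1 (Is m c) (Tc m c x).
  have h : is_derive (0 : R) 1 (fun p : R => Is m c (x + p * 1)) (Tc m c x).
    have -> : (fun p : R => Is m c (x + p * 1)) = (fun p => Is m (c + p * 0) (x + p * 1)).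
      by apply/funext => p; rewrite mulr0 addr0.
    by apply: (is_derive_eq (derive_Is_path 0 1 x m01 c0)); rewrite (mul0r (Ts m c x)) subr0 mul1r.
  exact: (shift (Is m c) x _ h).
(* Euler's identity is a linear system for [Ts] and [Tc], with determinant [- (c ^+ 2 + x ^+ 2)]; it
   is solved here. *)
have TE (x : R) : Ts m c x = m * (x * Ic m c x + c * Is m c x) / (c ^+ 2 + x ^+ 2) /\
   Tc m c x = m * (c * Ic m c x - x * Is m c x) / (c ^+ 2 + x ^+ 2).
  have [e1 e2] := euler x m01 c0.
  have nz : c ^+ 2 + x ^+ 2 != 0 by rewrite gt_eqF.
  split; apply: (mulIf nz); rewrite mulfVK//.
    have -> : m * (x * Ic m c x + c * Is m c x) = x * (m * Ic m c x) + c * (m * Is m c x) by ring.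
    by rewrite -e1 -e2; ring.
  have -> : m * (c * Ic m c x - x * Is m c x) = c * (m * Ic m c x) - x * (m * Is m c x) by ring.
  by rewrite -e1 -e2; ring.
(* [A] and [B] are the real and imaginary parts of [cpow s m * lap s (pker m)] at [s = c + i x]. *)
pose A x := expR (m * l x) * (cos (m * th x) * Ic m c x + sin (m * th x) * Is m c x).
pose B x := expR (m * l x) * (sin (m * th x) * Ic m c x - cos (m * th x) * Is m c x).
have dml (x : R) : is_derive x 1 (fun x => m * l x) (m * (x / (c ^+ 2 + x ^+ 2))).
  by have := is_derive_mul (is_derive_cst m x 1) (dl x); rewrite mulr0 addr0.
have dmth (x : R) : is_derive x 1 (fun x => m * th x) (m * (c / (c ^+ 2 + x ^+ 2))).
  by have := is_derive_mul (is_derive_cst m x 1) (dth x); rewrite mulr0 addr0.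
have dA (x : R) : is_derive x 1 A 0.
  have h1 := is_derive_mul (is_derive_cos_comp (dmth x)) (dC x).
  have h2 := is_derive_mul (is_derive_sin_comp (dmth x)) (dS x).
  have h := is_derive_mul (is_derive_expR_comp (dml x)) (is_deriveD h1 h2).
  apply: is_derive_eq h _ => /=; rewrite (TE x).1 (TE x).2.
  by rewrite -![(_ + _) x]/(_ x + _ x) /=; field; rewrite gt_eqF.
have dB (x : R) : is_derive x 1 B 0.
  have h1 := is_derive_mul (is_derive_sin_comp (dmth x)) (dC x).
  have h2 := is_derive_mul (is_derive_cos_comp (dmth x)) (dS x).
  have h := is_derive_mul (is_derive_expR_comp (dml x)) (is_deriveB h1 h2).
  apply: is_derive_eq h _ => /=; rewrite (TE x).1 (TE x).2.
  by rewrite -![(_ - _) x]/(_ x - _ x) /=; field; rewrite gt_eqF.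
have G1 : Ic m 1 0 = Gamma m.
  rewrite Gamma_lap//; apply: eq_Rintegral => t _; by rewrite /wcos mul0r cos0 mul1r.
have S1 : Is m 1 0 = 0.
  rewrite /Is; under eq_Rintegral do rewrite /wsin mul0r sin0 mul0r.
  by rewrite Rintegral_cst// mul0r.
(* At [w = 0], scaling by [c] reduces the value to [s = 1], where it is [Gamma m]. *)
have := lap_pker_scale 0 m01 ltr01 c0; rewrite mulr1 mulr0 => /eqP.
rewrite eq_complex/= !mul0r subr0 addr0 -!/(Ic _ _ _) -!/(Is _ _ _) G1 S1 oppr0 mulr0.
move=> /andP[/eqP c0E /eqP s0E].
have A0 : A w = Gamma m.
  rewrite (is_derive_0_is_cst w 0 dA) /A /th /l mul0r atan0 mulr0 cos0 sin0 mul1r mul0r addr0 c0E.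
  rewrite expr0n/= addr0 mulrA.
  have -> : 2^-1 * ln (c ^+ 2) = ln c.
    by rewrite -powR_mulrn ?(ltW c0)// ln_powR mulrA mulVf ?mul1r.
  by rewrite /powR gt_eqF// -expRD mulNr subrr expR0 mul1r.
have B0 : B w = 0.
  rewrite (is_derive_0_is_cst w 0 dB) /B /th mul0r atan0 mulr0 cos0 sin0 mul0r mul1r sub0r s0E.
  by rewrite mulr0.
have key : cpow (c +i* w) m * lap (c +i* w) (pker m) = (Gamma m)%:C.
  apply/eqP; rewrite eq_complex; apply/andP; split; apply/eqP.
    rewrite [RHS]/= -A0 /cpow clogE /cexp/= !mul0r !subr0 !addr0 /A -/(Ic m c w) -/(Is m c w); ring.
  rewrite [RHS]/= -B0 /cpow clogE /cexp/= !mul0r !subr0 !addr0 /B -/(Ic m c w) -/(Is m c w); ring.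
have nz := cpow_neq0 (c +i* w) m.
apply: (mulfI nz); rewrite key mulrCA -cpowD subrr cpow0 mulr1//.
Qed.

Lemma Gamma1 : @Gamma R 1 = 1.
Proof.
rewrite /Gamma Rintegral_mkcond.
transitivity (\int[mu]_t (exponential_pdf (1 : R) t)); last first.
  by have := integral_exponential_pdf (@ltr01 R); rewrite /Rintegral => ->.
apply: eq_Rintegral => t _; rewrite /exponential_pdf !patchE; case: ifP => // _.
by rewrite subrr powRr0 mulN1r.
Qed.

Lemma lap_heaviside (s : R[i]) : 0 < Re s -> lap s heaviside = s^-1.
Proof.
move=> s0; rewrite -pker1 lap_pker ?ltr01 ?lexx// Gamma1 mul1r.
have h : cpow s 1 * cpow s (- 1) = 1 by rewrite -cpowD subrr cpow0.
rewrite cpow1// in h.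
have nz : s != 0 by apply: contra_eq_neq h => ->; rewrite mul0r eq_sym oner_eq0.
by apply: (mulfI nz); rewrite h divff.
Qed.

(** On []0, 1]] the integrand is at least [exp (- 1)], as [m - 1 <= 0]. *)
Lemma Gamma_neq0 m : 0 < m <= 1 -> Gamma m != 0.
Proof.
move=> m01; rewrite Gamma_lap//; apply/eqP => h.
have i1 : L1 (damp 1 (pker m)) by exact: lapable_pker.
have h0 : forall t, 0 <= damp 1 (pker m) t by move=> t; rewrite mulr_ge0 ?expR_ge0 ?pker_ge0.
have [m0 m1] := andP m01.
have i2 : L1 ((fun _ => expR (- 1)) \_ `]0, 1] : R -> R).
  rewrite /L1 -restrict_EFin -integrable_mkcond//.
  apply: measurable_bounded_integrable => //.
    by rewrite [X in (X < _)%E](lebesgue_measure_itv `]0%R, 1%R])/= lte_fin ltr01 ltry.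
  exact: bounded_cst.
have : \int[mu]_t (((fun _ => expR (- 1)) \_ `]0, 1] : R -> R) t) <= \int[mu]_t (damp 1 (pker m) t).
  apply: le_Rintegral => // t _; rewrite patchE mem_setE in_itv/=; case: ifPn => // /andP[t0 t1].
  rewrite /damp /pker t0 mul1r -[leLHS]mulr1 ler_pM ?expR_ge0// ?ler_expR ?lerN2//.
  by rewrite -[leLHS](powRr0 t) ger_powR ?t0// subr_le0.
rewrite h -Rintegral_mkcond Rintegral_cst//.
have -> : (fine (@lebesgue_measure R `]0%R, 1%R]%classic) = 1)%R.
  by rewrite lebesgue_measure_itv/= lte_fin ltr01/= oppr0 addr0.
by rewrite mulr1 leNgt expR_gt0.
Qed.

End lap_kernel.

(** * Fractional integrals on bounded intervals *)

Section volterra.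
Context {R : realType}.
Implicit Types (f g z : R -> R) (m T t : R).

Lemma L1_restrict f (D : set R) : measurable D ->
  (@lebesgue_measure R).-integrable D (EFin \o f) <-> L1 (f \_ D).
Proof. by move=> mD; rewrite /L1 -restrict_EFin; exact: integrable_mkcond. Qed.

(** Counterpart of [conv_weight] for an integrable weight and a bounded kernel: in [integral_frac]
    the weight is a reflected power kernel, unbounded at [T]. *)
Lemma conv_weight_L1 f g (w : R -> R) (M : R) : L1 w -> L1 g -> measurable_fun setT f ->
  (forall x, `|f x| <= M) ->
  \int[mu]_t (w t * conv f g t) = \int[mu]_v ((\int[mu]_t (w t * f (t - v))) * g v).
Proof.
move=> wi gi mf fM.
have mw := L1_measurable wi; have mg := L1_measurable gi.
have mF := measurable_conv_integrand mf mg.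
have mfs (v : R) : measurable_fun setT (fun t : R => f (t - v)).
  by apply: (measurableT_comp mf); exact: measurable_funB.
have [||v /=|_ _ e] := @fubini_dom R (fun xy => w xy.1 * (f (xy.1 - xy.2) * g xy.2)) (fun v => (M * \int[mu]_x `|w x|) * `|g v|).
  - apply: measurable_funM => //; apply: (measurableT_comp mw); exact: measurable_fst.
  - exact/L1Zl/L1_norm.
  - have i1 : L1 (fun t => M * `|g v| * `|w t|) by apply/L1Zl/L1_norm.
    apply: (@le_trans _ _ (\int[mu]_t (M * `|g v| * `|w t|)%:E)%E).
      apply: ge0_le_integral => //.
      + do 2 apply: measurableT_comp => //.
        by apply: measurable_funM; [exact: mw|apply: measurable_funM; [exact: mfs|exact: measurable_cst]].
      + exact: (measurable_int mu).
      + move=> t _; rewrite lee_fin !normrM mulrC.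
        by rewrite ler_wpM2r// ler_wpM2r.
    rewrite (L1_EFin i1) lee_fin (RintegralZl (M * `|g v|) measurableT (L1_norm wi)).
    by rewrite mulrAC.
have mF' (t : R) : measurable_fun setT (fun v : R => f (t - v) * g v).
  by apply: measurable_funM => //; apply: (measurableT_comp mf); exact: measurable_funB.
transitivity (\int[mu]_t \int[mu]_v (w t * (f (t - v) * g v))).
  by apply: eq_Rintegral => t _; rewrite RintegralZl_meas.
rewrite e//; apply: eq_Rintegral => v _.
rewrite -RintegralZr; first by apply: eq_Rintegral => t _; rewrite mulrA.
  by [].
under eq_fun do rewrite mulrC.
exact: L1_bounded (mfs v) (fun t => fM (t - v)) wi.
Qed.

Lemma L1_pker_itv m T : 0 < m <= 1 -> L1 (pker m \_ `[0, T]).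
Proof.
move=> m01; have h := lapable_pker m01 (@ltr01 R).
have : L1 (fun t => (expR T * (`|damp 1 (pker m) t|))) by apply/L1Zl/L1_norm.
apply: L1_le.
  by apply/(measurable_restrictT _ _).1 => //; apply: measurable_funTS; exact: measurable_pker.
move=> t; rewrite patchE mem_setE in_itv/=; case: ifPn => [/andP[t0 tT]|_]; last first.
  by rewrite normr0 mulr_ge0 ?expR_ge0.
rewrite /damp !normrM mulrA ler_peMl ?normr_ge0//.
by rewrite ger0_norm ?expR_ge0// -expRD mul1r -[leLHS]expR0 ler_expR subr_ge0.
Qed.

(** Cutting both factors at [T] prepares them for [conv_weight], which needs integrability on the
    whole line, and does not affect [t <= T]. At [v = t] both integrands are 0, because
    [powR 0 (m - 1)] is 0 for [m < 1]. *)
Lemma conv_trunc m z T t : 0 < m < 1 -> 0 <= t <= T ->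
  \int[mu]_(v in `[0, t]) ((t - v) `^ (m - 1) * z v) =
  conv (pker m \_ `[0, T]) (z \_ `[0, T]) t.
Proof.
move=> /andP[m0 m1] /andP[t0 tT]; rewrite Rintegral_mkcond /conv; apply: eq_Rintegral => v _.
rewrite !patchE !mem_setE !in_itv/= /pker.
have [v0|v0] := leP 0 v; last by rewrite /= mulr0.
have [vt|tv] := leP v t; last by rewrite /= subr_ge0 leNgt tv/= mul0r.
rewrite /= (le_trans vt tT) subr_ge0 vt/= lerBlDr ler_wpDr//.
rewrite subr_gt0 lt_neqAle vt andbT; case: eqVneq => [->|//].
by rewrite subrr powR0 ?mul0r// lt_eqF// subr_lt0.
Qed.

Lemma conv_int z T t : 0 <= t <= T ->
  \int[mu]_(v in `[0, t]) z v = conv ((cst 1 : R -> R) \_ `[0, T]) (z \_ `[0, T]) t.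
Proof.
move=> /andP[t0 tT]; rewrite Rintegral_mkcond /conv; apply: eq_Rintegral => v _.
rewrite !patchE !mem_setE !in_itv/=.
have [v0|v0] := leP 0 v; last by rewrite /= mulr0.
have [vt|tv] := leP v t; last by rewrite /= subr_ge0 leNgt tv/= mul0r.
by rewrite /= (le_trans vt tT) subr_ge0 vt/= lerBlDr ler_wpDr// mul1r.
Qed.

(** Integration and fractional integration commute. After Fubini, [z v] is multiplied by the
    integral over [[v, T]] of a power, of [t - v] on one side and of [T - w] on the other; the
    reflection [w = T + v - t] exchanges them. *)
Lemma integral_frac m z T : 0 < m < 1 -> 0 < T ->
  (@lebesgue_measure R).-integrable `[0, T] (EFin \o z) ->
  (@lebesgue_measure R).-integrable `[0, T]
    (EFin \o (fun t => \int[mu]_(v in `[0, t]) ((t - v) `^ (m - 1) * z v))) /\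
  \int[mu]_(t in `[0, T]) \int[mu]_(v in `[0, t]) ((t - v) `^ (m - 1) * z v) =
  \int[mu]_(w in `[0, T]) ((T - w) `^ (m - 1) * \int[mu]_(v in `[0, w]) z v).
Proof.
move=> m01 T0 iz; have m01' : 0 < m <= 1 by case/andP : m01 => -> /ltW ->.
set kT := pker m \_ `[0, T].
set zT := z \_ `[0, T].
set oT : R -> R := (cst 1 : R -> R) \_ `[0, T].
have ik : L1 kT by exact: L1_pker_itv.
have iz' : L1 zT by have [h _] := L1_restrict z (measurable_itv `[0, T]); exact: h.
have mo : measurable_fun setT oT.
  by have [h _] := measurable_restrictT (cst 1 : R -> R) (measurable_itv `[0, T]); apply: h; exact: measurable_cst.
have bo x : `|oT x| <= 1.
  by rewrite /oT patchE; case: ifP => _ /=; rewrite ?normr1 ?normr0.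
have [ci _ cE] := conv_weight ik iz' mo bo.
have E1 : (fun t => \int[mu]_(v in `[0, t]) ((t - v) `^ (m - 1) * z v)) \_ `[0, T] =
   (fun t => oT t * conv kT zT t).
  apply/funext => t; rewrite /oT !patchE mem_setE in_itv/=; case: ifPn => [h|_]; last by rewrite mul0r.
  by rewrite mul1r (@conv_trunc m z T).
split.
  have [_ h] := L1_restrict (fun t => \int[mu]_(v in `[0, t]) ((t - v) `^ (m - 1) * z v)) (measurable_itv `[0, T]).
  by apply: h; rewrite E1; exact: L1_bounded mo bo ci.
rewrite [LHS]Rintegral_mkcond E1 cE [RHS]Rintegral_mkcond.
transitivity (\int[mu]_w (kT (T - w) * conv oT zT w)); last first.
  apply: eq_Rintegral => w _; rewrite /kT [RHS]patchE mem_setE in_itv/=; case: ifPn => [h|h].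
    rewrite (conv_int z h); congr (_ * _); rewrite patchE mem_setE in_itv/=.
    have [w0 wT] := andP h; rewrite subr_ge0 wT lerBlDr ler_wpDr//= /pker subr_gt0 lt_neqAle wT andbT.
    by case: eqVneq => [->|//]; rewrite subrr powR0// lt_eqF// subr_lt0; case/andP : m01.
  rewrite patchE mem_setE in_itv/=; case: ifPn => [h'|_]; last by rewrite mul0r.
  have {h h'} w0 : w < 0.
    rewrite ltNge; apply: contra h => w0; rewrite w0/=.
    by move: h'; rewrite subr_ge0 => /andP[].
  rewrite /conv; under eq_Rintegral => v _.
    have -> : oT (w - v) * zT v = 0.
      rewrite /oT /zT !patchE !mem_setE !in_itv/=.
      have [v0|v0] := leP 0 v; last by rewrite mulr0.
      by rewrite subr_ge0 leNgt (lt_le_trans w0 v0)/= mul0r.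
    over.
  by rewrite Rintegral_cst// mul0r mulr0.
rewrite (conv_weight_L1 (L1_refl T ik) iz' mo bo).
apply: eq_Rintegral => v _; congr (_ * _).
have h : L1 (fun w => kT (T - w) * oT (w - v)).
  under eq_fun do rewrite mulrC.
  apply: (@L1_bounded R _ _ 1); last exact: L1_refl.
    by apply: (measurableT_comp mo); exact: measurable_funB.
  by move=> t; exact: bo.
rewrite -(integral_refl (T + v) h); apply: eq_Rintegral => t _.
rewrite mulrC; congr (_ * _); first by congr kT; ring.
rewrite /oT !patchE !mem_setE !in_itv/=.
have -> : (0 <= T + v - t - v <= T) = (0 <= t <= T).
  by apply/idP/idP => /andP[h1 h2]; apply/andP; split; lra.
by [].
Qed.

End volterra.

(** * A Parseval inequality *)

Section parseval.
Context {R : realType}.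
Local Open Scope complex_scope.
Implicit Types (f g u : R -> R) (e t v w x : R).

Definition fcos f w := \int[mu]_t (wcos w t * f t).
Definition fsin f w := \int[mu]_t (wsin w t * f t).
Definition cauchyk w : R := (1 + w ^+ 2)^-1.

Lemma measurable_wcos2 d (S : measurableType d) (g h : S -> R) :
  measurable_fun setT g -> measurable_fun setT h -> measurable_fun setT (fun z => wcos (g z) (h z)).
Proof.
move=> mg mh; apply: (@measurableT_comp _ _ _ _ _ _ (@cos R)).
  by apply: continuous_measurable_fun; exact: continuous_cos.
exact: measurable_funM.
Qed.

Lemma measurable_wsin2 d (S : measurableType d) (g h : S -> R) :
  measurable_fun setT g -> measurable_fun setT h -> measurable_fun setT (fun z => wsin (g z) (h z)).
Proof.
move=> mg mh; apply: (@measurableT_comp _ _ _ _ _ _ (@sin R)).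
  by apply: continuous_measurable_fun; exact: continuous_sin.
exact: measurable_funM.
Qed.

Lemma fubini_prod (F : R * R -> R) f g (M : R) : measurable_fun setT F -> L1 f -> L1 g ->
  (forall x y : R, `|F (x, y)| <= M * (`|f x| * `|g y|)) ->
  [/\ L1 (fun x => \int[mu]_y F (x, y)), L1 (fun y => \int[mu]_x F (x, y)) &
   \int[mu]_x \int[mu]_y F (x, y) = \int[mu]_y \int[mu]_x F (x, y)].
Proof.
move=> mF fi gi FM.
apply: (@fubini_dom R F (fun y => (M * \int[mu]_x `|f x|) * `|g y|)) => //.
  exact/L1Zl/L1_norm.
move=> y.
have i1 : L1 (fun x => (M * `|g y|) * `|f x|) by apply/L1Zl/L1_norm.
apply: (@le_trans _ _ (\int[mu]_x ((M * `|g y|) * `|f x|)%:E)%E).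
  apply: ge0_le_integral => //.
  + apply/measurable_EFinP; apply: measurableT_comp => //.
    by apply: (measurableT_comp mF); exact: measurable_fun_pair.
  + exact: (measurable_int mu).
  + by move=> x _; rewrite lee_fin (le_trans (FM x y))// -mulrA (mulrC `|g y|).
rewrite (L1_EFin i1) lee_fin (RintegralZl (M * `|g y|) measurableT (L1_norm fi)).
by rewrite mulrAC.
Qed.

Lemma le_norm_mul3 (x y z : R) : `|z| <= 1 -> `|x * (z * y)| <= 1 * (`|x| * `|y|).
Proof. by move=> z1; rewrite mul1r !normrM ler_wpM2l// ler_piMl. Qed.

(** Fubini provides the measurability in [w] together with the integrability. *)
Lemma L1_fcos f g : L1 f -> L1 g -> L1 (fun w => g w * fcos f w).
Proof.
move=> fi gi.
have mF : measurable_fun setT (fun z : R * R => g z.1 * (wcos z.1 z.2 * f z.2)).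
  apply: measurable_funM; first by apply: (measurableT_comp (L1_measurable gi)); exact: measurable_fst.
  apply: measurable_funM; first by apply: measurable_wcos2; [exact: measurable_fst|exact: measurable_snd].
  by apply: (measurableT_comp (L1_measurable fi)); exact: measurable_snd.
have dF (x y : R) : `|g x * (wcos x y * f y)| <= 1 * (`|g x| * `|f y|).
  exact: le_norm_mul3 (wcos_le1 _ _).
have [h _ _] := fubini_prod mF gi fi dF.
suff <- : (fun x => \int[mu]_y (g x * (wcos x y * f y))) = (fun w => g w * fcos f w) by exact: h.
by apply/funext => x; rewrite (RintegralZl (g x) measurableT (L1_wcos x fi)).
Qed.

Lemma L1_fsin f g : L1 f -> L1 g -> L1 (fun w => g w * fsin f w).
Proof.
move=> fi gi.
have mF : measurable_fun setT (fun z : R * R => g z.1 * (wsin z.1 z.2 * f z.2)).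
  apply: measurable_funM; first by apply: (measurableT_comp (L1_measurable gi)); exact: measurable_fst.
  apply: measurable_funM; first by apply: measurable_wsin2; [exact: measurable_fst|exact: measurable_snd].
  by apply: (measurableT_comp (L1_measurable fi)); exact: measurable_snd.
have dF (x y : R) : `|g x * (wsin x y * f y)| <= 1 * (`|g x| * `|f y|).
  exact: le_norm_mul3 (wsin_le1 _ _).
have [h _ _] := fubini_prod mF gi fi dF.
suff <- : (fun x => \int[mu]_y (g x * (wsin x y * f y))) = (fun w => g w * fsin f w) by exact: h.
by apply/funext => x; rewrite (RintegralZl (g x) measurableT (L1_wsin x fi)).
Qed.

(** Real part of [1 / s] at [s = e + i x], which is where the Poisson kernel comes from. *)
Lemma integral_damp_cos e x : 0 < e ->
  \int[mu]_w (wcos x w * damp e heaviside w) = e / (e ^+ 2 + x ^+ 2).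
Proof.
move=> e0; have := @lap_heaviside R (e +i* x) e0 => /(congr1 (@complex.Re R)).
by move=> /= ->.
Qed.

(* A Poisson-kernel smoothing of [f] paired with [f], which tends to [pi] times the integral of
   [f ^+ 2] as [e] tends to 0. *)
Definition energy e f := \int[mu]_w (damp e heaviside w * (fcos f w ^+ 2 + fsin f w ^+ 2)).

Lemma L1_energy e f : 0 < e -> L1 f -> L1 (fun w => damp e heaviside w * (fcos f w ^+ 2 + fsin f w ^+ 2)).
Proof.
move=> e0 fi; have iD := lapable_heaviside e0.
have ic := L1_fcos fi iD; have ifs := L1_fsin fi iD.
have ic' := L1_fcos fi ic; have ifs' := L1_fsin fi ifs.
have := L1D ic' ifs'; congr L1; apply/funext => w; ring.
Qed.

(** The squared modulus of the transform is the double integral of [f t * f v * cos ((t - v) w)].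
    Integrating over [w > 0] first leaves the Poisson kernel; the weight [damp e heaviside] makes
    this legitimate. *)
Lemma energy_kernel e f : 0 < e -> L1 f ->
  energy e f = \int[mu]_t (f t * \int[mu]_v (f v * (e / (e ^+ 2 + (t - v) ^+ 2)))).
Proof.
move=> e0 fi; have iD : L1 (damp e heaviside) := lapable_heaviside e0.
have ic := L1_fcos fi iD; have ifs := L1_fsin fi iD.
set Dc := (fun w => damp e heaviside w * fcos f w) in ic.
set Ds := (fun w => damp e heaviside w * fsin f w) in ifs.
have mf := L1_measurable fi.
pose Dn w := `|Dc w| + `|Ds w|.
have ics : L1 Dn by apply: L1D; exact: L1_norm.
(* First exchange, [t] with [w]: one factor of each square is expanded, the other is kept inside
   [Dc] or [Ds]. *)
pose F (z : R * R) := f z.1 * (wcos z.2 z.1 * Dc z.2 + wsin z.2 z.1 * Ds z.2).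
have mF : measurable_fun setT F.
  apply: measurable_funM; first by apply: (measurableT_comp mf); exact: measurable_fst.
  apply: measurable_funD; apply: measurable_funM.
  - by apply: measurable_wcos2; [exact: measurable_snd|exact: measurable_fst].
  - by apply: (measurableT_comp (L1_measurable ic)); exact: measurable_snd.
  - by apply: measurable_wsin2; [exact: measurable_snd|exact: measurable_fst].
  - by apply: (measurableT_comp (L1_measurable ifs)); exact: measurable_snd.
have dF (t w : R) : `|F (t, w)| <= 1 * (`|f t| * `|Dn w|).
  rewrite mul1r normrM ler_wpM2l// (le_trans (ler_normD _ _))// [leRHS]ger0_norm ?addr_ge0// /Dn.
  by rewrite lerD// normrM ler_piMl// ?wcos_le1 ?wsin_le1.
have [_ _ FE] := fubini_prod mF fi ics dF.
have inner (w : R) : \int[mu]_t F (t, w) = damp e heaviside w * (fcos f w ^+ 2 + fsin f w ^+ 2).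
  rewrite /F /=.
  have i1 : L1 (fun t => Dc w * (wcos w t * f t)) by exact/L1Zl/L1_wcos.
  have i2 : L1 (fun t => Ds w * (wsin w t * f t)) by exact/L1Zl/L1_wsin.
  transitivity (\int[mu]_t (Dc w * (wcos w t * f t) + Ds w * (wsin w t * f t))).
    by apply: eq_Rintegral => t _; ring.
  rewrite (RintegralD measurableT i1 i2) (RintegralZl _ measurableT (L1_wcos w fi)) (RintegralZl _ measurableT (L1_wsin w fi)).
  by rewrite -/(fcos f w) -/(fsin f w) /Dc /Ds; ring.
rewrite /energy; transitivity (\int[mu]_w \int[mu]_t F (t, w)).
  by apply: eq_Rintegral => w _; rewrite inner.
rewrite -FE; apply: eq_Rintegral => t _.
(* Second exchange, [w] with [v], for fixed [t]. *)
pose G (z : R * R) := damp e heaviside z.1 * (wcos (t - z.2) z.1 * f z.2).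
have mG : measurable_fun setT G.
  apply: measurable_funM; first by apply: (measurableT_comp (L1_measurable iD)); exact: measurable_fst.
  apply: measurable_funM; last by apply: (measurableT_comp mf); exact: measurable_snd.
  apply: measurable_wcos2; last exact: measurable_fst.
  by apply: measurable_funB => //; exact: measurable_snd.
have dG (w v : R) : `|G (w, v)| <= 1 * (`|damp e heaviside w| * `|f v|).
  exact: (le_norm_mul3 (damp e heaviside w) (f v) (wcos_le1 (t - v) w)).
have [_ _ GE] := fubini_prod mG iD fi dG.
have i3 : L1 (fun w => wcos w t * Dc w + wsin w t * Ds w).
  have e1 w : wcos w t = wcos t w by rewrite /wcos mulrC.
  have e2 w : wsin w t = wsin t w by rewrite /wsin mulrC.
  by under eq_fun do rewrite e1 e2; apply: L1D; [exact: L1_wcos|exact: L1_wsin].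
rewrite /F (RintegralZl (f t) measurableT i3); congr (_ * _).
transitivity (\int[mu]_w \int[mu]_v G (w, v)).
  apply: eq_Rintegral => w _; rewrite /G /=.
  have j1 : L1 (fun v => wcos w t * (wcos w v * f v)) by exact/L1Zl/L1_wcos.
  have j2 : L1 (fun v => wsin w t * (wsin w v * f v)) by exact/L1Zl/L1_wsin.
  have j12 := L1D j1 j2.
  have E : (fun v => wcos (t - v) w * f v) = (fun v => wcos w t * (wcos w v * f v) + wsin w t * (wsin w v * f v)).
    by apply/funext => v; rewrite /wcos /wsin mulrBl cosB !(mulrC w); ring.
  have jE : L1 (fun v => wcos (t - v) w * f v) by rewrite E.
  rewrite (RintegralZl (damp e heaviside w) measurableT jE) E (RintegralD measurableT j1 j2).
  rewrite (RintegralZl _ measurableT (L1_wcos w fi)) (RintegralZl _ measurableT (L1_wsin w fi)).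
  by rewrite -/(fcos f w) -/(fsin f w) /Dc /Ds; ring.
apply: (etrans GE).
apply: eq_Rintegral => v _.
rewrite -(integral_damp_cos (t - v) e0).
rewrite -(RintegralZl (f v) measurableT (L1_wcos (t - v) iD)).
by apply: eq_Rintegral => w _; rewrite /G /=; ring.
Qed.

(** With [v = t - e w] the kernel no longer depends on [e], which then acts on the translation
    only. *)
Lemma energy_scale e f : 0 < e -> L1 f -> (exists M : R, forall t, `|f t| <= M) ->
  energy e f = \int[mu]_t (f t * \int[mu]_w (f (t - e * w) * cauchyk w)).
Proof.
move=> e0 fi [M fM]; apply: (etrans (energy_kernel e0 fi)); apply: eq_Rintegral => t _; congr (_ * _).
have k0 (x : R) : 0 < e ^+ 2 + x ^+ 2 by rewrite ltr_pwDl ?exprn_gt0 ?sqr_ge0.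
have i1 : L1 (fun v => f v * (e / (e ^+ 2 + (t - v) ^+ 2))).
  under eq_fun do rewrite mulrC.
  apply: (@L1_bounded R f _ e^-1) => //.
    have mq : measurable_fun setT (fun x : R => e / (e ^+ 2 + x ^+ 2)).
      apply: continuous_measurable_fun => x; apply: cvgM; first exact: cvg_cst.
      apply: cvgV; first by rewrite gt_eqF.
      by apply: cvgD; [exact: cvg_cst|exact: exprn_continuous].
    by apply: (measurableT_comp mq); exact: measurable_funB.
  move=> v; rewrite ger0_norm ?divr_ge0 ?(ltW e0) ?(ltW (k0 _))//.
  rewrite ler_pdivrMr// mulrDr expr2 mulKf ?gt_eqF// lerDl mulr_ge0 ?sqr_ge0// invr_ge0 ltW//.
apply: (etrans (@integral_affine R (- e) t _ _ i1)); first by rewrite oppr_eq0 gt_eqF.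
have i2 : L1 (fun w => f (- e * w + t) * (e / (e ^+ 2 + (t - (- e * w + t)) ^+ 2))).
  by apply: (@L1_affine R (- e) t _ _ i1); rewrite oppr_eq0 gt_eqF.
rewrite -(RintegralZl (`|- e|) measurableT i2); apply: eq_Rintegral => w _.
rewrite normrN gtr0_norm// mulNr [in LHS]addrC mulrCA; congr (_ * _).
rewrite /cauchyk; field.
have h1 : 1 + w ^+ 2 != 0 by rewrite gt_eqF// ltr_pwDl ?sqr_ge0.
by rewrite h1/= gt_eqF.
Qed.

Lemma cauchyk_gt0 w : 0 < cauchyk w.
Proof. by rewrite invr_gt0 ltr_pwDl ?sqr_ge0. Qed.

Lemma continuous_cauchyk : continuous cauchyk.
Proof. exact: continuous_oneDsqrV. Qed.

Lemma measurable_cauchyk : measurable_fun setT cauchyk.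
Proof. by apply: continuous_measurable_fun; exact: continuous_cauchyk. Qed.

Lemma integral_cauchyk : (\int[mu]_w (cauchyk w)%:E = pi%:E)%E.
Proof.
rewrite ge0_symfun_integralT//=.
- have -> : [set x : R | (0 <= x)%R] = `[0%R, +oo[%classic by rewrite -set_itvcy.
  by rewrite [X in (_ * X)%E]integral0y_oneDsqr -EFinM; congr EFin; field.
- by move=> x; rewrite ltW// cauchyk_gt0.
- exact: continuous_cauchyk.
- by move=> x; rewrite /cauchyk /= sqrrN.
Qed.

Lemma L1_cauchyk : L1 cauchyk.
Proof.
apply/L1P; split; first exact: measurable_cauchyk.
under eq_integral do rewrite gtr0_norm ?cauchyk_gt0//.
by rewrite integral_cauchyk ltry.
Qed.

Lemma Rintegral_cauchyk : \int[mu]_w cauchyk w = pi.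
Proof. by rewrite /Rintegral integral_cauchyk. Qed.

Lemma L1_sqr f (M : R) : L1 f -> (forall t, `|f t| <= M) -> L1 (fun t => f t ^+ 2).
Proof.
move=> fi fM; under eq_fun do rewrite expr2.
exact: L1_bounded (L1_measurable fi) fM fi.
Qed.

(** The correlation of [u] with any of its translates is at most the integral of [u ^+ 2], by
    [2 |x y| <= x^2 + y^2] and translation invariance; [cauchyk] has mass [pi]. *)
Lemma energy_le e u (M : R) : 0 < e -> L1 u -> (forall t, `|u t| <= M) ->
  energy e u <= pi * \int[mu]_t (u t ^+ 2).
Proof.
move=> e0 ui uM; apply: (@le_trans _ _ (\int[mu]_t (u t * \int[mu]_w (u (t - e * w) * cauchyk w)))).
  by rewrite le_eqVlt; apply/orP; left; apply/eqP; apply: energy_scale => //; exists M.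
have M0 : 0 <= M by apply: le_trans (uM 0).
have mu' := L1_measurable ui.
have iu2 := L1_sqr ui uM.
have iu2s (w : R) : L1 (fun t => u (t - e * w) ^+ 2) := L1_shift (e * w) iu2.
pose F (z : R * R) := u z.1 * (u (z.1 - e * z.2) * cauchyk z.2).
have mF : measurable_fun setT F.
  apply: measurable_funM; first by apply: (measurableT_comp mu'); exact: measurable_fst.
  apply: measurable_funM; last by apply: (measurableT_comp measurable_cauchyk); exact: measurable_snd.
  apply: (measurableT_comp mu'); apply: measurable_funB; first exact: measurable_fst.
  by apply: measurable_funM => //; exact: measurable_snd.
have ptw (t w : R) : `|u t * u (t - e * w)| <= 2^-1 * (u t ^+ 2 + u (t - e * w) ^+ 2).
  rewrite normrM -(real_normK (num_real (u t))) -(real_normK (num_real (u (t - e * w)))).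
  have := sqr_ge0 (`|u t| - `|u (t - e * w)|); rewrite sqrrB; lra.
have half (w : R) : \int[mu]_t (2^-1 * (u t ^+ 2 + u (t - e * w) ^+ 2)) = \int[mu]_t (u t ^+ 2).
  rewrite (RintegralZl _ measurableT (L1D iu2 (iu2s w))) (RintegralD measurableT iu2 (iu2s w)).
  by rewrite (integral_shift (e * w) iu2); lra.
have ihalf (w : R) : L1 (fun t => 2^-1 * (u t ^+ 2 + u (t - e * w) ^+ 2)) := L1Zl _ (L1D iu2 (iu2s w)).
have [|_ iG FE] := @fubini_dom R F (fun w => (\int[mu]_t (u t ^+ 2)) * cauchyk w) mF (L1Zl _ L1_cauchyk).
  move=> w.
  have i1 : L1 (fun t => cauchyk w * (2^-1 * (u t ^+ 2 + u (t - e * w) ^+ 2))) := L1Zl _ (ihalf w).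
  apply: (@le_trans _ _ (\int[mu]_t (cauchyk w * (2^-1 * (u t ^+ 2 + u (t - e * w) ^+ 2)))%:E)%E).
    apply: ge0_le_integral => //.
    + apply/measurable_EFinP; apply: measurableT_comp => //.
      by apply: (measurableT_comp mF); exact: measurable_fun_pair.
    + exact: (measurable_int mu).
    + move=> t _; rewrite lee_fin /F /= mulrA normrM mulrC (gtr0_norm (cauchyk_gt0 w)).
      by apply: ler_wpM2l; [exact: ltW (cauchyk_gt0 w)|exact: ptw].
  by rewrite (L1_EFin i1) lee_fin (RintegralZl _ measurableT (ihalf w)) half mulrC.
have us (t : R) : measurable_fun setT (fun w : R => u (t - e * w) * cauchyk w).
  apply: measurable_funM; last exact: measurable_cauchyk.
  by apply: (measurableT_comp mu'); apply: measurable_funB => //; exact: measurable_funM.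
have -> : \int[mu]_t (u t * \int[mu]_w (u (t - e * w) * cauchyk w)) = \int[mu]_t \int[mu]_w F (t, w).
  by apply: eq_Rintegral => t _; rewrite (RintegralZl_meas (u t) (us t)).
rewrite FE -Rintegral_cauchyk -(RintegralZr _ measurableT L1_cauchyk).
have iR : L1 (fun w => cauchyk w * \int[mu]_t (u t ^+ 2)).
  by under eq_fun do rewrite mulrC; exact: L1Zl L1_cauchyk.
apply: (le_Rintegral measurableT iG iR) => w _.
have i2 : L1 (fun t => cauchyk w * (u t * u (t - e * w))).
  apply: L1Zl; exact: L1_bounded mu' uM (L1_shift (e * w) ui).
apply: (@le_trans _ _ (\int[mu]_t (cauchyk w * (2^-1 * (u t ^+ 2 + u (t - e * w) ^+ 2))))).
  rewrite (_ : (fun t => F (t, w)) = (fun t => cauchyk w * (u t * u (t - e * w)))); last first.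
    by apply/funext => t; rewrite /F /=; ring.
  apply: (le_Rintegral measurableT i2 (L1Zl _ (ihalf w))) => t _; apply: ler_wpM2l; first exact: ltW (cauchyk_gt0 w).
  exact: le_trans (ler_norm _) (ptw t w).
by rewrite (RintegralZl _ measurableT (ihalf w)) half.
Qed.

Lemma Rintegral_dominated (F_ : nat -> R -> R) f g :
  (forall n, measurable_fun setT (F_ n)) -> measurable_fun setT f ->
  (forall x, F_ n x @[n --> \oo] --> f x) -> L1 g ->
  (forall n x, `|F_ n x| <= g x) ->
  (\int[mu]_x F_ n x) @[n --> \oo] --> \int[mu]_x f x.
Proof.
move=> mF mf cF ig Fg.
have mF' n : measurable_fun setT (fun x => (F_ n x)%:E) by apply/measurable_EFinP.
have mf' : measurable_fun setT (fun x => (f x)%:E) by apply/measurable_EFinP.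
have h1 : {ae @lebesgue_measure R, forall x, [set: R] x -> (F_ n x)%:E @[n --> \oo] --> (f x)%:E}.
  by apply: aeW => x _; apply: cvg_EFin; [exact: nearW|exact: cF].
have h2 : {ae @lebesgue_measure R, forall x n, [set: R] x -> (`|(F_ n x)%:E| <= (g x)%:E)%E}.
  by apply: aeW => x n _; rewrite /= lee_fin.
have [i1 _ c] := @dominated_convergence _ _ R (@lebesgue_measure R) setT measurableT _ _ (EFin \o g) mF' mf' h1 ig h2.
apply: fine_cvg; rewrite /Rintegral fineK; last exact: integrable_fin_num.
exact: c.
Qed.

(** Dominated convergence twice: in [w], by continuity of [f], then in [t], under [M pi |f|]. *)
Lemma energy_cvg f (M : R) : L1 f -> (forall t, `|f t| <= M) -> continuous f ->
  energy n.+1%:R^-1 f @[n --> \oo] --> pi * \int[mu]_t (f t ^+ 2).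
Proof.
move=> fi fM cf; have mf := L1_measurable fi.
have M0 : 0 <= M by apply: le_trans (fM 0).
pose en (n : nat) : R := n.+1%:R^-1.
have en0 n : 0 < en n by rewrite invr_gt0.
pose G n t := \int[mu]_w (f (t - en n * w) * cauchyk w).
have GE n : energy (en n) f = \int[mu]_t (f t * G n t).
  by apply: energy_scale => //; exists M.
have mfs (n : nat) (t : R) : measurable_fun setT (fun w : R => f (t - en n * w)).
  by apply: (measurableT_comp mf); apply: measurable_funB => //; exact: measurable_funM.
have iG n t : L1 (fun w => f (t - en n * w) * cauchyk w).
  exact: L1_bounded (mfs n t) (fun w => fM _) L1_cauchyk.
have Gle n t : `|G n t| <= M * pi.
  apply: le_trans (le_normr_Rintegral measurableT (iG n t)) _.
  rewrite -Rintegral_cauchyk -(RintegralZl M measurableT L1_cauchyk).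
  apply: (le_Rintegral measurableT (L1_norm (iG n t)) (L1Zl M L1_cauchyk)) => w _.
  by rewrite normrM (gtr0_norm (cauchyk_gt0 w)); apply: ler_wpM2r; [exact: ltW (cauchyk_gt0 w)|].
have Gcvg t : G n t @[n --> \oo] --> f t * pi.
  rewrite -Rintegral_cauchyk -(RintegralZl (f t) measurableT L1_cauchyk).
  apply: (Rintegral_dominated (g := fun w => M * cauchyk w)).
  - by move=> n; apply: measurable_funM; [exact: mfs|exact: measurable_cauchyk].
  - by apply: measurable_funM => //; exact: measurable_cauchyk.
  - move=> w; apply: cvgM; last exact: cvg_cst.
    apply: (@cvg_comp _ _ _ (fun n => t - en n * w) f _ (nbhs t)); last exact: cf.
    have H : (fun n => t - en n * w) @ \oo --> t - 0 * w.
      apply: cvgB; first exact: cvg_cst.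
      by apply: cvgM; [exact: cvg_harmonic|exact: cvg_cst].
    by rewrite mul0r subr0 in H.
  - exact: L1Zl L1_cauchyk.
  - move=> n w; rewrite normrM (gtr0_norm (cauchyk_gt0 w)).
    by apply: ler_wpM2r; [exact: ltW (cauchyk_gt0 w)|].
have mG n : measurable_fun setT (fun t => f t * G n t).
  have mF : measurable_fun setT (fun z : R * R => f z.1 * (f (z.1 - en n * z.2) * cauchyk z.2)).
    apply: measurable_funM; first by apply: (measurableT_comp mf); exact: measurable_fst.
    apply: measurable_funM; last by apply: (measurableT_comp measurable_cauchyk); exact: measurable_snd.
    apply: (measurableT_comp mf); apply: measurable_funB; first exact: measurable_fst.
    by apply: measurable_funM => //; exact: measurable_snd.
  have dF (t w : R) : `|f t * (f (t - en n * w) * cauchyk w)| <= M * (`|f t| * `|cauchyk w|).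
    by rewrite !normrM mulrCA; apply: ler_wpM2r => //; exact: mulr_ge0.
  have [h _ _] := fubini_prod mF fi L1_cauchyk dF.
  have -> : (fun t => f t * G n t) = (fun t => \int[mu]_w (f t * (f (t - en n * w) * cauchyk w))).
    by apply/funext => t; rewrite (RintegralZl (f t) measurableT (iG n t)).
  exact: L1_measurable h.
under eq_cvg do rewrite GE.
have -> : pi * \int[mu]_t (f t ^+ 2) = \int[mu]_t (f t * (f t * pi)).
  rewrite -(RintegralZl pi measurableT (L1_sqr fi fM)).
  by apply: eq_Rintegral => t _; ring.
apply: (Rintegral_dominated (g := fun t => (M * pi) * `|f t|)) => //.
- by apply: measurable_funM => //; apply: measurable_funM.
- by move=> t; apply: cvgM; [exact: cvg_cst|exact: Gcvg].
- exact/L1Zl/L1_norm.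
- by move=> n t; rewrite normrM mulrC ler_wpM2r.
Qed.

(** The comparison is integrated against the weight of the energy, then [e] tends to 0. Only [f] is
    taken to the limit; [u] enters through [energy_le], so it may jump, as the forcing does at 0. *)
Lemma parseval_le f u (M C : R) : L1 f -> (forall t, `|f t| <= M) -> continuous f ->
  L1 u -> (forall t, `|u t| <= M) ->
  (forall w, 0 < w -> fcos f w ^+ 2 + fsin f w ^+ 2 <= C * (fcos u w ^+ 2 + fsin u w ^+ 2)) ->
  0 <= C ->
  \int[mu]_t (f t ^+ 2) <= C * \int[mu]_t (u t ^+ 2).
Proof.
move=> fi fM cf ui uM h C0.
have key e : 0 < e -> energy e f <= C * (pi * \int[mu]_t (u t ^+ 2)).
  move=> e0; apply: (@le_trans _ _ (C * energy e u)); last first.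
    by apply: ler_wpM2l => //; exact: energy_le uM.
  rewrite /energy -(RintegralZl C measurableT (L1_energy e0 ui)).
  apply: (le_Rintegral measurableT (L1_energy e0 fi) (L1Zl C (L1_energy e0 ui))) => w _.
  rewrite /damp /heaviside; case: ifPn => w0; last by rewrite mulr0 !mul0r mulr0.
  by rewrite mulr1 mulrCA; apply: ler_wpM2l; [exact: expR_ge0|exact: h].
have c := energy_cvg fi fM cf.
rewrite -(ler_pM2l (pi_gt0 R)) mulrCA.
rewrite -(cvg_lim _ c)//; apply: limr_le; first by apply/cvg_ex; eexists; exact: c.
by apply: nearW => n; exact: key.
Qed.

End parseval.

(** * Zeros of exponential sums and of the characteristic function *)

Section complex_derivative.
Context {R : realType}.
Local Open Scope complex_scope.
Implicit Types (z w h k : R[i]) (f g : R[i] -> R[i]) (Z : set R[i]) (e : R).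

Lemma normcD_le z w : normc (z + w) <= normc z + normc w.
Proof. exact: (@le_normcD R z w). Qed.

Lemma normcNE z : normc (- z) = normc z.
Proof. exact: (@normcN R z). Qed.

Lemma normcB_le z w : normc (z - w) <= normc z + normc w.
Proof. by rewrite -(normcNE w); exact: normcD_le. Qed.

Lemma normcB_ge z w : normc z - normc w <= normc (z - w).
Proof. by rewrite lerBlDr; have := normcD_le (z - w) w; rewrite subrK. Qed.

Lemma normc_ge0 z : 0 <= normc z.
Proof. by case: z => x y; exact: sqrtr_ge0. Qed.

Lemma normc_gt0 z : z != 0 -> 0 < normc z.
Proof.
by move=> z0; rewrite lt_neqAle normc_ge0 andbT eq_sym; apply: contra z0 => /eqP /eq0_normc ->.
Qed.

Lemma Re_le_normc z : `|Re z| <= normc z.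
Proof. by case: z => x y /=; rewrite -(sqrtr_sqr x) ler_wsqrtr// lerDl sqr_ge0. Qed.

Lemma Im_le_normc z : `|Im z| <= normc z.
Proof. by case: z => x y /=; rewrite -(sqrtr_sqr y) ler_wsqrtr// lerDr sqr_ge0. Qed.

Lemma normc_le z : normc z <= `|Re z| + `|Im z|.
Proof.
case: z => x y /=.
rewrite -[leRHS]ger0_norm ?addr_ge0// -sqrtr_sqr ler_wsqrtr// sqrrD !real_normK ?num_real//.
by rewrite lerD2r lerDl mulrn_wge0// mulr_ge0.
Qed.

Lemma normc_real (x : R) : normc x%:C = `|x|.
Proof. by rewrite /= expr0n/= addr0 sqrtr_sqr. Qed.

(** Complex derivative as a first-order expansion, without a quotient, so that [h = 0] is no
    exception. *)
Definition cdiff f z k := forall e, 0 < e -> exists2 d : R, 0 < d &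
  forall h, normc h < d -> normc (f (z + h) - f z - k * h) <= e * normc h.

Lemma is_derive_eps (f : R -> R) (x k e : R) : is_derive x 1 f k -> 0 < e ->
  exists2 d : R, 0 < d & forall h : R, `|h| < d -> `|f (x + h) - f x - k * h| <= e * `|h|.
Proof.
move=> [df dk] e0.
have := df; rewrite /derivable => /cvg_ex[l hl].
have kl : k = l by rewrite -dk; apply/cvg_lim.
move/cvgrPdist_le : hl => /(_ _ e0)[d /= d0 H].
exists d => // h hd; have [->|h0] := eqVneq h 0.
  by rewrite addr0 subrr mulr0 subr0 normr0 mulr0.
have := H h; rewrite /ball_/= sub0r normrN => /(_ hd h0).
rewrite -kl -![_ *: _]/(_ * _) mulr1 => Hh.
have -> : f (x + h) - f x - k * h = - ((k - h^-1 * (f (h + x) - f x)) * h).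
  by rewrite (addrC h x); field.
by rewrite normrN normrM ler_wpM2r.
Qed.

Lemma cdiff_cexp0 : cdiff (@cexp R) 0 1.
Proof.
move=> e e0.
(* The two components below contribute [3 c n] and [5 c n], hence [e / 8]; [c <= 1] bounds [|x|] and
   gives the factors 2. *)
have [c c0 [c1 c8]] : exists2 c : R, 0 < c & c <= 1 /\ c <= e / 8.
  exists (Num.min 1 (e / 8)); first by rewrite lt_min ltr01 divr_gt0.
  by rewrite !ge_min !lexx orbT.
have [d1 d10 H1] := is_derive_eps (is_derive_expR (0 : R)) c0.
have [d2 d20 H2] := is_derive_eps (is_derive_cos (0 : R)) c0.
have [d3 d30 H3] := is_derive_eps (is_derive_sin (0 : R)) c0.
exists (Num.min c (Num.min d1 (Num.min d2 d3))); first by rewrite !lt_min c0 d10 d20.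
move=> h; rewrite !lt_min => /and4P[hc h1 h2 h3].
have hx := Re_le_normc h; have hy := Im_le_normc h.
apply: le_trans (normc_le _) _.
have := H1 _ (le_lt_trans hx h1); have := H2 _ (le_lt_trans hy h2); have := H3 _ (le_lt_trans hy h3).
have n0 := normc_ge0 h.
case: h hc hx hy n0 {h1 h2 h3} => x y /= ; set n := Num.sqrt _ => hc hx hy n0.
rewrite !add0r expR0 cos0 sin0 oppr0 mul0r !subr0 !mul1r => s1 c2 e1.
rewrite addr0 in s1; rewrite mul0r addr0 subr0.
have cy : `|cos y| <= 1 := cos_max y.
have x1 : `|x| <= 1 by apply: le_trans hx _; apply: le_trans c1; exact: ltW.
have b1 : `|expR x * cos y - 1 - x| <= c * n + 2 * (c * n).
  have -> : expR x * cos y - 1 - x = (expR x - 1 - x) * cos y + (1 + x) * (cos y - 1) by ring.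
  apply: le_trans (ler_normD _ _) _; rewrite !normrM; apply: lerD.
    rewrite -[leRHS]mulr1; apply: ler_pM => //; apply: le_trans e1 _.
    by rewrite ler_wpM2l// ltW.
  apply: ler_pM => //.
    by apply: le_trans (ler_normD _ _) _; rewrite normr1; lra.
  by apply: le_trans c2 _; rewrite ler_wpM2l// ltW.
have ex : `|expR x - 1| <= 2 * `|x|.
  have -> : expR x - 1 = (expR x - 1 - x) + x by ring.
  apply: le_trans (ler_normD _ _) _; rewrite mulrDl mul1r lerD2r.
  by apply: le_trans e1 _; rewrite ler_piMl.
have sy : `|sin y| <= 2 * `|y|.
  have -> : sin y = (sin y - y) + y by ring.
  apply: le_trans (ler_normD _ _) _; rewrite mulrDl mul1r lerD2r.
  by apply: le_trans s1 _; rewrite ler_piMl.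
have b2 : `|expR x * sin y - y| <= 4 * (c * n) + c * n.
  have -> : expR x * sin y - y = (expR x - 1) * sin y + (sin y - y) by ring.
  apply: le_trans (ler_normD _ _) _; rewrite !normrM; apply: lerD.
    have -> : 4 * (c * n) = (2 * c) * (2 * n) by ring.
    apply: ler_pM => //.
      by apply: le_trans ex _; rewrite ler_wpM2l//; apply: le_trans hx _; exact: ltW.
    by apply: le_trans sy _; rewrite ler_wpM2l.
  by apply: le_trans s1 _; rewrite ler_wpM2l// ltW.
have cn : c * n <= e / 8 * n by rewrite ler_wpM2r.
apply: (@le_trans _ _ (8 * (c * n))); last by lra.
have -> : 8 * (c * n) = (c * n + 2 * (c * n)) + (4 * (c * n) + c * n) by ring.
exact: lerD.
Qed.

Lemma cdiff_cexp z : cdiff (@cexp R) z (cexp z).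
Proof.
move=> e e0.
have n1 : 0 < normc (cexp z) + 1 by rewrite ltr_wpDl ?normc_ge0.
have [d d0 H] := cdiff_cexp0 (divr_gt0 e0 n1); exists d => // h /H hd.
have -> : cexp (z + h) - cexp z - cexp z * h = cexp z * (cexp (0 + h) - cexp 0 - 1 * h).
  by rewrite cexpD cexp0 add0r; ring.
rewrite normcM; apply: le_trans (ler_wpM2l (normc_ge0 _) hd) _.
rewrite mulrA ler_wpM2r ?normc_ge0// mulrCA ler_piMr ?(ltW e0)//.
by rewrite ler_pdivrMr// mul1r lerDl.
Qed.

Lemma cdiff_cst k z : cdiff (fun _ => k) z 0.
Proof.
move=> e e0; exists 1 => // h _.
by rewrite subrr mul0r subr0 normc0 mulr_ge0 ?(ltW e0) ?normc_ge0.
Qed.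

Lemma cdiffD f g z k k' : cdiff f z k -> cdiff g z k' -> cdiff (fun w => f w + g w) z (k + k').
Proof.
move=> hf hg e e0; have e20 : 0 < e / 2 by rewrite divr_gt0.
have [d d0 H] := hf _ e20; have [d' d'0 H'] := hg _ e20.
exists (Num.min d d'); first by rewrite lt_min d0.
move=> h; rewrite lt_min => /andP[hd hd'].
have -> : f (z + h) + g (z + h) - (f z + g z) - (k + k') * h =
  (f (z + h) - f z - k * h) + (g (z + h) - g z - k' * h) by ring.
apply: le_trans (normcD_le _ _) _; have := H _ hd; have := H' _ hd'; lra.
Qed.

Lemma cdiffZ c f z k : cdiff f z k -> cdiff (fun w => c * f w) z (c * k).
Proof.
move=> hf e e0; have n1 : 0 < normc c + 1 by rewrite ltr_wpDl ?normc_ge0.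
have [d d0 H] := hf _ (divr_gt0 e0 n1); exists d => // h /H hd.
have -> : c * f (z + h) - c * f z - c * k * h = c * (f (z + h) - f z - k * h) by ring.
rewrite normcM; apply: le_trans (ler_wpM2l (normc_ge0 c) hd) _.
rewrite mulrA ler_wpM2r ?normc_ge0// mulrCA ler_piMr ?(ltW e0)//.
by rewrite ler_pdivrMr// mul1r lerDl.
Qed.

Lemma cdiff_lin c z : cdiff (fun w => c * w) z c.
Proof.
move=> e e0; exists 1 => // h _.
have -> : c * (z + h) - c * z - c * h = 0 by ring.
by rewrite normc0 mulr_ge0 ?(ltW e0) ?normc_ge0.
Qed.

Lemma cdiff_comp f g z k k' : cdiff g z k' -> cdiff f (g z) k -> cdiff (fun w => f (g w)) z (k * k').
Proof.
move=> hg hf e e0.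
have K0 : 0 < normc k' + 1 by rewrite ltr_wpDl ?normc_ge0.
have k1 : 0 < normc k + 1 by rewrite ltr_wpDl ?normc_ge0.
have [d d0 H] := hf (e / 2 / (normc k' + 1)) (divr_gt0 (divr_gt0 e0 (ltr0Sn R 1)) K0).
have [d1 d10 H1] := hg 1 ltr01.
have [d2 d20 H2] := hg (e / 2 / (normc k + 1)) (divr_gt0 (divr_gt0 e0 (ltr0Sn R 1)) k1).
exists (Num.min d1 (Num.min d2 (d / (normc k' + 1)))); first by rewrite !lt_min d10 d20 divr_gt0.
move=> h; rewrite !lt_min => /and3P[h1 h2 h3].
have n0 := normc_ge0 h.
pose u := g (z + h) - g z.
have uE : g (z + h) = g z + u by rewrite /u; ring.
have u1 : normc u <= (normc k' + 1) * normc h.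
  have -> : u = (u - k' * h) + k' * h by ring.
  apply: le_trans (normcD_le _ _) _; rewrite normcM mulrDl addrC lerD2l.
  exact: H1.
have ud : normc u < d by apply: le_lt_trans u1 _; rewrite mulrC -ltr_pdivlMr.
rewrite uE.
have -> : f (g z + u) - f (g z) - k * k' * h = (f (g z + u) - f (g z) - k * u) + k * (u - k' * h) by ring.
apply: le_trans (normcD_le _ _) _; rewrite normcM.
have b1 : normc (f (g z + u) - f (g z) - k * u) <= e / 2 * normc h.
  apply: le_trans (H _ ud) _; apply: le_trans (ler_wpM2l _ u1) _.
    by rewrite !divr_ge0 ?(ltW e0) ?(ltW K0).
  by rewrite mulrA divfK ?gt_eqF.
have b2 : normc k * normc (u - k' * h) <= e / 2 * normc h.
  apply: le_trans (ler_wpM2l (normc_ge0 k) (H2 _ h2)) _.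
  rewrite mulrA ler_wpM2r// mulrCA ler_piMr ?divr_ge0 ?(ltW e0)//.
  by rewrite ler_pdivrMr// mul1r lerDl.
lra.
Qed.

Definition accum Z z := forall d : R, 0 < d -> exists2 w, Z w & w != z /\ normc (w - z) < d.

(** Applied to a nearby zero with tolerance [|k| / 2], the expansion would give [|k| <= |k| / 2]. *)
Lemma accum_cdiff0 Z f z k : accum Z z -> Z z -> (forall w, Z w -> f w = 0) -> cdiff f z k -> k = 0.
Proof.
move=> aZ Zz fZ hf; apply: contrapT => /eqP k0.
have n0 := normc_gt0 k0.
have [d d0 H] := hf (normc k / 2) (divr_gt0 n0 (ltr0Sn R 1)).
have [w Zw [wz wd]] := aZ d d0.
have := H _ wd; rewrite [z + _]addrC subrK !fZ// subrr sub0r normcNE normcM.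
rewrite ler_pM2r; last by rewrite normc_gt0// subr_eq0.
by move=> ?; lra.
Qed.

(** A point of [Z] that is not an accumulation point is alone in a box with rational corners, and
    there are countably many such boxes. *)
Lemma uncountable_accum Z : ~ countable Z -> ~ countable [set z | Z z /\ accum Z z].
Proof.
move=> uZ cA; apply: uZ.
pose box (q : (rat * rat) * (rat * rat)) : set R[i] :=
  [set z | ratr q.1.1 < Re z < ratr q.1.2 /\ ratr q.2.1 < Im z < ratr q.2.2].
pose F q := [set z | [/\ Z z, box q z & forall w, Z w -> box q w -> w = z]].
have cF q : countable (F q).
  have [[z0 Fz0]|nF] := pselect (exists z, F q z).
    have -> : F q = [set z0]; last exact: countable1.
    apply/seteqP; split => [z [Zz bz _]|z ->//].
    by case: Fz0 => _ _ h; exact: h.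
  have -> : F q = set0; last exact: countable0.
  by apply/seteqP; split => // z Fz; case: nF; exists z.
(* [None] indexes the accumulation points, assumed countable, so that one countable union covers
   [Z]. *)
pose G (o : option ((rat * rat) * (rat * rat))) : set R[i] :=
  if o is Some q then F q else [set z | Z z /\ accum Z z].
suff ZG : Z `<=` \bigcup_o G o.
  apply: (sub_countable (subset_card_le ZG)).
  by apply: bigcup_countable => // -[q|] _; [exact: cF|].
move=> z Zz.
have [az|naz] := pselect (accum Z z); first by exists None.
have [d d0 H] : exists2 d : R, 0 < d & forall w, Z w -> normc (w - z) < d -> w = z.
  apply: contrapT => nd; apply: naz => d d0; apply: contrapT => nw; apply: nd.
  exists d => // w Zw wd; apply: contrapT => /eqP wz; apply: nw; exists w => //.
have d20 : 0 < d / 2 by rewrite divr_gt0.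
have [q1] := @rat_in_itvoo R (Re z - d / 2) (Re z) ltac:(lra).
have [q2] := @rat_in_itvoo R (Re z) (Re z + d / 2) ltac:(lra).
have [q3] := @rat_in_itvoo R (Im z - d / 2) (Im z) ltac:(lra).
have [q4] := @rat_in_itvoo R (Im z) (Im z + d / 2) ltac:(lra).
rewrite !in_itv/= => /andP[a1 a2] /andP[a3 a4] /andP[a5 a6] /andP[a7 a8].
exists (Some ((q1, q2), (q3, q4))) => //; split => //; first by rewrite /box/= a8 a5 a4 a1.
move=> w Zw [/andP[b1 b2] /andP[b3 b4]]; apply: H => //.
apply: le_lt_trans (normc_le _) _.
move: b1 b2 b3 b4; case: w Zw => wx wy Zw; case: z a1 a2 a3 a4 a5 a6 a7 a8 {Zz naz} => zx zy /=.
move=> *; rewrite [d]splitr ltrD// ltr_norml; apply/andP; split; lra.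
Qed.

(** Takes the place of the identity theorem: it gains one derivative at a time and can be iterated,
    since [Z'] is again uncountable. *)
Lemma uncountable_deriv Z f (f' : R[i] -> R[i]) : ~ countable Z ->
  (forall z, Z z -> f z = 0) -> (forall z, cdiff f z (f' z)) ->
  exists2 Z', ~ countable Z' & forall z, Z' z -> Z z /\ f' z = 0.
Proof.
move=> uZ fZ df; exists [set z | Z z /\ accum Z z]; first exact: uncountable_accum.
by move=> z [Zz az]; split=> //; exact: accum_cdiff0 az Zz fZ (df z).
Qed.

End complex_derivative.

Section exponential_sums.
Context {R : realType}.
Local Open Scope complex_scope.
Implicit Types (z w : R[i]) (Z : set R[i]) (l : seq (R * R)) (b c : R).

Definition expsum l w : R[i] := \sum_(x <- l) x.2%:C * cexp (x.1%:C * w).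

Definition dexpsum l := [seq (x.1, x.2 * x.1) | x <- l].

Lemma expsum_cons x l w : expsum (x :: l) w = x.2%:C * cexp (x.1%:C * w) + expsum l w.
Proof. by rewrite /expsum big_cons. Qed.

Lemma expsum_nil w : expsum [::] w = 0. Proof. by rewrite /expsum big_nil. Qed.

Lemma cdiff_expsum l z : cdiff (expsum l) z (expsum (dexpsum l) z).
Proof.
elim: l => [|x l IH].
  rewrite expsum_nil; have -> : expsum [::] = (fun _ => 0) by apply/funext => w; exact: expsum_nil.
  exact: cdiff_cst.
rewrite /dexpsum /= expsum_cons /=.
have -> : expsum (x :: l) = fun w => x.2%:C * cexp (x.1%:C * w) + expsum l w.
  by apply/funext => w; exact: expsum_cons.
apply: cdiffD => //; rewrite rmorphM -mulrA; apply: cdiffZ; rewrite mulrC.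
exact: cdiff_comp (cdiff_lin _ _) (cdiff_cexp _).
Qed.

Lemma expsum_shift l w b :
  cexp (- (b%:C * w)) * expsum l w = expsum [seq (x.1 - b, x.2) | x <- l] w.
Proof.
elim: l => [|x l IH]; first by rewrite !expsum_nil mulr0.
rewrite expsum_cons /= expsum_cons /= mulrDr IH; congr (_ + _).
rewrite mulrCA -cexpD; congr (_ * cexp _).
by rewrite rmorphB /=; ring.
Qed.

Lemma expsum_const0 x l w : x.1 = 0 -> expsum (dexpsum (x :: l)) w = expsum (dexpsum l) w.
Proof. by move=> x0; rewrite /dexpsum /= expsum_cons /= x0 mulr0 mul0r add0r. Qed.

Lemma nonempty_uncountable Z : ~ countable Z -> exists z, Z z.
Proof.
move=> uZ; apply: contrapT => nZ; apply: uZ.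
have -> : Z = set0 by apply/seteqP; split => // z Zz; apply: nZ; exists z.
exact: countable0.
Qed.

(* Each exponential other than the first is removed by dividing by it and differentiating. *)
Lemma expsum_uncountable b c l Z : c != 0 -> all (fun x => x.1 != b) l ->
  ~ countable Z -> ~ (forall z, Z z -> expsum ((b, c) :: l) z = 0).
Proof.
have [n] := ubnP (size l); elim: n => // n IH in b c l Z *.
case: l => [|x l] /= ln c0 hb uZ Z0.
  have [z Zz] := nonempty_uncountable uZ.
  have := Z0 _ Zz; rewrite expsum_cons expsum_nil addr0 => /eqP.
  by rewrite mulf_eq0 (negbTE (cexp_neq0 _)) orbF /= eq_complex/= eqxx andbT (negbTE c0).
have [xb hl] := andP hb.
pose sh (y : R * R) := (y.1 - x.1, y.2).
(* Division turns the term of [x] into a constant, which differentiation removes. The leading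
   exponent becomes [b - x.1], which is nonzero and multiplies the coefficient [c]. *)
have Z1 z : Z z -> expsum (map sh [:: x, (b, c) & l]) z = 0.
  move=> Zz; rewrite -expsum_shift.
  have -> : expsum [:: x, (b, c) & l] z = expsum [:: (b, c), x & l] z.
    by rewrite !expsum_cons addrCA.
  by rewrite Z0// mulr0.
have [Z' uZ' hZ'] := uncountable_deriv uZ Z1 (fun z => cdiff_expsum _ z).
apply: (IH (b - x.1) (c * (b - x.1)) (dexpsum (map sh l)) Z') => //.
- by rewrite !size_map.
- by rewrite mulf_neq0// subr_eq0 eq_sym.
- rewrite all_map all_map; apply: sub_all hl => y /=.
  by rewrite (inj_eq (addIr _)).
- move=> z /hZ' [_ h]; move: h.
  rewrite -[map sh _]/(sh x :: map sh ((b, c) :: l)) expsum_const0; last by rewrite /= subrr.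
  exact.
Qed.

End exponential_sums.

(** * The characteristic function: zero-free lines, a positive root, a lower bound *)

Section symbol.
Context {R : realType}.
Local Open Scope complex_scope.
Variables (al a d p q tau : R).
Hypotheses (al0 : 0 < al) (d0 : 0 < d) (p0 : 0 < p) (pq : p < q) (tau0 : 0 <= tau).
Implicit Types (s w z : R[i]).

Definition symb s : R[i] := a%:C * cpow s al + d%:C * cpow s (2 * al).
Definition delta s : R[i] := symb s + p%:C - q%:C * cexp (- (s * tau%:C)).

(* [delta] in the variable [w = log s], where it becomes an entire function. *)
Let f0 w := expsum [:: (al, a); (2 * al, d)] w + p%:C - q%:C * cexp (- tau%:C * cexp w).

Let f0E s : 0 < Re s -> f0 (clog s) = delta s.
Proof.
move=> s0; rewrite /f0 !expsum_cons expsum_nil addr0 /= clogK// /delta /symb /cpow.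
by rewrite mulNr (mulrC tau%:C).
Qed.

(** [f0] and its derivative vanish together on an uncountable set, which is enough to eliminate the
    double exponential and to reach an exponential sum. *)
Let f0_uncountable (Z : set R[i]) : ~ countable Z -> ~ (forall z, Z z -> f0 z = 0).
Proof.
move=> uZ Z0.
pose f0' w := expsum (dexpsum [:: (al, a); (2 * al, d)]) w
   + 0 + (- q%:C) * (cexp (- tau%:C * cexp w) * (- tau%:C * cexp w)).
have df z : cdiff f0 z (f0' z).
  have -> : f0 = fun w => expsum [:: (al, a); (2 * al, d)] w + p%:C + (- q%:C) * cexp (- tau%:C * cexp w).
    by apply/funext => w; rewrite /f0 -mulNr.
  apply: cdiffD; first by apply: cdiffD; [exact: cdiff_expsum|exact: cdiff_cst].
  apply: cdiffZ; apply: (@cdiff_comp R (@cexp R) (fun w => - tau%:C * cexp w)); last exact: cdiff_cexp.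
  exact: cdiffZ (cdiff_cexp z).
have [Z' uZ' hZ'] := uncountable_deriv uZ Z0 df.
(* [f0' + tau e^w f0] contains no exponential of an exponential. *)
have E z : Z' z -> expsum [:: (1 + 2 * al, tau * d); (2 * al, 2 * al * d); (1 + al, tau * a); (al, al * a); (1, tau * p)] z = 0.
  move=> /hZ' [/Z0 h0 h1].
  have <- : f0' z + tau%:C * cexp z * f0 z = 0 by rewrite h0 h1 mulr0 addr0.
  rewrite /f0' /f0 /dexpsum /= !expsum_cons !expsum_nil /=.
  rewrite !rmorphM !rmorphD /= !mulrDl !mul1r !cexpD !rmorphD /= !mulrDl !cexpD; ring.
(* For [tau = 0] the term of largest exponent [1 + 2 * al] disappears, and [2 * al] leads
   instead. *)
have [t0|t0] := eqVneq tau 0.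
  apply: (@expsum_uncountable R (2 * al) (2 * al * d) [:: (al, al * a)] Z') => //.
  - by rewrite !mulf_neq0 ?gt_eqF.
  - by rewrite /= andbT lt_eqF//; move: al0; lra.
  - move=> z /E; rewrite t0 !expsum_cons !expsum_nil /= !mul0r.
    by rewrite !(add0r, addr0).
apply: (@expsum_uncountable R _ _ _ Z' _ _ uZ' E); first by rewrite mulf_neq0// gt_eqF.
by rewrite /= !lt_eqF//; move: al0; lra.
Qed.

(** Otherwise the real parts of [cexp] on the countable zero set of [f0] would cover []0, lam[],
    which has positive measure. *)
Lemma zero_free_line (lam : R) : 0 < lam ->
  exists2 c : R, 0 < c < lam & forall w : R, delta (c +i* w) != 0.
Proof.
move=> lam0; apply: contrapT => nc.
pose Z := [set z | f0 z = 0].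
apply: (@f0_uncountable Z); last by [].
move=> cZ.
have sub : `]0, lam[%classic `<=` (fun z => Re (cexp z)) @` Z.
  move=> c; rewrite /= in_itv/= => c0l; have [c0 _] := andP c0l.
  have [w hw] : exists w : R, delta (c +i* w) = 0.
    apply: contrapT => nw; apply: nc; exists c => // w; apply/eqP => h; apply: nw; by exists w.
  exists (clog (c +i* w)); first by rewrite /Z/= f0E.
  exact: (congr1 (@complex.Re R) (clogK (z := c +i* w) c0)).
have cI : countable (`]0, lam[%classic : set R).
  apply: (sub_countable (subset_card_le sub)).
  exact: (sub_countable (card_image_le _ _)).
have := countable_lebesgue_measure0 cI.
rewrite lebesgue_measure_itv/= lte_fin lam0 oppr0 addr0 => /eqP.
by rewrite eqe gt_eqF.
Qed.

(** Intermediate value theorem on the positive reals, where [delta] is real: its limit at 0 is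
    [p - q < 0], and [d x^(2 al)] dominates for large [x], whatever the sign of [a]. *)
Lemma real_root : exists2 lam : R, 0 < lam & delta lam%:C = 0.
Proof.
pose g (x : R) := a * x `^ al + d * x `^ (2 * al) + p - q * expR (- (x * tau)).
have gE x : 0 < x -> delta x%:C = (g x)%:C.
  move=> x0; rewrite /delta /symb !cpow_real//.
  have -> : - (x%:C * tau%:C) = (- (x * tau))%:C by rewrite rmorphN rmorphM.
  by rewrite cexp_real /g rmorphB !rmorphD !rmorphM.
have al20 : 0 < 2 * al by rewrite mulr_gt0.
have [x0 x00 [x01 gx0]] : exists2 x0 : R, 0 < x0 & x0 < 1 /\ g x0 < 0.
  have cg : g x @[x --> 0^'+] --> a * 0 + d * 0 + p - q * expR (- (0 * tau)).
    apply: cvgB; last first.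
      apply: cvgM; first exact: cvg_cst.
      apply: (@cvg_comp _ _ _ (fun x => - (x * tau)) (@expR R) _ (nbhs (- (0 * tau)))); last exact: continuous_expR.
      apply: cvgN; apply: cvgM; last exact: cvg_cst.
      by apply: cvg_at_right_filter; exact: cvg_id.
    apply: cvgD; last exact: cvg_cst.
    by apply: cvgD; apply: cvgM; try exact: cvg_cst; exact: powR_cvg0.
  rewrite !mulr0 !add0r mul0r oppr0 expR0 mulr1 in cg.
  have : \forall x \near 0^'+, [/\ 0 < x, x < 1 & g x < 0].
    near=> x; split.
    - by near: x; exact: nbhs_right_gt.
    - by near: x; exact: nbhs_right_lt.
    - by near: x; apply: (cvgr_lt _ cg); rewrite subr_lt0.
  by move=> /filter_ex [x [h1 h2 h3]]; exists x.
(* Chosen so that [d * z1 = |a| + q + d]: then [d * z1 ^+ 2] exceeds [|a| * z1 + q]. Moreover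
   [z1 >= 1] keeps [x1] to the right of [x0]. *)
pose z1 := (`|a| + q) / d + 1.
have q0 : 0 < q by apply: lt_trans pq.
have z11 : 1 <= z1 by rewrite lerDr divr_ge0 ?addr_ge0 ?(ltW q0) ?(ltW d0).
pose x1 := z1 `^ al^-1.
have x1E : x1 `^ al = z1.
  by rewrite /x1 -powRrM mulVf ?gt_eqF// powRr1// (le_trans ler01).
have x11 : 1 <= x1.
  by rewrite -(powRr0 z1) ler_powR// invr_ge0 ltW.
have gx1 : 0 <= g x1.
  rewrite /g x1E (mulrC 2) powRrM x1E -[2]/(2%:R) powR_mulrn; last exact: le_trans z11.
  have dz : d * z1 = `|a| + q + d by rewrite /z1; field; rewrite gt_eqF.
  rewrite expr2 mulrA dz.
  have e1 : expR (- (x1 * tau)) <= 1.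
    by rewrite -[leRHS]expR0 ler_expR oppr_le0 mulr_ge0// (le_trans ler01).
  have a1 : - (`|a| * z1) <= a * z1 by rewrite -mulNr ler_wpM2r ?(le_trans ler01 z11)// lerNl -normrN ler_norm.
  have q1 : q * expR (- (x1 * tau)) <= q by rewrite ler_piMr// ltW.
  have q2 : q <= q * z1 by rewrite ler_peMr// ltW.
  have d2 : 0 <= d * z1 by apply: mulr_ge0; [exact: ltW|exact: le_trans z11].
  rewrite mulrDl mulrDl; move: p0; lra.
have x0x1 : x0 <= x1 by apply: ltW; apply: lt_le_trans x11.
have [||c] := @IVT R g x0 x1 0 x0x1.
- apply: continuous_in_subspaceT => x; rewrite inE/= in_itv/= => /andP[h1 _].
  have xx : 0 < x by apply: lt_le_trans h1.
  have cp b : {for x, continuous (fun y : R => y `^ b)}.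
    by apply/differentiable_continuous/derivable1_diffP; have h := is_derive1_powR b xx; exact: ex_derive.
  apply: cvgB; last first.
    apply: cvgM; first exact: cvg_cst.
    apply: (@cvg_comp _ _ _ (fun x => - (x * tau)) (@expR R) _ (nbhs (- (x * tau)))); last exact: continuous_expR.
    by apply: cvgN; apply: cvgM; [exact: cvg_id|exact: cvg_cst].
  apply: cvgD; last exact: cvg_cst.
  by apply: cvgD; apply: cvgM; try exact: cvg_cst; exact: cp.
- by rewrite ge_min le_max gx1 (ltW gx0) orbT.
- rewrite in_itv/= => /andP[h1 _] gc; have c0 : 0 < c by apply: lt_le_trans h1.
  by exists c => //; rewrite gE// gc.
Unshelve. all: by end_near. Qed.

(** Compactness on [[0, W]]; beyond [W] the term [d s^(2 al)] dominates, since
    [|exp (- s tau)| <= 1] for [Re s > 0]. *)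
Lemma delta_lower_bound (c : R) : 0 < c -> (forall w : R, delta (c +i* w) != 0) ->
  exists2 m : R, 0 < m & forall w : R, 0 < w -> m <= normc (delta (c +i* w)).
Proof.
move=> c0 nz.
have q0 : 0 < q by apply: lt_trans pq.
pose rho (w : R) := Num.sqrt (c ^+ 2 + w ^+ 2).
have rho2 (w : R) : 0 < c ^+ 2 + w ^+ 2 by rewrite ltr_pwDl ?exprn_gt0 ?sqr_ge0.
have rho0 (w : R) : 0 < rho w by rewrite sqrtr_gt0.
have crho : continuous rho.
  move=> w; apply: (@cvg_comp _ _ _ (fun w : R => c ^+ 2 + w ^+ 2) (@Num.sqrt R) _ (nbhs (c ^+ 2 + w ^+ 2))).
    by apply: cvgD; [exact: cvg_cst|exact: exprn_continuous].
  exact: sqrt_continuous.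
pose th (w : R) := atan (w / c).
have cth : continuous th.
  move=> w; apply: (@cvg_comp _ _ _ (fun w : R => w / c) (@atan R) _ (nbhs (w / c))).
    by apply: cvgM; [exact: cvg_id|exact: cvg_cst].
  exact: continuous_atan.
have cexpRc (g : R -> R) : continuous g -> continuous (fun w : R => expR (g w)).
  by move=> cg w; apply: (@cvg_comp _ _ _ g (@expR R) _ (nbhs (g w))); [exact: cg|exact: continuous_expR].
have ccosc (g : R -> R) : continuous g -> continuous (fun w : R => cos (g w)).
  by move=> cg w; apply: (@cvg_comp _ _ _ g (@cos R) _ (nbhs (g w))); [exact: cg|exact: continuous_cos].
have csinc (g : R -> R) : continuous g -> continuous (fun w : R => sin (g w)).
  by move=> cg w; apply: (@cvg_comp _ _ _ g (@sin R) _ (nbhs (g w))); [exact: cg|exact: continuous_sin].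
have cM (g h : R -> R) : continuous g -> continuous h -> continuous (fun w : R => g w * h w).
  by move=> cg ch w; apply: cvgM; [exact: cg|exact: ch].
have cD (g h : R -> R) : continuous g -> continuous h -> continuous (fun w : R => g w + h w).
  by move=> cg ch w; apply: cvgD; [exact: cg|exact: ch].
have cN (g : R -> R) : continuous g -> continuous (fun w : R => - g w).
  by move=> cg w; apply: cvgN; exact: cg.
have ck (k : R) : continuous (fun _ : R => k) by move=> w; exact: cvg_cst.
pose CC (F : R -> R[i]) := continuous (fun w : R => Re (F w)) /\ continuous (fun w : R => Im (F w)).
have CCD F G : CC F -> CC G -> CC (fun w : R => F w + G w).
  move=> [F1 F2] [G1 G2]; split.
    have -> : (fun w : R => Re (F w + G w)) = (fun w : R => Re (F w) + Re (G w)).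
      by apply/funext => w; case: (F w) => ? ?; case: (G w).
    exact: cD.
  have -> : (fun w : R => Im (F w + G w)) = (fun w : R => Im (F w) + Im (G w)).
    by apply/funext => w; case: (F w) => ? ?; case: (G w).
  exact: cD.
have CCM F G : CC F -> CC G -> CC (fun w : R => F w * G w).
  move=> [F1 F2] [G1 G2]; split.
    have -> : (fun w : R => Re (F w * G w)) = (fun w : R => Re (F w) * Re (G w) + - (Im (F w) * Im (G w))).
      by apply/funext => w; case: (F w) => ? ?; case: (G w).
    by apply: cD; [exact: cM|apply: cN; exact: cM].
  have -> : (fun w : R => Im (F w * G w)) = (fun w : R => Re (F w) * Im (G w) + Im (F w) * Re (G w)).
    by apply/funext => w; case: (F w) => ? ?; case: (G w).
  by apply: cD; exact: cM.
have CCE F : CC F -> CC (fun w : R => cexp (F w)).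
  move=> [F1 F2]; split; rewrite /cexp/=; apply: cM; try exact: cexpRc; [exact: ccosc|exact: csinc].
have CCc (k : R[i]) : CC (fun _ => k) by split; exact: ck.
have CCl : CC (fun w : R => clog (c +i* w)).
  split => /=; last exact: cth.
  move=> w; apply: (@cvg_comp _ _ _ rho (@ln R) _ (nbhs (rho w))); first exact: crho.
  exact: continuous_ln (rho0 w).
have CCs : CC (fun w : R => c +i* w) by split => /=; [exact: ck|move=> w; exact: cvg_id].
have CCd : CC (fun w : R => delta (c +i* w)).
  rewrite /delta /symb /cpow.
  apply: (CCD _ _); last first.
    have -> : (fun w : R => - (q%:C * cexp (- ((c +i* w) * tau%:C)))) = (fun w : R => (- q%:C) * cexp ((c +i* w) * (- tau%:C))).
      by apply/funext => w; rewrite mulNr mulrN.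
    by apply: (CCM _ _) => //; apply: (CCE _); exact: (CCM _ _).
  apply: (CCD _ _) => //; apply: (CCD _ _); apply: (CCM _ _) => //; apply: (CCE _); exact: (CCM _ _).
pose N (w : R) := normc (delta (c +i* w)).
have cN' : continuous N.
  case: CCd => h1 h2 w.
  have -> : N = fun w : R => Num.sqrt (Re (delta (c +i* w)) * Re (delta (c +i* w)) + Im (delta (c +i* w)) * Im (delta (c +i* w))).
    by apply/funext => v; rewrite /N; case: (delta _) => x y /=; rewrite !expr2.
  apply: (@cvg_comp _ _ _ (fun w : R => Re (delta (c +i* w)) * Re (delta (c +i* w)) + Im (delta (c +i* w)) * Im (delta (c +i* w))) (@Num.sqrt R) _ (nbhs _)).
    by apply: cD; exact: cM.
  exact: sqrt_continuous.
(* Chosen so that [d * z1 = (|a| + p + q + 1) + d]: once [|s|^al >= z1], the modulus of [delta] is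
   at least 1. *)
pose z1 := (`|a| + p + q + 1) / d + 1.
have z11 : 1 <= z1 by rewrite lerDr divr_ge0 ?addr_ge0 ?(ltW q0) ?(ltW d0) ?(ltW p0).
pose W := z1 `^ al^-1.
have W0 : 0 <= W by exact: powR_ge0.
have WE : W `^ al = z1.
  by rewrite /W -powRrM mulVf ?gt_eqF// powRr1// (le_trans ler01).
have [x hx Nx] := @EVT_min R N 0 W W0 (continuous_subspaceT cN').
have Nx0 : 0 < N x by apply: normc_gt0.
exists (Num.min 1 (N x)); first by rewrite lt_min ltr01.
move=> w w0; have [wW|Ww] := leP w W.
  by apply: (@le_trans _ _ (N x)); [rewrite ge_min lexx orbT|apply: Nx; rewrite in_itv/= (ltW w0)].
apply: (@le_trans _ _ 1); first by rewrite ge_min lexx.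
pose zr := rho w `^ al.
have rW : W <= rho w.
  apply: le_trans (ltW Ww) _; rewrite -[leLHS]ger0_norm ?(ltW w0)// -sqrtr_sqr ler_wsqrtr//.
  by rewrite lerDr sqr_ge0.
have zz : z1 <= zr.
  by rewrite -WE ge0_ler_powR ?nnegrE ?(ltW al0)// ltW.
have zr1 : 1 <= zr := le_trans z11 zz.
have n1 : normc (cpow (c +i* w) al) = zr by rewrite normc_cpow.
have n2 : normc (cpow (c +i* w) (2 * al)) = zr ^+ 2.
  by rewrite normc_cpow// (mulrC 2) powRrM -[2]/(2%:R) powR_mulrn// powR_ge0.
have e1 : normc (cexp (- ((c +i* w) * tau%:C))) <= 1.
  rewrite normc_cexp/= mulr0 subr0 -[leRHS]expR0 ler_expR oppr_le0 mulr_ge0//; exact: ltW.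
rewrite /delta /symb.
set A := cpow _ al in n1 *; set B := cpow _ (2 * al) in n2 *; set E := cexp _ in e1 *.
have -> : a%:C * A + d%:C * B + p%:C - q%:C * E = d%:C * B - (- (a%:C * A) + (q%:C * E - p%:C)) by ring.
apply: le_trans (normcB_ge _ _).
have b1 : normc (- (a%:C * A) + (q%:C * E - p%:C)) <= `|a| * zr + (q + p).
  apply: le_trans (normcD_le _ _) _; rewrite normcNE normcM n1 normc_real lerD2l.
  apply: le_trans (normcB_le _ _) _; rewrite normcM !normc_real gtr0_norm// gtr0_norm// lerD2r.
  by rewrite ler_piMr// ltW.
have b2 : normc (d%:C * B) = d * zr ^+ 2 by rewrite normcM n2 normc_real gtr0_norm.
rewrite b2.
have dz : (`|a| + p + q + 1) + d <= d * zr.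
  have <- : d * z1 = (`|a| + p + q + 1) + d by rewrite /z1; field; rewrite gt_eqF.
  by rewrite ler_pM2l.
have h1 : ((`|a| + p + q + 1) + d) * zr <= d * zr ^+ 2.
  by rewrite expr2 mulrA; apply: ler_wpM2r => //; exact: le_trans zr1.
have h2 : p + q + 1 <= (p + q + 1) * zr.
  by rewrite ler_peMr// !addr_ge0// ltW.
have h3 : 0 <= d * zr by apply: mulr_ge0; [exact: ltW|exact: le_trans zr1].
have h4 : ((`|a| + p + q + 1) + d) * zr = `|a| * zr + (p + q + 1) * zr + d * zr by ring.
lra.
Qed.

End symbol.

(** * Caputo derivatives and the Laplace transform of the equation *)

Section near_zero.
Context {R : realType}.
Implicit Types (f g z x y : R -> R) (m T t K : R).

(** The strict inequality discards the value at 0, which for [derive1 x] carries no information. *)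
Definition causal f t := if 0 < t then f t else 0.

Lemma causal_pos f t : 0 < t -> causal f t = f t.
Proof. by rewrite /causal => ->. Qed.

Lemma causal_le0 f t : t <= 0 -> causal f t = 0.
Proof. by rewrite /causal ltNge => ->. Qed.

Lemma conv_le0 f g T : (forall t, t <= 0 -> f t = 0) -> (forall t, t <= 0 -> g t = 0) ->
  T <= 0 -> conv f g T = 0.
Proof.
move=> f0 g0 T0; rewrite /conv; under eq_Rintegral => v _.
  have -> : f (T - v) * g v = 0.
    have [v0|v0] := leP v 0; first by rewrite (g0 v v0) mulr0.
    by rewrite f0 ?mul0r// subr_le0 (le_trans T0)// ltW.
  over.
by rewrite Rintegral_cst// mul0r.
Qed.

Lemma conv_heaviside f T : 0 < T ->
  (@lebesgue_measure R).-integrable `[0, T] (EFin \o f) ->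
  conv heaviside (causal f) T = \int[mu]_(t in `[0, T]) f t.
Proof.
move=> T0 fi.
have s1 : `]0, T[ `<=` `[0, T] by apply: subset_itvW.
have s2 : `[0, T[ `<=` `[0, T] by move=> t /=; rewrite !in_itv/= => /andP[-> /ltW].
have i1 : (@lebesgue_measure R).-integrable `]0, T[ (EFin \o f).
  by apply: integrableS fi => //.
have i2 : (@lebesgue_measure R).-integrable `[0, T[ (EFin \o f).
  by apply: integrableS fi => //.
rewrite -Rintegral_itv_bndo_bndc// -Rintegral_itv_obnd_cbnd//.
rewrite Rintegral_mkcond; apply: eq_Rintegral => v _.
rewrite patchE mem_setE in_itv/= /heaviside /causal subr_gt0.
by case: ltP => v0; case: ltP => vT; rewrite /= ?mul1r ?mul0r.
Qed.

Lemma conv_pker m z T : 0 < m < 1 -> 0 < T ->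
  (forall t, t <= 0 -> z t = 0) ->
  conv (pker m) z T = \int[mu]_(w in `[0, T]) ((T - w) `^ (m - 1) * z w).
Proof.
move=> /andP[m0 m1] T0 z0; rewrite Rintegral_mkcond; apply: eq_Rintegral => w _.
rewrite patchE mem_setE in_itv/= /pker subr_gt0.
have [w0|w0] := ltP w 0; first by rewrite z0 ?mulr0// ltW.
have [wT|wT] := ltP w T; first by rewrite ltW.
rewrite /=; case: (leP w T) => // wT'; last by rewrite mul0r.
have -> : w = T by apply/eqP; rewrite eq_le wT wT'.
by rewrite subrr powR0// lt_eqF// subr_lt0.
Qed.

Lemma Rintegral_itv1 z (a : R) : \int[mu]_(v in `[a, a]) z v = 0.
Proof. by rewrite set_itv1 Rintegral_set1. Qed.

(* [D] is the Caputo derivative of order [1 - m] of [Z], whose derivative is [z]. *)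
Lemma integral_caputo m z Z T : 0 < m < 1 -> 0 < T ->
  (@lebesgue_measure R).-integrable `[0, T] (EFin \o z) ->
  (forall t, 0 < t -> Z t = \int[mu]_(v in `[0, t]) z v) ->
  let D t := (Gamma m)^-1 * \int[mu]_(v in `[0, t]) ((t - v) `^ (m - 1) * z v) in
  (@lebesgue_measure R).-integrable `[0, T] (EFin \o D) /\
  \int[mu]_(t in `[0, T]) D t = (Gamma m)^-1 * conv (pker m) (causal Z) T.
Proof.
move=> m01 T0 iz ZE D; have [i1 e1] := integral_frac m01 T0 iz.
split.
  exact: (@integrableZl _ _ R (@lebesgue_measure R) _ (measurable_itv `[0,T]) (Gamma m)^-1 _ i1).
rewrite /D (@RintegralZl _ _ R (@lebesgue_measure R) _ _ (Gamma m)^-1 (measurable_itv `[0, T]) i1) e1 conv_pker//; last by move=> t; exact: causal_le0.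
congr (_ * _); apply: eq_Rintegral => w; rewrite inE/= in_itv/= => /andP[w0 wT].
congr (_ * _); rewrite /causal; case: ltP => w0'; first by rewrite ZE.
have -> : w = 0 by apply/eqP; rewrite eq_le w0 w0'.
exact: Rintegral_itv1.
Qed.

Lemma primitive_cvg0 z T : 0 < T ->
  (@lebesgue_measure R).-integrable `[0, T] (EFin \o z) ->
  (\int[mu]_(v in `[0, t]) z v) @[t --> 0^'+] --> 0.
Proof.
move=> T0 iz; apply: cvg_at_right_filter.
exact: (@parameterized_integral_cvg_left R 0 T z T0 iz).
Qed.

Lemma primitiveB z s t T : 0 < s -> s <= t -> t <= T ->
  (@lebesgue_measure R).-integrable `[0, T] (EFin \o z) ->
  \int[mu]_(v in `[0, t]) z v - \int[mu]_(v in `[0, s]) z v = \int[mu]_(v in `[s, t]) z v.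
Proof.
move=> s0 st tT iz.
have i0t : (@lebesgue_measure R).-integrable `[0, t] (EFin \o z).
  by apply: integrableS iz => //; apply: subset_itvl; rewrite bnd_simp.
rewrite (@Rintegral_itvB R z (BLeft 0) (BRight t) s i0t) ?bnd_simp ?(ltW s0)//.
rewrite Rintegral_itv_obnd_cbnd//.
by apply: integrableS i0t => //; apply: subset_itvr; rewrite bnd_simp ltW.
Qed.

(** On [t > 0], [f] differs from the primitive of [z] by a constant. This constant is the limit at
    0, independently of [f 0]. *)
Lemma primitive_limit f z :
  (forall T, 0 < T -> (@lebesgue_measure R).-integrable `[0, T] (EFin \o z)) ->
  (forall s t, 0 < s -> s <= t -> f t - f s = \int[mu]_(v in `[s, t]) z v) ->
  exists2 K, f t @[t --> 0^'+] --> K &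
    forall T, 0 < T -> f T - K = \int[mu]_(v in `[0, T]) z v.
Proof.
move=> iz fz; pose J t := \int[mu]_(v in `[0, t]) z v.
have JB s t : 0 < s -> s <= t -> J t - J s = \int[mu]_(v in `[s, t]) z v.
  by move=> s0 st; apply: (@primitiveB z s t t s0 st _ (iz _ _)) => //; exact: lt_le_trans st.
pose K := f 1 - J 1.
have fJ t : 0 < t -> f t = J t + K.
  move=> t0; rewrite /K; have [t1|t1] := leP t 1.
    have := fz t 1 t0 t1; rewrite -JB//; lra.
  have := fz 1 t ltr01 (ltW t1); rewrite -JB ?ltW//; lra.
exists K; last by move=> T T0; rewrite (fJ T T0) addrK.
have : J t + K @[t --> 0^'+] --> 0 + K.
  by apply: cvgD; [exact: primitive_cvg0 ltr01 (iz 1 ltr01)|exact: cvg_cst].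
rewrite add0r; apply: cvg_trans; apply: near_eq_cvg.
by near=> t; rewrite fJ//; near: t; exact: nbhs_right_gt.
Unshelve. all: by end_near. Qed.

Lemma ac_pos_limit f : ac_pos f ->
  exists2 K, f t @[t --> 0^'+] --> K &
    forall T, 0 < T -> f T - K = \int[mu]_(v in `[0, T]) derive1 f v.
Proof. by move=> [i1 i2]; exact: primitive_limit. Qed.

Lemma integrable_bounded_pos g T :
  (forall t, 0 < t -> {for t, continuous g}) ->
  (forall T, exists N : R, forall t, 0 < t -> t <= T -> `|g t| <= N) ->
  (@lebesgue_measure R).-integrable `[0, T] (EFin \o g).
Proof.
move=> cg /(_ T)[M gM].
have mg : measurable_fun (`]0, +oo[%classic : set R) g.
  apply: open_continuous_measurable_fun; first exact: interval_open.
  by move=> t; rewrite inE/= in_itv/= andbT; exact: cg.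
have mg0 : measurable_fun (`[0, T]%classic : set R) g.
  apply/measurable_fun_itv_obnd_cbndP; apply: measurable_funS mg => //.
  by apply: subset_itvl; rewrite bnd_simp.
apply: measurable_bounded_integrable => //.
  have [T0|T0] := leP 0 T; last by rewrite set_itv_ge ?measure0 ?ltry// bnd_simp -ltNge.
  by rewrite /= lebesgue_measure_itv/= lte_fin; case: ifP => _; rewrite ?ltry// -EFinB ltry.
exists (`|M| + `|g 0|); split; [exact: num_real|] => N MN t; rewrite /= in_itv/= => /andP[t0 tT].
apply: le_trans (ltW MN); move: t0; rewrite le_eqVlt => /predU1P[<-|t0].
  by rewrite lerDr.
by rewrite (le_trans (gM t t0 tT))// (le_trans (ler_norm M))// lerDl.
Qed.

(** Serves the integer orders, for which mere differentiability is assumed: absolute continuity is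
    recovered from the equation, which makes the derivative continuous on [t > 0] and bounded near
    0. *)
Lemma FTC_pos f g :
  (forall t, 0 < t -> is_derive t 1 f (g t)) ->
  (forall t, 0 < t -> {for t, continuous g}) ->
  (forall T, exists N : R, forall t, 0 < t -> t <= T -> `|g t| <= N) ->
  exists2 K, f t @[t --> 0^'+] --> K &
    forall T, 0 < T -> f T - K = \int[mu]_(v in `[0, T]) g v.
Proof.
move=> df cg gM; apply: primitive_limit.
  by move=> T _; exact: integrable_bounded_pos cg gM.
move=> s t s0; rewrite le_eqVlt => /predU1P[<-|st].
  by rewrite subrr set_itv1 Rintegral_set1.
have cg' u : s <= u <= t -> {for u, continuous g}.
  by move=> /andP[su _]; apply: cg; exact: lt_le_trans su.
have df' u : s <= u <= t -> is_derive u 1 f (g u).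
  by move=> /andP[su _]; apply: df; exact: lt_le_trans su.
exact: (esym (congr1 fine (continuous_FTC2_derive st cg' df'))).
Qed.

(** By the mean value theorem the quotient at [h] is a value of [dx] in []0, h[]. This ties the
    prescribed slope at 0 to the limit of the derivative. *)
Lemma derive_limit_quotient x (dx : R -> R) (L v : R) :
  (forall t, 0 < t -> is_derive t 1 x (dx t)) -> x t @[t --> 0^'+] --> x 0 ->
  dx t @[t --> 0^'+] --> L -> h^-1 * (x h - x 0) @[h --> 0^'+] --> v -> L = v.
Proof.
move=> hx cx dL qv; apply: (@cvg_unique _ _ (h^-1 * (x h - x 0) @[h --> 0^'+])) => //.
apply/cvgrPdist_le => e e0; move/cvgrPdist_le : dL => /(_ e e0) [/= r r0 H].
near=> h; have h0 : 0 < h by near: h; exact: nbhs_right_gt.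
have hr : h < r by near: h; exact: nbhs_right_lt.
have [||c] := @MVT R x dx 0 h h0.
- by move=> t; rewrite in_itv/= => /andP[t0 _]; exact: hx.
- apply/continuous_within_itvP => //; split => //.
    move=> t; rewrite in_itv/= => /andP[t0 _].
    by apply/differentiable_continuous/derivable1_diffP; have h1 := hx t t0; exact: ex_derive.
  apply: cvg_at_left_filter.
  by apply/differentiable_continuous/derivable1_diffP; have h1 := hx h h0; exact: ex_derive.
rewrite in_itv/= subr0 => /andP[c0 ch] ->; rewrite mulrC mulfK ?gt_eqF//.
by apply: H => //=; rewrite sub0r normrN gtr0_norm// (lt_trans ch).
Unshelve. all: by end_near. Qed.

Lemma lapable_bounded f (M c : R) : 0 < c -> measurable_fun setT f ->
  (forall t, `|f t| <= M) -> (forall t, t <= 0 -> f t = 0) -> lapable c f.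
Proof.
move=> c0 mf fM f0; apply: (@L1_le R _ (fun t => M * damp c heaviside t)).
- by apply: measurable_funM => //; exact: measurable_exp_lin.
- move=> t; rewrite /damp /heaviside; case: ifPn => [t0|]; last first.
    by rewrite -leNgt => t0; rewrite f0// !mulr0 normr0.
  by rewrite normrM ger0_norm ?expR_ge0// mulr1 mulrC ler_wpM2r ?expR_ge0.
- exact/L1Zl/lapable_heaviside.
Qed.

Lemma measurable_causal f : (forall t, 0 < t -> {for t, continuous f}) ->
  measurable_fun setT (causal f).
Proof.
move=> cf; have mf : measurable_fun (`]0, +oo[%classic : set R) f.
  apply: open_continuous_measurable_fun; first exact: interval_open.
  by move=> t; rewrite inE/= in_itv/= andbT; exact: cf.
have -> : causal f = f \_ `]0, +oo[.
  by apply/funext => t; rewrite patchE mem_setE in_itv/= andbT.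
by have [h _] := measurable_restrictT f (measurable_itv `]0, +oo[); exact: h.
Qed.

End near_zero.

(** * Primitives of Caputo derivatives of orders below 2 *)

Section caputo_operators.
Context {R : realType}.
Implicit Types (f g z x y : R -> R) (m T t K : R).

Lemma causal_idem f : causal (causal f) = causal f.
Proof. by apply/funext => t; rewrite /causal; case: (0 < t). Qed.

Lemma integrable_causal f T :
  (@lebesgue_measure R).-integrable `[0, T] (EFin \o f) ->
  (@lebesgue_measure R).-integrable `[0, T] (EFin \o causal f).
Proof.
move=> fi; have mf : measurable_fun (`[0, T]%classic : set R) f.
  by apply/measurable_EFinP; exact: measurable_int fi.
have mc : measurable_fun (`[0, T]%classic : set R) (causal f).
  apply/measurable_fun_itv_obnd_cbndP; apply: (eq_measurable_fun f).
    by move=> t; rewrite inE/= in_itv/= /causal => /andP[-> _].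
  by apply/measurable_fun_itv_obnd_cbndP.
have cf t : (`|(EFin \o causal f) t| <= `|(EFin \o f) t|)%E.
  by rewrite /= lee_fin /causal; case: ifP => // _; rewrite normr0.
apply: (le_integrable _ _ _ fi) => //; exact/measurable_EFinP.
Qed.

Lemma Rintegral_causal f T : 0 < T ->
  (@lebesgue_measure R).-integrable `[0, T] (EFin \o f) ->
  \int[mu]_(t in `[0, T]) causal f t = \int[mu]_(t in `[0, T]) f t.
Proof.
move=> T0 fi; rewrite -(conv_heaviside T0 fi) -(conv_heaviside T0 (integrable_causal fi)).
by rewrite causal_idem.
Qed.

Lemma caputo_order1 m : 0 < m <= 1 -> caputo_order m = 1%N.
Proof. by move=> m01; rewrite /caputo_order (@Num.Theory.ceil_def _ m 1). Qed.

Lemma caputo_order2 m : 1 < m <= 2 -> caputo_order m = 2%N.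
Proof. by move=> m12; rewrite /caputo_order (@Num.Theory.ceil_def _ m 2). Qed.

Lemma caputo_frac1 m x t : 0 < m < 1 ->
  caputo m x t =
  (Gamma (1 - m))^-1 * \int[mu]_(v in `[0, t]) ((t - v) `^ (1 - m - 1) * derive1 x v).
Proof.
move=> /andP[m0 m1]; rewrite /caputo /caputo_integrand caputo_order1 ?m0 ?(ltW m1)//.
by rewrite lt_eqF.
Qed.

Lemma caputo_frac2 m x t : 1 < m < 2 ->
  caputo m x t =
  (Gamma (2 - m))^-1 * \int[mu]_(v in `[0, t]) ((t - v) `^ (2 - m - 1) * derive1 (derive1 x) v).
Proof.
move=> /andP[m0 m1]; rewrite /caputo /caputo_integrand caputo_order2 ?m0 ?(ltW m1)//.
by rewrite lt_eqF.
Qed.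

Lemma caputo1 x t : caputo 1 x t = derive1 x t.
Proof. by rewrite /caputo caputo_order1 ?ltr01 ?lexx// eqxx. Qed.

Lemma caputo2 x t : caputo 2 x t = derive1 (derive1 x) t.
Proof. by rewrite /caputo caputo_order2 ?eqxx// ltr1n lexx. Qed.

(** Integration removes the derivative of [x]: what is left is a convolution with [x - x 0], which
    is bounded in the application. *)
Lemma integral_caputo1 m x T : 0 < m < 1 -> caputo_derivable m x ->
  x t @[t --> 0^'+] --> x 0 -> 0 < T ->
  (@lebesgue_measure R).-integrable `[0, T] (EFin \o caputo m x) /\
  \int[mu]_(t in `[0, T]) caputo m x t =
  (Gamma (1 - m))^-1 * conv (pker (1 - m)) (causal (fun t => x t - x 0)) T.
Proof.
move=> /andP[m0 m1] + x0 T0; rewrite /caputo_derivable caputo_order1 ?m0 ?(ltW m1)// lt_eqF//.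
move=> [_ ac _]; have [K xK xE] := ac_pos_limit ac.
have KE : K = x 0 by apply: (cvg_unique _ xK x0).
rewrite {K xK}KE /= in xE; case: ac => ac _.
have m01 : 0 < 1 - m < 1 by apply/andP; split; lra.
have -> : caputo m x = fun t =>
    (Gamma (1 - m))^-1 * \int[mu]_(v in `[0, t]) ((t - v) `^ (1 - m - 1) * derive1 x v).
  by apply/funext => t; rewrite caputo_frac1// m0.
exact: (integral_caputo m01 T0 (ac _ T0) xE).
Qed.

(** One integration still leaves [derive1 x], for which no growth bound is at hand; [lap_case_gt]
    deals with it. *)
Lemma integral_caputo2 m x T : 1 < m < 2 -> caputo_derivable m x ->
  x t @[t --> 0^'+] --> x 0 -> h^-1 * (x h - x 0) @[h --> 0^'+] --> 0 -> 0 < T ->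
  (@lebesgue_measure R).-integrable `[0, T] (EFin \o caputo m x) /\
  \int[mu]_(t in `[0, T]) caputo m x t =
  (Gamma (2 - m))^-1 * conv (pker (2 - m)) (causal (derive1 x)) T.
Proof.
move=> /andP[m0 m1] + x0 q0 T0; rewrite /caputo_derivable caputo_order2 ?m0 ?(ltW m1)// lt_eqF//.
move=> [dx ac _]; have [K xK xE] := ac_pos_limit ac.
(* Both the limit of [derive1 x] and the difference quotient at 0 exist, hence agree. *)
have KE : K = 0.
  apply: (derive_limit_quotient _ x0 xK q0) => t t0.
  by rewrite /= derive1E; apply: derivableP; exact: (dx 0%N).
rewrite {K xK}KE /= in xE; case: ac => ac _.
have m01 : 0 < 2 - m < 1 by apply/andP; split; lra.
have -> : caputo m x = fun t =>
    (Gamma (2 - m))^-1 * \int[mu]_(v in `[0, t]) ((t - v) `^ (2 - m - 1) * derive1 (derive1 x) v).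
  by apply/funext => t; rewrite caputo_frac2// m0.
apply: (integral_caputo m01 T0 (ac _ T0)) => t t0.
by rewrite -xE// subr0.
Qed.

End caputo_operators.

(** * Laplace transform of the equation, by ranges of the order *)

Section laplace_equation.
Context {R : realType}.
Implicit Types (f g z x y : R -> R) (m T t K : R).

(** For causal [f], the Riemann-Liouville fractional integral of order [m]. *)
Definition fracint m f T := (Gamma m)^-1 * conv (pker m) f T.

Lemma lapable_fracint m (c : R) f : 0 < m <= 1 -> 0 < c -> lapable c f -> lapable c (fracint m f).
Proof. by move=> m01 c0 fc; apply/lapableZ/lapable_conv => //; exact: lapable_pker. Qed.

Lemma lap_fracint m (s : R[i]) f : 0 < m <= 1 -> 0 < Re s -> lapable (Re s) f ->
  lap s (fracint m f) = cpow s (- m) * lap s f.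
Proof.
move=> m01 s0 fs; have ps : lapable (Re s) (pker m) by exact: lapable_pker.
rewrite /fracint lapZ; last exact: lapable_conv.
rewrite lap_conv// lap_pker// !mulrA -rmorphM/= mulVf ?mul1r//.
exact: Gamma_neq0.
Qed.

Lemma fracint_le0 m f T : (forall t, t <= 0 -> f t = 0) -> T <= 0 -> fracint m f T = 0.
Proof.
by move=> f0 T0; rewrite /fracint conv_le0 ?mulr0// => t; exact: pker_le0.
Qed.

Lemma mul_cpowN m (s : R[i]) : 0 < Re s -> s * cpow s (- m) = cpow s (1 - m).
Proof. by move=> s0; rewrite cpowD cpow1. Qed.

Lemma conv_heaviside_eq f g : (forall t, t <= 0 -> g t = 0) ->
  (forall T, 0 < T -> (@lebesgue_measure R).-integrable `[0, T] (EFin \o f)) ->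
  (forall T, 0 < T -> \int[mu]_(t in `[0, T]) f t = g T) ->
  conv heaviside (causal f) = g.
Proof.
move=> g0 fi fg; apply/funext => T; have [T0|T0] := leP T 0; last first.
  by rewrite conv_heaviside// ?fg//; exact: fi.
rewrite g0// conv_le0// => t t0; last exact: causal_le0.
by rewrite /heaviside ltNge t0.
Qed.

(** Transformability passes from [f] to its primitive. With [f] the bounded right-hand side, the
    Caputo terms need no transform of their own. *)
Lemma lap_primitive (s : R[i]) f g : 0 < Re s -> lapable (Re s) f ->
  conv heaviside f = g -> lapable (Re s) g /\ lap s f = s * lap s g.
Proof.
move=> s0 fs <-; have hs := lapable_heaviside s0; split; first exact: lapable_conv.
rewrite lap_conv// lap_heaviside// mulrA mulfV ?mul1r//.
by apply: contraTneq s0 => ->; rewrite ltxx.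
Qed.

Lemma integralDZ (f g : R -> R) (k l T : R) :
  (@lebesgue_measure R).-integrable `[0, T] (EFin \o f) ->
  (@lebesgue_measure R).-integrable `[0, T] (EFin \o g) ->
  (@lebesgue_measure R).-integrable `[0, T] (EFin \o (fun t => k * f t + l * g t)) /\
  \int[mu]_(t in `[0, T]) (k * f t + l * g t) =
  k * \int[mu]_(t in `[0, T]) f t + l * \int[mu]_(t in `[0, T]) g t.
Proof.
move=> fi gi; have mT := measurable_itv `[0, T].
have kf := @integrableZl _ _ R (@lebesgue_measure R) _ mT k _ fi.
have lg := @integrableZl _ _ R (@lebesgue_measure R) _ mT l _ gi.
split; first exact: (@integrableD _ _ R (@lebesgue_measure R) _ mT _ _ kf lg).
rewrite (@RintegralD _ _ R (@lebesgue_measure R) _ (fun t => k * f t) (fun t => l * g t) mT kf lg).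
congr (_ + _).
  exact: (@RintegralZl _ _ R (@lebesgue_measure R) _ _ k mT fi).
exact: (@RintegralZl _ _ R (@lebesgue_measure R) _ _ l mT gi).
Qed.

Lemma causal_bounded f (N : R) : (forall t, 0 < t -> `|f t| <= N) ->
  forall t, `|causal f t| <= N.
Proof.
move=> fN t; rewrite /causal; case: ifPn => [/fN//|_].
by rewrite normr0 (le_trans _ (fN 1 ltr01)).
Qed.

Lemma lapable_causal f (c N : R) : 0 < c -> (forall t, 0 < t -> {for t, continuous f}) ->
  (forall t, 0 < t -> `|f t| <= N) -> lapable c (causal f).
Proof.
move=> c0 cf fN; apply: (lapable_bounded c0 (measurable_causal cf) (causal_bounded fN)).
by move=> t; exact: causal_le0.
Qed.

Variables (al d M : R) (x F : R -> R) (s : R[i]).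
Hypotheses (al01 : 0 < al <= 1) (s0 : 0 < Re s) (d0 : 0 < d).
Hypothesis x0 : x t @[t --> 0^'+] --> x 0.
Hypothesis qx : 1 < 2 * al -> h^-1 * (x h - x 0) @[h --> 0^'+] --> 0.
Hypothesis cx : forall t, 0 < t -> {for t, continuous x}.
Hypothesis xM : forall t, 0 < t -> `|x t| <= M.
Hypothesis cF : forall t, 0 < t -> {for t, continuous F}.
Hypothesis FM : forall t, 0 < t -> `|F t| <= M.
Hypothesis cap1 : caputo_derivable al x.
Hypothesis cap2 : caputo_derivable (2 * al) x.
Hypothesis eqF : forall t, 0 < t ->
  (al - 2^-1) * caputo al x t + d * caputo (2 * al) x t = F t.

Let y := causal (fun t => x t - x 0).
Let Fc := causal F.
Let a := al - 2^-1.

Let lapable_y : lapable (Re s) y.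
Proof.
apply: (@lapable_causal _ _ (M + `|x 0|) s0) => t t0.
  by apply: cvgB; [exact: cx|exact: cvg_cst].
by rewrite (le_trans (ler_normB _ _))// lerD2r xM.
Qed.

Let lapable_F : lapable (Re s) Fc.
Proof. exact: lapable_causal s0 cF FM. Qed.

Let y_le0 t : t <= 0 -> y t = 0. Proof. exact: causal_le0. Qed.

Let FB T : exists N : R, forall t, 0 < t -> t <= T -> `|F t| <= N.
Proof. by exists M => t t0 _; exact: FM. Qed.

Let FE : Fc = causal (fun t => a * caputo al x t + d * caputo (2 * al) x t).
Proof. by apply/funext => t; rewrite /Fc /causal; case: ifP => // t0; rewrite eqF. Qed.

(** Both orders are below 1: one integration suffices, and [s * s^(- (1 - m)) = s^m] restores the
    symbol. *)
Let lap_case_lt : 2 * al < 1 -> symb al a d s * lap s y = lap s Fc.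
Proof.
move=> al1; have /andP[al0 _] := al01.
have b1 : 0 < al < 1 by apply/andP; split; lra.
have b2 : 0 < 2 * al < 1 by apply/andP; split; lra.
have m1 : 0 < 1 - al <= 1 by apply/andP; split; lra.
have m2 : 0 < 1 - 2 * al <= 1 by apply/andP; split; lra.
have [_ E] : lapable (Re s) (fun T => a * fracint (1 - al) y T + d * fracint (1 - 2 * al) y T) /\
    lap s Fc = s * lap s (fun T => a * fracint (1 - al) y T + d * fracint (1 - 2 * al) y T).
  apply: lap_primitive => //; rewrite FE; apply: conv_heaviside_eq => T T0.
  - by rewrite !fracint_le0// !mulr0 addr0.
  - have [i1 _] := integral_caputo1 b1 cap1 x0 T0.
    have [i2 _] := integral_caputo1 b2 cap2 x0 T0.
    by have [] := integralDZ a d i1 i2.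
  - have [i1 e1] := integral_caputo1 b1 cap1 x0 T0.
    have [i2 e2] := integral_caputo1 b2 cap2 x0 T0.
    by have [_ ->] := integralDZ a d i1 i2; rewrite e1 e2.
have l1 := lapable_fracint m1 s0 lapable_y.
have l2 := lapable_fracint m2 s0 lapable_y.
rewrite E lapD; [|exact: lapableZ|exact: lapableZ].
rewrite (lapZ a l1) (lapZ d l2) !lap_fracint// /symb.
have -> : cpow s al = s * cpow s (- (1 - al)) by rewrite mul_cpowN//; congr cpow; ring.
have -> : cpow s (2 * al) = s * cpow s (- (1 - 2 * al)) by rewrite mul_cpowN//; congr cpow; ring.
ring.
Qed.

(** The coefficient [a] vanishes and the equation is the ODE [d x' = F]. *)
Let lap_case_eq : 2 * al = 1 -> symb al a d s * lap s y = lap s Fc.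
Proof.
move=> al1; have a0 : a = 0 by rewrite /a; lra.
have dx t : 0 < t -> is_derive t 1 x (d^-1 * F t).
  move=> t0; rewrite -eqF// -/a a0 mul0r add0r mulrA mulVf ?gt_eqF// mul1r al1 caputo1.
  rewrite derive1E; apply: derivableP.
  move: cap2; rewrite al1 /caputo_derivable caputo_order1 ?ltr01 ?lexx// eqxx => h.
  exact: (h 0%N).
have cF' t : 0 < t -> {for t, continuous (fun t => d^-1 * F t)}.
  by move=> t0; apply: cvgMr; exact: cF.
have FM' t : 0 < t -> `|d^-1 * F t| <= d^-1 * M.
  by move=> t0; rewrite normrM gtr0_norm ?invr_gt0// ler_pM2l ?invr_gt0// FM.
have FB' T : exists N : R, forall t, 0 < t -> t <= T -> `|d^-1 * F t| <= N.
  by exists (d^-1 * M) => t t0 _; exact: FM'.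
have [K xK xE] := FTC_pos dx cF' FB'.
have KE : K = x 0 by apply: (cvg_unique _ xK x0).
rewrite {K xK}KE in xE.
have [_ E] : lapable (Re s) y /\ lap s (fun t => d^-1 * Fc t) = s * lap s y.
  apply: lap_primitive => //; first exact: lapableZ.
  have -> : (fun t => d^-1 * Fc t) = causal (fun t => d^-1 * F t).
    by apply/funext => t; rewrite /Fc /causal; case: ifP => // _; rewrite mulr0.
  apply: conv_heaviside_eq => T T0; first exact: y_le0.
  - exact: integrable_bounded_pos cF' FB'.
  - by rewrite -xE// /y causal_pos.
rewrite /symb a0 al1 cpow1// mul0r add0r -mulrA -E lapZ// mulrA -rmorphM/=.
by rewrite divff ?gt_eqF// mul1r.
Qed.

(** Two integrations are needed, and the fractional integral [U] of [x'] has no evident bound. It is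
    transformable because the integrated equation expresses it through transformable functions. *)
Let lap_case_gt : 1 < 2 * al -> al < 1 -> symb al a d s * lap s y = lap s Fc.
Proof.
move=> al1 al2; have /andP[al0 _] := al01; have q0 := qx al1.
have b1 : 0 < al < 1 by apply/andP; split; lra.
have b2 : 1 < 2 * al < 2 by apply/andP; split; lra.
have m1 : 0 < 1 - al <= 1 by apply/andP; split; lra.
have m2 : 0 < 2 - 2 * al < 1 by apply/andP; split; lra.
have m2' : 0 < 2 - 2 * al <= 1 by apply/andP; split; lra.
have [ac xE] : (forall T, 0 < T -> (@lebesgue_measure R).-integrable `[0, T] (EFin \o derive1 x)) /\
    (forall T, 0 < T -> x T - x 0 = \int[mu]_(v in `[0, T]) derive1 x v).
  move: cap1; rewrite /caputo_derivable caputo_order1 ?al0 ?(ltW al2)// lt_eqF//.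
  move=> [_ ac _]; have [K xK xE] := ac_pos_limit ac.
  have KE : K = x 0 by apply: (cvg_unique _ xK x0).
  by rewrite KE in xE; case: ac.
pose U := fracint (2 - 2 * al) (causal (derive1 x)).
have [lV E] : lapable (Re s) (fun T => a * fracint (1 - al) y T + d * U T) /\
    lap s Fc = s * lap s (fun T => a * fracint (1 - al) y T + d * U T).
  apply: lap_primitive => //; rewrite FE; apply: conv_heaviside_eq => T T0.
  - by rewrite /U !fracint_le0// ?mulr0 ?addr0// => t; exact: causal_le0.
  - have [i1 _] := integral_caputo1 b1 cap1 x0 T0.
    have [i2 _] := integral_caputo2 b2 cap2 x0 q0 T0.
    by have [] := integralDZ a d i1 i2.
  - have [i1 e1] := integral_caputo1 b1 cap1 x0 T0.
    have [i2 e2] := integral_caputo2 b2 cap2 x0 q0 T0.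
    by have [_ ->] := integralDZ a d i1 i2; rewrite e1 e2.
have l1 := lapable_fracint m1 s0 lapable_y.
have lU : lapable (Re s) U.
  have -> : U = fun T => d^-1 * ((a * fracint (1 - al) y T + d * U T) + - a * fracint (1 - al) y T).
    by apply/funext => T; field; rewrite gt_eqF.
  by apply/lapableZ/lapableD => //; exact: lapableZ.
have UE T : 0 < T -> U T = (Gamma (2 - 2 * al))^-1 *
    \int[mu]_(v in `[0, T]) ((T - v) `^ (2 - 2 * al - 1) * causal (derive1 x) v).
  by move=> T0; rewrite /U /fracint conv_pker// => t; exact: causal_le0.
have iZ T : 0 < T -> (@lebesgue_measure R).-integrable `[0, T] (EFin \o causal (derive1 x)).
  by move=> T0; exact: integrable_causal (ac T T0).
have xE' T : 0 < T -> x T - x 0 = \int[mu]_(v in `[0, T]) causal (derive1 x) v.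
  by move=> T0; rewrite Rintegral_causal ?xE//; exact: ac.
(* Second integration: the primitive of [U] is a fractional integral of [y]. *)
have [_ E'] : lapable (Re s) (fracint (2 - 2 * al) y) /\
    lap s U = s * lap s (fracint (2 - 2 * al) y).
  apply: lap_primitive => //.
  pose D t := (Gamma (2 - 2 * al))^-1 *
    \int[mu]_(v in `[0, t]) ((t - v) `^ (2 - 2 * al - 1) * causal (derive1 x) v).
  have -> : U = causal D.
    apply/funext => t; rewrite /causal; case: ltP => t0; first by rewrite UE.
    by rewrite /U fracint_le0// => u; exact: causal_le0.
  apply: conv_heaviside_eq => T T0; first by rewrite fracint_le0.
  - by have [] := integral_caputo m2 T0 (iZ T T0) xE'.
  - by have [_ ->] := integral_caputo m2 T0 (iZ T T0) xE'.
rewrite E lapD; [|exact: lapableZ|exact: lapableZ].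
rewrite (lapZ a l1) (lapZ d lU) E' !lap_fracint// /symb.
have -> : cpow s al = s * cpow s (- (1 - al)) by rewrite mul_cpowN//; congr cpow; ring.
have -> : cpow s (2 * al) = s * (s * cpow s (- (2 - 2 * al))).
  rewrite mul_cpowN//.
  have -> : cpow s (2 * al) = cpow s 1 * cpow s (1 - (2 - 2 * al)) by rewrite -cpowD; congr cpow; ring.
  by rewrite cpow1.
ring.
Qed.

(** The equation is [a x' + d x'' = F]. A first integration expresses [x'] through [J] and [x],
    which makes the second one possible. *)
Let lap_case_1 : al = 1 -> symb al a d s * lap s y = lap s Fc.
Proof.
move=> al1; have a2 : a = 2^-1 by rewrite /a al1; lra.
have q0 : h^-1 * (x h - x 0) @[h --> 0^'+] --> 0 by apply: qx; rewrite al1; lra.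
have dn0 : d != 0 by rewrite gt_eqF.
have [d1 d2] : (forall t, 0 < t -> derivable x t 1) /\
    (forall t, 0 < t -> derivable (derive1 x) t 1).
  move: cap2; rewrite al1 mulr1 /caputo_derivable caputo_order2 ?ltr1n ?lexx// eqxx => h.
  by split; [exact: (h 0%N)|exact: (h 1%N)].
have dx t : 0 < t -> is_derive t 1 x (derive1 x t).
  by move=> t0; rewrite derive1E; apply: derivableP; exact: d1.
have dW t : 0 < t -> is_derive t 1 (fun t => a * x t + d * derive1 x t) (F t).
  move=> t0; have h1 := dx t t0.
  have h2 : is_derive t 1 (derive1 x) (derive1 (derive1 x) t).
    by rewrite derive1E; apply: derivableP; exact: d2.
  rewrite -eqF// -/a al1 mulr1 caputo1 caputo2.
  apply: is_deriveD.
have [K WK WE] := FTC_pos dW cF FB.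
(* The limit of [x'] exists by the first integration and equals the prescribed slope 0, which fixes
   the constant [K]. *)
have x'K : derive1 x t @[t --> 0^'+] --> d^-1 * (K - a * x 0).
  have : d^-1 * ((a * x t + d * derive1 x t) - a * x t) @[t --> 0^'+] --> d^-1 * (K - a * x 0).
    by apply: cvgMr; apply: cvgB => //; apply: cvgMr.
  by under eq_fun do rewrite addrC addKr mulrA mulVf// mul1r.
have KE : K = a * x 0.
  have := derive_limit_quotient dx x0 x'K q0 => /eqP; rewrite mulf_eq0 invr_eq0 (negbTE dn0)/=.
  by rewrite subr_eq0 => /eqP.
rewrite {K WK x'K}KE in WE.
pose J t := \int[mu]_(v in `[0, t]) F v.
have iF T : (@lebesgue_measure R).-integrable `[0, T] (EFin \o F).
  exact: integrable_bounded_pos cF FB.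
(* [j] is [x'] written without derivatives, so that continuity and bounds on bounded intervals can
   be read off. *)
pose j t := d^-1 * (J t - a * (x t - x 0)).
have jE t : 0 < t -> derive1 x t = j t.
  by move=> t0; rewrite /j /J -WE//; field.
have cJ t : 0 < t -> {for t, continuous J}.
  move=> t0; have T1 : t < t + 1 by rewrite ltrDl.
  have := parameterized_integral_continuous (ltW (lt_trans t0 T1)) (iF (t + 1)).
  move=> /continuous_within_itvP -/(_ (lt_trans t0 T1)) [+ _ _].
  by apply; rewrite in_itv/= t0.
have JB T t : 0 < t -> t <= T -> `|J t| <= T * M.
  move=> t0 tT.
  rewrite /J -(Rintegral_causal t0 (iF t)).
  have ic := integrable_causal (iF t).
  have iM : (@lebesgue_measure R).-integrable `[0, t] (EFin \o (fun _ : R => M)).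
    apply: (@integrable_bounded_pos R (fun _ : R => M) t) => [u _|T']; first exact: cvg_cst.
    by exists `|M| => u _ _.
  apply: (le_trans (le_normr_Rintegral _ ic)) => //.
  have mI := measurable_itv `[0, t].
  have ian := @integrable_norm _ _ R (@lebesgue_measure R) _ _ ic.
  apply: (le_trans (@le_Rintegral _ _ R (@lebesgue_measure R) _ (fun u => `|causal F u|) (fun _ : R => M) mI ian iM _)).
    by move=> u _; exact: (causal_bounded FM).
  rewrite Rintegral_cst// mulrC.
  have -> : fine (mu `[0, t]) = t by rewrite lebesgue_measure_itv/= lte_fin t0 sube0.
  by rewrite ler_wpM2r// (le_trans _ (FM ltr01)).
have cj t : 0 < t -> {for t, continuous j}.
  move=> t0; apply: cvgMr; apply: cvgB; first exact: cJ.
  by apply: cvgMr; apply: cvgB; [exact: cx|exact: cvg_cst].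
have dxj t : 0 < t -> is_derive t 1 x (j t) by move=> t0; rewrite -jE//; exact: dx.
have jB T : exists N : R, forall t, 0 < t -> t <= T -> `|j t| <= N.
  exists (d^-1 * (T * M + a * (M + `|x 0|))) => t t0 tT.
  rewrite normrM gtr0_norm ?invr_gt0// ler_pM2l ?invr_gt0// (le_trans (ler_normB _ _))//.
  rewrite lerD ?JB// normrM a2 gtr0_norm ?invr_gt0// ler_pM2l ?invr_gt0//.
  by rewrite (le_trans (ler_normB _ _))// lerD2r xM.
have [K xK xE] := FTC_pos dxj cj jB.
have KE : K = x 0 by apply: (cvg_unique _ xK x0).
rewrite {K xK}KE in xE.
have [lJ EJ] : lapable (Re s) (causal J) /\ lap s Fc = s * lap s (causal J).
  apply: lap_primitive => //; apply: conv_heaviside_eq => T T0; first exact: causal_le0.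
  - exact: iF.
  - by rewrite causal_pos.
have [_ E] : lapable (Re s) y /\ lap s (fun t => d^-1 * (causal J t + - a * y t)) = s * lap s y.
  apply: lap_primitive => //.
    by apply/lapableZ/lapableD => //; exact: lapableZ.
  have -> : (fun t => d^-1 * (causal J t + - a * y t)) = causal j.
    by apply/funext => t; rewrite /y /j /causal; case: ifP => // _; ring.
  apply: conv_heaviside_eq => T T0; first exact: y_le0.
  - exact: integrable_bounded_pos cj jB.
  - by rewrite -xE// /y causal_pos.
rewrite EJ /symb al1 mulr1 cpow1//.
have -> : cpow s 2 = s * s by rewrite -[2]/(1 + 1) cpowD cpow1.
move: E; rewrite lapZ; last by apply/lapableD => //; exact: lapableZ.
rewrite lapD//; last exact: lapableZ.
rewrite lapZ// => E.
have dC : real_complex R d != 0 by rewrite fmorph_eq0.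
have -> : lap s (causal J) = real_complex R d * (s * lap s y) - (real_complex R (- a)) * lap s y.
  by rewrite -E fmorphV; field.
rewrite rmorphN; ring.
Qed.

Lemma laplace_equation : symb al a d s * lap s y = lap s Fc.
Proof.
have [h|h|h] := ltgtP (2 * al) 1; [exact: lap_case_lt| |exact: lap_case_eq].
by have /andP[_] := al01; rewrite le_eqVlt => /predU1P[|]; [exact: lap_case_1|exact: lap_case_gt].
Qed.

End laplace_equation.

(** * The instability estimate *)

Section instability.
Local Open Scope complex_scope.
Context {R : realType}.
Implicit Types (f g h y : R -> R) (c t : R).

Lemma L1_le_integral f g : L1 f -> L1 g -> (forall t, f t <= g t) ->
  \int[mu]_t f t <= \int[mu]_t g t.
Proof. by move=> fi gi fg; apply: (le_Rintegral measurableT fi gi) => t _; exact: fg. Qed.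

Lemma L1_integralDZ f g (k l : R) : L1 f -> L1 g ->
  \int[mu]_t (k * f t + l * g t) = k * \int[mu]_t f t + l * \int[mu]_t g t.
Proof.
move=> fi gi; rewrite (RintegralD measurableT (L1Zl k fi) (L1Zl l gi)).
by rewrite (RintegralZl k measurableT fi) (RintegralZl l measurableT gi).
Qed.

Lemma L1_integral_ge0 f : (forall t, 0 <= f t) -> 0 <= \int[mu]_t f t.
Proof. by move=> f0; apply: Rintegral_ge0. Qed.

Lemma damp_bounded c f (M : R) : 0 <= c -> (forall t, `|f t| <= M) ->
  (forall t, t <= 0 -> f t = 0) -> forall t, `|damp c f t| <= M.
Proof.
move=> c0 fM f0 t; rewrite /damp normrM ger0_norm ?expR_ge0//.
have [t0|t0] := leP t 0; first by rewrite f0// normr0 mulr0 (le_trans _ (fM t)).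
rewrite (le_trans _ (fM t))// ler_piMl// -expR0 ler_expR oppr_le0.
by rewrite mulr_ge0// ltW.
Qed.

Lemma normc_lap (s : R[i]) f :
  normc (lap s f) ^+ 2 = fcos (damp (Re s) f) (Im s) ^+ 2 + fsin (damp (Re s) f) (Im s) ^+ 2.
Proof. by rewrite /lap /normc sqr_sqrtr ?sqrrN// addr_ge0// sqr_ge0. Qed.

Lemma damp_continuous c f : continuous f -> continuous (damp c f).
Proof.
move=> cf t; apply: cvgM; last exact: cf.
apply: (@continuous_comp _ _ _ (fun t => - (c * t)) expR); last exact: continuous_expR.
by apply: cvgN; apply: cvgMr; exact: cvg_id.
Qed.

Variables (al a d p q tau : R).
Hypotheses (al0 : 0 < al) (d0 : 0 < d) (p0 : 0 < p) (pq : p < q) (tau0 : 0 <= tau).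

Lemma instability_core : exists2 k : R, 0 < k & forall (c M : R) y h, 0 < c ->
  continuous y -> (forall t, `|y t| <= M) -> (forall t, t <= 0 -> y t = 0) ->
  measurable_fun setT h ->
  (forall t, `|h t| <= k * (`|y (t - tau)| + c * heaviside t)) ->
  (forall s : R[i], 0 < Re s ->
    delta al a d p q tau s * lap s y = (c * (q - p))%:C * s^-1 + q%:C * lap s h) -> False.
Proof.
have [lam lam0 dlam] := real_root a al0 d0 p0 pq tau0.
have [sg /andP[sg0 sgl] clean] := zero_free_line a p q tau al0 d0 lam0.
have [m m0 dm] := delta_lower_bound al0 d0 p0 pq tau0 sg0 clean.
have q0 : 0 < q by exact: lt_trans pq.
(* [A] is the constant of [N <= A * c ^+ 2]. [B1] and [B2] are the factors of [k] in the two
   smallness conditions: absorbing [N], and reaching the contradiction. *)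
pose D := \int[mu]_t (damp sg heaviside t ^+ 2).
pose A := 2 * m ^- 2 * (2 * (q - p) ^+ 2 + 4 * q ^+ 2) * D.
pose K1 := \int[mu]_t damp lam heaviside t.
pose K2 := \int[mu]_t (damp (lam - sg) heaviside t ^+ 2).
pose B1 := 8 * q ^+ 2 * m ^- 2.
pose B2 := q * ((K2 + A) / 2 + K1) / ((q - p) / lam).
have D_ge0 : 0 <= D by apply: L1_integral_ge0 => t; exact: sqr_ge0.
have K2_ge0 : 0 <= K2 by apply: L1_integral_ge0 => t; exact: sqr_ge0.
have heav0 t : 0 <= heaviside t :> R by rewrite /heaviside; case: ifP.
have K1_ge0 : 0 <= K1 by apply: L1_integral_ge0 => t; rewrite mulr_ge0 ?expR_ge0.
have m2 : 0 < m ^- 2 by rewrite invr_gt0 exprn_gt0.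
have A_ge0 : 0 <= A.
  rewrite /A mulr_ge0// mulr_ge0 ?(mulr_ge0 _ (ltW m2))//.
  by rewrite addr_ge0// mulr_ge0// sqr_ge0.
have qpl : 0 < (q - p) / lam by rewrite divr_gt0// subr_gt0.
have B1_ge0 : 0 <= B1 by rewrite mulr_ge0 ?(ltW m2)// mulr_ge0// sqr_ge0.
have B2_ge0 : 0 <= B2.
  rewrite divr_ge0 ?(ltW qpl)// mulr_ge0 ?(ltW q0)// addr_ge0// divr_ge0//.
  by rewrite addr_ge0.
(* Gives [k <= 1], [k * B1 <= 1] and [k * B2 < 1] at once, independently of [c] and [M]. *)
exists (1 + B1 + B2)^-1; first by rewrite invr_gt0 -addrA ltr_pwDl// addr_ge0.
set k := _^-1.
have k0 : 0 < k by rewrite invr_gt0 -addrA ltr_pwDl// addr_ge0.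
have kE : k + k * B1 + k * B2 = 1.
  by rewrite /k; field; rewrite gt_eqF// -addrA ltr_pwDl// addr_ge0.
have kB1 : k * B1 <= 1 by have := mulr_ge0 (ltW k0) B2_ge0; lra.
have kB2 : k * B2 < 1 by have := mulr_ge0 (ltW k0) B1_ge0; lra.
have k1 : k <= 1.
  by have := mulr_ge0 (ltW k0) B1_ge0; have := mulr_ge0 (ltW k0) B2_ge0; lra.
move=> c M y h c0 cy yM y0 mh hk eqn.
have my : measurable_fun setT y by apply: continuous_measurable_fun.
have yl b : 0 < b -> lapable b y by move=> b0; exact: lapable_bounded yM y0.
have hl0 t : t <= 0 -> h t = 0.
  move=> t0; apply/eqP; rewrite -normr_le0 (le_trans (hk t))//.
  by rewrite y0 ?(subr_le0, le_trans t0)// normr0 add0r /heaviside ltNge t0/= !mulr0.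
have hM t : `|h t| <= k * (M + c).
  rewrite (le_trans (hk t))// ler_wpM2l ?(ltW k0)// lerD// /heaviside.
  by case: ifP => _; rewrite ?mulr1// mulr0 ltW.
have hl b : 0 < b -> lapable b h by move=> b0; exact: lapable_bounded hM hl0.
(* The forcing: by the hypothesis on transforms, [delta s * lap s y = lap s u]. *)
pose u t := c * (q - p) * heaviside t + q * h t.
have ul : lapable sg u.
  by apply: lapableD; apply: lapableZ; [exact: lapable_heaviside|exact: hl].
have lapu (s : R[i]) : 0 < Re s -> lap s u = (c * (q - p))%:C * s^-1 + q%:C * lap s h.
  move=> s0; have h1 := lapable_heaviside s0; have h2 := hl _ s0.
  by rewrite lapD; [rewrite !lapZ// lap_heaviside|exact: lapableZ|exact: lapableZ].
pose N := \int[mu]_t (damp sg y t ^+ 2).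
have M0 : 0 <= M by rewrite (le_trans _ (yM 0)).
have qp0 : 0 < q - p by rewrite subr_gt0.
pose M2 := M + (c * (q - p) + q * (k * (M + c))).
have uM t : `|u t| <= c * (q - p) + q * (k * (M + c)).
  rewrite (le_trans (ler_normD _ _))// lerD//.
    rewrite normrM gtr0_norm ?mulr_gt0// ler_piMr ?mulr_ge0 ?(ltW c0) ?(ltW qp0)//.
    by rewrite /heaviside; case: ifP => _; rewrite ?normr1 ?normr0.
  by rewrite normrM gtr0_norm// ler_pM2l.
have u0 t : t <= 0 -> u t = 0.
  by move=> t0; rewrite /u hl0// /heaviside ltNge t0/= !mulr0 addr0.
have P : N <= m ^- 2 * \int[mu]_t (damp sg u t ^+ 2).
  apply: (@parseval_le R _ _ M2).
  - exact: yl.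
  - move=> t; rewrite (le_trans (damp_bounded (ltW sg0) yM y0 t))// /M2 lerDl.
    by rewrite (le_trans _ (uM 0)).
  - exact: damp_continuous.
  - exact: ul.
  - move=> t; rewrite (le_trans (damp_bounded (ltW sg0) uM u0 t))// /M2 lerDr//.
  - move=> w w0; have /= := eqn (sg +i* w) sg0; rewrite -lapu// => E.
    rewrite -(normc_lap (sg +i* w) y) -(normc_lap (sg +i* w) u) -E normcM exprMn.
    rewrite mulrA ler_peMl ?sqr_ge0// ler_pdivlMl ?exprn_gt0// mulr1.
    by rewrite lerXn2r ?nnegrE ?(ltW m0) ?normc_ge0// dm.
  - exact: ltW.
have L2y : L1 (fun t => damp sg y t ^+ 2).
  exact: (L1_sqr (yl _ sg0) (damp_bounded (ltW sg0) yM y0)).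
have heav_le t : `|heaviside t| <= 1 :> R.
  by rewrite /heaviside; case: ifP => _; rewrite ?normr1 ?normr0.
have heav_le0 t : t <= 0 -> heaviside t = 0 :> R by rewrite /heaviside ltNge => ->.
have L2h b : 0 < b -> L1 (fun t => damp b heaviside t ^+ 2).
  by move=> b0; exact: (L1_sqr (lapable_heaviside b0) (damp_bounded (ltW b0) heav_le heav_le0)).
have L2ys : L1 (fun t => damp sg y (t - tau) ^+ 2) by exact: (L1_shift tau L2y).
have L2u : L1 (fun t => damp sg u t ^+ 2).
  exact: (L1_sqr ul (damp_bounded (ltW sg0) uM u0)).
have N_ge0 : 0 <= N by apply: L1_integral_ge0 => t; exact: sqr_ge0.
(* The delay only brings in the factor [exp (- b tau) <= 1]. *)
have ysh t b : 0 <= b -> damp b (fun t => `|y (t - tau)|) t <= `|damp b y (t - tau)|.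
  move=> b0; rewrite (damp_shift b (fun t => `|y t|)) /damp normrM ger0_norm ?expR_ge0//.
  by rewrite ler_piMl ?mulr_ge0 ?expR_ge0// -expR0 ler_expR oppr_le0 mulr_ge0.
have dh b t : 0 <= b -> `|damp b h t| <= k * (`|damp b y (t - tau)| + c * damp b heaviside t).
  move=> b0; rewrite /damp normrM ger0_norm ?expR_ge0//.
  rewrite (le_trans (ler_wpM2l (expR_ge0 _) (hk t)))// mulrCA ler_pM2l// mulrDr.
  by rewrite (mulrCA _ c) lerD2r; exact: ysh.
have N_le : N <= A * c ^+ 2.
  have Iu : \int[mu]_t (damp sg u t ^+ 2) <=
      (2 * (q - p) ^+ 2 + 4 * q ^+ 2) * c ^+ 2 * D + 4 * q ^+ 2 * k * N.
    have -> : N = \int[mu]_t (damp sg y (t - tau) ^+ 2) by rewrite (integral_shift tau L2y).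
    rewrite -L1_integralDZ//; last exact: L2h.
    apply: L1_le_integral => //.
      by apply: L1D; apply: L1Zl => //; exact: L2h.
    move=> t; have := dh sg t (ltW sg0).
    rewrite /u dampD !dampZ.
    set X := damp sg h t; set Y := `|damp sg y _|; set Z := damp sg heaviside t.
    have -> : damp sg y (t - tau) ^+ 2 = Y ^+ 2 by rewrite /Y real_normK// num_real.
    have Y0 : 0 <= Y by rewrite /Y.
    have Z0 : 0 <= Z by rewrite mulr_ge0// expR_ge0.
    move=> XYZ.
    have W0 : 0 <= k * (Y + c * Z) by rewrite mulr_ge0 ?(ltW k0)// addr_ge0// mulr_ge0// ltW.
    have X2 : X ^+ 2 <= k ^+ 2 * (Y + c * Z) ^+ 2.
      by rewrite -exprMn -[leLHS]real_normK ?num_real// lerXn2r.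
    (* The factor [k] is kept on [Y ^+ 2], for the absorption, and dropped on [Z ^+ 2], so that [A]
       does not depend on [k]. *)
    have X2' : X ^+ 2 <= 2 * (k * Y ^+ 2 + c ^+ 2 * Z ^+ 2).
      apply: (le_trans X2); have kk : k ^+ 2 <= k by rewrite expr2 ler_piMl// ltW.
      have YZ : (Y + c * Z) ^+ 2 <= 2 * (Y ^+ 2 + c ^+ 2 * Z ^+ 2).
        by have := sqr_ge0 (Y - c * Z); rewrite -subr_ge0 => h0; rewrite -subr_ge0; apply: (le_trans h0); lra.
      apply: (le_trans (ler_wpM2l (sqr_ge0 _) YZ)).
      have e1 : k ^+ 2 * Y ^+ 2 <= k * Y ^+ 2 by rewrite ler_wpM2r ?sqr_ge0.
      have e2 : k ^+ 2 * (c ^+ 2 * Z ^+ 2) <= c ^+ 2 * Z ^+ 2.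
        apply: ler_piMl; last exact: le_trans kk k1.
        by rewrite mulr_ge0 ?sqr_ge0.
      lra.
    have s1 : (c * (q - p) * Z + q * X) ^+ 2 <=
        2 * (c * (q - p) * Z) ^+ 2 + 2 * (q ^+ 2 * X ^+ 2).
      by have := sqr_ge0 (c * (q - p) * Z - q * X); lra.
    apply: (le_trans s1); have := ler_wpM2l (sqr_ge0 q) X2'; lra.
  (* [L2y] makes [N] a genuine finite integral, so this half can be moved to the left-hand side. *)
  have kB : m ^- 2 * (4 * q ^+ 2 * k * N) <= N / 2.
    have -> : m ^- 2 * (4 * q ^+ 2 * k * N) = k * B1 * (N / 2) by rewrite /B1; field; rewrite gt_eqF.
    by rewrite ler_piMl// divr_ge0.
  have := le_trans P (ler_wpM2l (ltW m2) Iu); rewrite mulrDr => h1.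
  have -> : A * c ^+ 2 = 2 * (m ^- 2 * ((2 * (q - p) ^+ 2 + 4 * q ^+ 2) * c ^+ 2 * D)).
    by rewrite /A; ring.
  lra.
have lam_eq : c * (q - p) / lam + q * \int[mu]_t damp lam h t = 0.
  have := eqn lam%:C lam0; rewrite dlam mul0r => /(congr1 (@complex.Re R)).
  rewrite -fmorphV -rmorphM/= !mul0r !subr0 => /esym; under eq_Rintegral do rewrite /wcos mul0r cos0 mul1r.
  by [].
have : `|\int[mu]_t damp lam h t| <= k * c * ((K2 + A) / 2 + K1).
  apply: (le_trans (le_normr_Rintegral _ _)) => //; first exact: hl.
  pose g0 t := damp (lam - sg) heaviside (t - tau) ^+ 2.
  have ls0 : 0 < lam - sg by rewrite subr_gt0.
  have g0l : L1 g0 by exact: (L1_shift tau (L2h _ ls0)).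
  have dlh := lapable_heaviside lam0.
  have yd t : `|damp lam y t| <= c / 2 * damp (lam - sg) heaviside t ^+ 2 + c^-1 / 2 * damp sg y t ^+ 2.
    have [t0|t0] := leP t 0.
      by rewrite /damp y0// mulr0 normr0 heav_le0// !mulr0 expr0n/= !mulr0 addr0.
    have -> : damp lam y t = damp (lam - sg) heaviside t * damp sg y t.
      by rewrite /damp /heaviside t0 mulr1 mulrA -expRD; congr (expR _ * _); ring.
    rewrite normrM ger0_norm; last by rewrite mulr_ge0 ?expR_ge0.
    rewrite -[X in _ <= _ + _ * X]real_normK ?num_real//.
    set X := damp _ _ _; set Y := `|_|.
    (* AM-GM with weight [c], so that the bound stays linear in [c]. *)
    have -> : c / 2 * X ^+ 2 + c^-1 / 2 * Y ^+ 2 = X * Y + (c * X - Y) ^+ 2 / (2 * c).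
      by field; rewrite gt_eqF.
    by rewrite lerDl divr_ge0 ?sqr_ge0// mulr_ge0// ltW.
  apply: (@le_trans _ _ (\int[mu]_t (1 * (k * (c / 2) * g0 t + k * (c^-1 / 2) * damp sg y (t - tau) ^+ 2) +
      k * c * damp lam heaviside t))).
    apply: L1_le_integral.
    - exact/L1_norm/hl.
    - by apply: L1D; apply: L1Zl => //; apply: L1D; apply: L1Zl.
    - move=> t; apply: (le_trans (dh lam t (ltW lam0))).
      by rewrite mul1r [leLHS]mulrDr (mulrA k c) lerD2r -!(mulrA k) -mulrDr ler_pM2l//; exact: yd.
  rewrite L1_integralDZ//; last by apply: L1D; apply: L1Zl.
  rewrite L1_integralDZ// mul1r (integral_shift tau L2y) (integral_shift tau (L2h _ ls0)).
  (* The bound on [N] is quadratic in [c], which compensates for the weight [c^-1] and leaves a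
     multiple of [c]. *)
  have h1 : k * (c^-1 / 2) * N <= k * (c / 2) * A.
    have -> : k * (c / 2) * A = k * (c^-1 / 2) * (A * c ^+ 2) by field; rewrite gt_eqF.
    by rewrite ler_wpM2l// mulr_ge0 ?(ltW k0)// divr_ge0// invr_ge0 ltW.
  rewrite -/N -/K1 -/K2; lra.
move: lam_eq; set I := \int[mu]_t _ => lam_eq IB.
have : c * ((q - p) / lam) <= q * (k * c * ((K2 + A) / 2 + K1)).
  have -> : c * ((q - p) / lam) = q * - I by move: lam_eq; lra.
  by rewrite ler_pM2l// (le_trans _ IB)// ler_normr lexx orbT.
have -> : q * (k * c * ((K2 + A) / 2 + K1)) = k * B2 * (c * ((q - p) / lam)).
  by rewrite /B2; field; rewrite !gt_eqF.
by rewrite leNgt gtr_pMl ?kB2// mulr_gt0.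
Qed.

End instability.

(** * Equilibrium and linearization *)

Section rational_power.
Context {R : realType}.
Implicit Types (r t y : R).

Lemma nat_truncn r : r \is a Num.nat -> (Num.truncn r)%:R = r.
Proof. exact: Num.Theory.truncnK. Qed.

Lemma rpow0 r : 0 < r -> rpow 0 r = 0 :> R.
Proof.
move=> r0; rewrite /rpow; case: ifPn => [rn|_]; last by rewrite powR0// gt_eqF.
by rewrite expr0n; case: eqP => // t0; move: r0; rewrite -(nat_truncn rn) t0 ltxx.
Qed.

Lemma norm_rpow r y : mg_defined r y -> `|rpow y r| = `|y| `^ r.
Proof.
move=> [h _]; rewrite /rpow; case: ifPn => [rn|rn].
  by rewrite normrX -powR_mulrn// nat_truncn.
by case: h => [h|y0]; [rewrite h in rn|rewrite norm_powR].
Qed.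

(** Away from 0 the power is differentiable; at 0 continuity is checked directly. *)
Lemma continuous_norm_powR r : 0 < r -> continuous (fun y => `|y| `^ r).
Proof.
move=> r0 y; have [->|y0] := eqVneq y 0.
  apply/cvgrPdist_lt => e e0; near=> z.
  rewrite normr0 powR0 ?gt_eqF// sub0r normrN norm_powR// normr_id.
  (* Reduces the claim to [|z| < e^(1 / r)], as the power is increasing. *)
  have -> : e = (e `^ r^-1) `^ r by rewrite -powRrM mulVf ?gt_eqF// powRr1// ltW.
  rewrite gt0_ltr_powR ?nnegrE ?powR_ge0//.
  near: z; have := nbhsx_ballx (0 : R) (e `^ r^-1) (powR_gt0 _ e0).
  by apply: filterS => u; rewrite /ball/= sub0r normrN.
apply: (@continuous_comp _ _ _ (fun y : R => `|y|) (fun z : R => z `^ r)).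
  exact: norm_continuous.
apply/differentiable_continuous/derivable1_diffP/derivable_powR.
by rewrite in_itv/= andbT normr_gt0.
Unshelve. all: by end_near. Qed.

(** For non-integer [r] the domain condition gives [x u >= 0], so [rpow] agrees with the power of
    the absolute value, which is continuous also where [x] vanishes. *)
Lemma rpow_cvg r (x : R -> R) t : 0 < r -> {for t, continuous x} ->
  (\forall u \near t, mg_defined r (x u)) -> {for t, continuous (fun u => rpow (x u) r)}.
Proof.
move=> r0 cx dx; have [rn|rn] := boolP (r \is a Num.nat).
  rewrite /rpow rn; apply: (@continuous_comp _ _ _ x (fun z : R => z ^+ Num.truncn r)) => //.
  exact: exprn_continuous.
have E : {near t, (fun u => `|x u| `^ r) =1 (fun u => rpow (x u) r)}.
  near=> u; have [[h|h] _] : mg_defined r (x u) by near: u.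
    by rewrite h in rn.
  by rewrite /rpow (negbTE rn) ger0_norm.
rewrite /prop_for /continuous_at -(nbhs_singleton E); apply: cvg_trans (near_eq_cvg E) _.
apply: (@continuous_comp _ _ _ x (fun z : R => `|z| `^ r)) => //.
exact: continuous_norm_powR.
Unshelve. all: by end_near. Qed.

(** The difference is [y] times [- y^r / (1 + y^r)], whose denominator is at least [1 / 2] in
    modulus since [|y^r| <= e^r <= 1 / 2]. *)
Lemma mg_perturbation r y (e : R) : 0 < r -> mg_defined r y -> `|y| <= e -> e `^ r <= 2^-1 ->
  `|y / (1 + rpow y r) - y| <= 2 * e `^ r * `|y|.
Proof.
move=> r0 dy ye er; have [_ dn0] := dy.
have Re : `|rpow y r| <= e `^ r.
  rewrite norm_rpow// ge0_ler_powR ?nnegrE ?(ltW r0)//; exact: le_trans ye.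
have -> : y / (1 + rpow y r) - y = (- rpow y r / (1 + rpow y r)) * y by field.
rewrite normrM ler_wpM2r// normrM normrN normfV.
have h : 2^-1 <= `|1 + rpow y r|.
  have := ler_normB (1 + rpow y r) (rpow y r); rewrite addrK normr1; lra.
rewrite ler_pdivrMr; last by apply: lt_le_trans h; rewrite invr_gt0.
by rewrite (le_trans Re)// -mulrA mulrCA ler_peMr ?powR_ge0//; lra.
Qed.

End rational_power.

Section equilibrium.
Context {R : realType}.
Implicit Types (m t : R).

Lemma derive1n_cst0 n : derive1n n (cst 0) = cst 0 :> (R -> R).
Proof.
elim: n => //= n; rewrite /derive1n => ->.
by apply/funext => t; rewrite derive1_cst.
Qed.

Lemma caputo_cst0 m t : caputo m (cst 0) t = 0 :> R.
Proof.
rewrite /caputo derive1n_cst0; case: ifP => // _.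
under eq_Rintegral do rewrite /caputo_integrand derive1n_cst0 mulr0.
by rewrite Rintegral_cst// mul0r mulr0.
Qed.

Lemma caputo_derivable_cst0 m : caputo_derivable m (cst 0 : R -> R).
Proof.
have i0 t : (@lebesgue_measure R).-integrable `[0, t] (fun _ : R => 0%:E).
  exact: integrable0.
rewrite /caputo_derivable; case: ifP => _.
  by move=> k _ t _; rewrite derive1n_cst0; exact: derivable_cst.
have d0 : derive1 (cst 0 : R -> R) = cst 0 by exact: (derive1n_cst0 1).
rewrite derive1n_cst0; split.
- by move=> k _ t _; rewrite derive1n_cst0; exact: derivable_cst.
- split=> [T _|a b _ _]; rewrite d0; first exact: i0.
  by rewrite Rintegral_cst// mul0r subrr.
- move=> t _; apply: eq_integrable (i0 t) => //= s _.
  by rewrite /caputo_integrand derive1n_cst0 mulr0.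
Qed.

Lemma mg_defined0 (r : R) : 0 < r -> mg_defined r 0.
Proof. by move=> r0; split; [right|rewrite rpow0// addr0 oner_neq0]. Qed.

Lemma equilibrium0 (al d p q r tau : R) : 0 < r -> mg_equilibrium al d p q r tau 0.
Proof.
move=> r0; split=> //.
- by apply: continuous_subspaceT => t; exact: cvg_cst.
- by move=> _; under eq_fun do rewrite /= subrr mulr0; exact: cvg_cst.
- by split; exact: caputo_derivable_cst0.
- move=> t t0; split; first exact: mg_defined0.
  by rewrite !caputo_cst0 /= mul0r !mulr0 addr0.
Qed.

End equilibrium.

(** * Perturbation of a constant initial function *)

Section linearization.
Local Open Scope complex_scope.
Context {R : realType}.
Implicit Types (t s : R).
Variables (al d p q r tau c e : R) (x : R -> R).
Hypotheses (al01 : 0 < al <= 1) (d0 : 0 < d) (p0 : 0 < p) (q0 : 0 < q) (r0 : 0 < r).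
Hypotheses (tau0 : 0 <= tau) (c0 : 0 < c) (ce : c <= e) (er : e `^ r <= 2^-1).
Hypothesis sol : mg_solution al d p q r tau (cst c) 0 x.
Hypothesis xe : forall t, 0 <= t -> `|x t| <= e.

Let y := causal (fun t => x t - c).
Let G t := x (t - tau) / (1 + rpow (x (t - tau)) r).
Let h := causal (fun t => G t - x (t - tau)).
Let F t := - p * x t + q * G t.

Let x_past t : - tau <= t <= 0 -> x t = c.
Proof. by case: sol => + _ _ _ _ => /[apply]. Qed.

Let x0c : x 0 = c.
Proof. by apply: x_past; rewrite lexx oppr_le0 tau0. Qed.

Let x_cont t : - tau < t -> {for t, continuous x}.
Proof.
case: sol => _ /continuous_within_itvcyP[+ _] _ _ _ => cx tt.
by apply: cx; rewrite in_itv/= tt.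
Qed.

Let x_right : x t @[t --> 0^'+] --> x 0.
Proof.
case: sol => _ /continuous_within_itvcyP[_ cx] _ _ _.
(* For [tau = 0] the origin is the left end of the domain, and only one-sided continuity is
   available there. *)
move: tau0; rewrite le_eqVlt => /predU1P[t0|t0]; first by rewrite -t0 oppr0 in cx.
by apply: cvg_at_right_filter; apply: x_cont; rewrite oppr_lt0.
Qed.

Let x_bounded t : - tau <= t -> `|x t| <= e.
Proof.
move=> tt; have [t0|t0] := leP 0 t; first exact: xe.
by rewrite x_past ?tt ?(ltW t0)// gtr0_norm.
Qed.

Let pos_gt_tau t : 0 < t -> - tau < t.
Proof. by move=> t0; apply: le_lt_trans t0; rewrite oppr_le0. Qed.

Let shift_gt_tau t : 0 < t -> - tau < t - tau.
Proof. by rewrite ltrDr. Qed.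

Let x_cont_pos t : 0 < t -> {for t, continuous x}.
Proof. by move=> t0; exact/x_cont/pos_gt_tau. Qed.

Let xtau_cont t : 0 < t -> {for t, continuous (fun u => x (u - tau))}.
Proof.
move=> t0; apply: (@continuous_comp _ _ _ (fun u => u - tau) x).
  by apply: cvgB; [exact: cvg_id|exact: cvg_cst].
exact/x_cont/shift_gt_tau.
Qed.

Let defined_pos t : 0 < t -> mg_defined r (x (t - tau)).
Proof. by case: sol => _ _ _ _ H /H[]. Qed.

Let G_cont t : 0 < t -> {for t, continuous G}.
Proof.
move=> t0; have [_ dn0] := defined_pos t0.
apply: cvgM; first exact: xtau_cont.
apply: cvgV => //; apply: cvgD; first exact: cvg_cst.
apply: (rpow_cvg r0 (xtau_cont t0)); near=> u; apply: defined_pos.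
near: u; exact: lt_nbhsr.
Unshelve. all: by end_near. Qed.

Let h_pos t : 0 < t -> `|G t - x (t - tau)| <= 2 * e `^ r * `|x (t - tau)|.
Proof.
move=> t0; apply: (mg_perturbation r0 (defined_pos t0) _ er).
exact/x_bounded/ltW/shift_gt_tau.
Qed.

Let y_le0 t : t <= 0 -> y t = 0. Proof. exact: causal_le0. Qed.

(** Holds also while [t - tau <= 0]: there [x] is the initial constant and [y] is 0. *)
Lemma perturbation_shift t : 0 < t -> x (t - tau) = y (t - tau) + c.
Proof.
move=> t0; rewrite /y /causal; case: ltP => tt; first by rewrite subrK.
by rewrite add0r x_past// tt (ltW (shift_gt_tau t0)).
Qed.

(** At 0 the two branches meet because [x] starts from [c]. *)
Lemma perturbation_continuous : continuous y.
Proof.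
move=> t; have [t0|t0|->] := ltgtP t 0.
- have E : {near t, cst 0 =1 y}.
    by near=> u; rewrite y_le0//; apply/ltW; near: u; exact: lt_nbhsl.
  rewrite /continuous_at y_le0 ?(ltW t0)//; apply: cvg_trans (near_eq_cvg E) _.
  exact: cvg_cst.
- have E : {near t, (fun u => x u - c) =1 y}.
    by near=> u; rewrite /y causal_pos//; near: u; exact: lt_nbhsr.
  rewrite /continuous_at {2}/y causal_pos//; apply: cvg_trans (near_eq_cvg E) _.
  by apply: cvgB; [exact: x_cont_pos|exact: cvg_cst].
- apply/cvgrPdist_lt => b b0; rewrite y_le0//.
  move/cvgrPdist_lt : x_right => /(_ b b0)[/= w w0 H].
  near=> u; have uw : `|u| < w.
    near: u; have := nbhsx_ballx (0 : R) w w0.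
    by apply: filterS => u; rewrite /ball/= sub0r normrN.
  rewrite sub0r normrN /y /causal; case: (ltP 0 u) => u0; last by rewrite normr0.
  by rewrite -x0c distrC; apply: H => //=; rewrite sub0r normrN.
Unshelve. all: by end_near. Qed.

Lemma perturbation_bounded t : `|y t| <= 2 * e.
Proof.
have e0 : 0 < e by exact: lt_le_trans ce.
rewrite /y /causal; case: ltP => t0; last by rewrite normr0 mulr_ge0// ltW.
rewrite (le_trans (ler_normB _ _))// (gtr0_norm c0).
have := xe (ltW t0); move: ce; lra.
Qed.

Lemma measurable_nonlinearity : measurable_fun setT h.
Proof.
by apply: measurable_causal => t t0; apply: cvgB; [exact: G_cont|exact: xtau_cont].
Qed.

Lemma nonlinearity_le t : `|h t| <= 2 * e `^ r * (`|y (t - tau)| + c * heaviside t).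
Proof.
have er0 : 0 <= 2 * e `^ r by rewrite mulr_ge0// powR_ge0.
rewrite /h /causal /heaviside; case: ltP => t0; last first.
  by rewrite normr0 mulr_ge0// mulr0 addr0.
rewrite (le_trans (h_pos t0))// ler_wpM2l// mulr1 perturbation_shift//.
by rewrite (le_trans (ler_normD _ _))// (gtr0_norm c0).
Qed.

Lemma transfer_equation (s : R[i]) : 0 < Re s ->
  delta al (al - 2^-1) d p q tau s * lap s y = (c * (q - p))%:C * s^-1 + q%:C * lap s h.
Proof.
move=> s0; have e0 : 0 < e by exact: lt_le_trans ce.
case: sol => _ _ qx [cap1 cap2] eqx.
have GM t : 0 < t -> `|G t| <= 2 * e.
  move=> t0; have xb := x_bounded (ltW (shift_gt_tau t0)).
  have -> : G t = (G t - x (t - tau)) + x (t - tau) by rewrite subrK.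
  rewrite (le_trans (ler_normD _ _))// [leRHS]mulr_natl mulr2n lerD//.
  rewrite (le_trans (h_pos t0))// (le_trans _ xb)// ler_piMl//; move: er; lra.
pose M := e + (p * e + q * (2 * e)).
have xM t : 0 < t -> `|x t| <= M.
  move=> t0; rewrite (le_trans (xe (ltW t0)))// lerDl addr_ge0// !mulr_ge0// ltW//.
have F_cont t : 0 < t -> {for t, continuous F}.
  move=> t0; apply: cvgD; apply: cvgMr; [exact: x_cont_pos|exact: G_cont].
have FM t : 0 < t -> `|F t| <= M.
  move=> t0; rewrite /F; move: (G t) (GM t t0) (xe (ltW t0)) => g hg hx.
  rewrite (le_trans (ler_normD _ _))// !normrM normrN (gtr0_norm p0) (gtr0_norm q0).
  by have := ler_wpM2l (ltW p0) hx; have := ler_wpM2l (ltW q0) hg; rewrite /M; lra.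
have eqF t : 0 < t -> (al - 2^-1) * caputo al x t + d * caputo (2 * al) x t = F t.
  by move=> /eqx[_ ->].
have := laplace_equation al01 s0 d0 x_right qx x_cont_pos xM F_cont FM cap1 cap2 eqF.
rewrite x0c -/y => E.
have ly : lapable (Re s) y.
  apply: (lapable_bounded s0 _ perturbation_bounded y_le0).
  by apply: continuous_measurable_fun; exact: perturbation_continuous.
have lh : lapable (Re s) h.
  apply: (@lapable_causal _ _ _ (2 * e `^ r * e) s0) => t t0.
    by apply: cvgB; [exact: G_cont|exact: xtau_cont].
  rewrite (le_trans (h_pos t0))// ler_wpM2l ?mulr_ge0 ?powR_ge0//.
  exact/x_bounded/ltW/shift_gt_tau.
have lH := lapable_heaviside s0.
have lys := lapable_shift tau ly.
(* From [x = y + c] and [G = h + y (t - tau) + c] for positive [t]: the constants add up to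
   [c * (q - p)]. *)
have FE : causal F = fun t => (- p * y t + q * y (t - tau)) +
    (c * (q - p) * heaviside t + q * h t).
  apply/funext => t; have [t0|t0] := leP t 0.
    rewrite /h !causal_le0// y_le0// y_le0; last by rewrite subr_le0 (le_trans t0).
    by rewrite /heaviside ltNge t0/= !mulr0 !addr0.
  have hE : h t = G t - x (t - tau) by rewrite /h causal_pos.
  have yE : y t = x t - c by rewrite /y causal_pos.
  by rewrite causal_pos// /F hE yE perturbation_shift// /heaviside t0; move: (G t) => g; ring.
move: E; rewrite FE lapD; [|by apply: lapableD; exact: lapableZ|by apply: lapableD; exact: lapableZ].
rewrite lapD; [|exact: lapableZ|exact: lapableZ].
rewrite (lapD (lapableZ _ lH) (lapableZ _ lh)).
rewrite (lapZ _ ly) (lapZ _ lys) (lapZ _ lH) (lapZ _ lh) lap_shift// lap_heaviside//.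
rewrite /delta => E; rewrite mulrBl mulrDl E rmorphN; ring.
Qed.

End linearization.

Theorem theorem4p1 (R : realType) (alpha d p q r tau : R)
    (halpha : 0 < alpha <= 1) (hd : 0 < d)
    (hp : 0 < p) (hq : 0 < q) (hr : 0 < r) (hpq : p < q) (htau : 0 <= tau) :
  mg_equilibrium alpha d p q r tau 0 /\ mg_unstable alpha d p q r tau 0.
Proof.
split; first exact: equilibrium0.
rewrite /mg_unstable => stable; have /andP[al0 _] := halpha.
have [k k0 core] := instability_core (alpha - 2^-1) al0 hd hp hpq htau.
(* [eta] will be [e^r]: [k / 2] makes the constant [2 e^r] of the remainder at most [k], and [1 / 2]
   keeps the denominator away from 0. *)
pose eta := Num.min (k / 2) 2^-1.
have eta0 : 0 < eta by rewrite lt_min divr_gt0 ?invr_gt0 ?ltr0n.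
pose e := eta `^ r^-1.
have e0 : 0 < e by exact: powR_gt0.
have eE : e `^ r = eta by rewrite /e -powRrM mulVf ?gt_eqF// powRr1// ltW.
have [del del0 H] := stable e e0.
pose c := Num.min del e / 2.
have c0 : 0 < c by rewrite divr_gt0// lt_min del0.
have cle : c < del /\ c < e.
  have m0 : 0 < Num.min del e by rewrite lt_min del0.
  have m1 : Num.min del e <= del by rewrite ge_min lexx.
  have m2 : Num.min del e <= e by rewrite ge_min lexx orbT.
  by rewrite /c; split; lra.
have rc : 0 <= rpow c r by rewrite /rpow; case: ifP; rewrite ?exprn_ge0 ?powR_ge0// ltW.
have init : mg_initial r tau (cst c).
  split.
    apply: (@klipschitzW _ _ _ 0); last by move=> [u v] _ /=; rewrite subrr normr0 mul0r.
    apply: (@globally_properfilter _ _ (0, 0)).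
    by split; rewrite /= in_itv/= lexx oppr_le0 htau.
  by move=> t _; split; [right; exact: ltW|rewrite gt_eqF// ltr_pwDl].
have nrm : init_norm tau (fun t => cst c t - 0) < del.
  (* The interval contains 0 even when [tau = 0], so the supremum is taken over a nonempty set. *)
  rewrite /init_norm; have -> : [set `|cst c t - 0| | t in `[- tau, 0]] = [set c].
    apply/seteqP; split => [_ [t _ <-]|_ ->]; first by rewrite /= subr0 gtr0_norm.
    by exists 0; rewrite /= ?in_itv/= ?lexx ?oppr_le0 ?htau// subr0 gtr0_norm.
  by rewrite sup1; case: cle.
have [x sol xe] := H _ init nrm.
have xe' t : 0 <= t -> `|x t| <= e by move=> t0; have := xe t t0; rewrite subr0 => /ltW.
have [_ /ltW ce] := cle.
have er : e `^ r <= 2^-1 by rewrite eE ge_min lexx orbT.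
apply: (core c (2 * e) (causal (fun t => x t - c))
  (causal (fun t => x (t - tau) / (1 + rpow (x (t - tau)) r) - x (t - tau)))) => //.
- exact: (perturbation_continuous htau sol).
- exact: (perturbation_bounded c0 ce xe').
- by move=> t; exact: causal_le0.
- exact: measurable_nonlinearity hr sol.
- move=> t; apply: (le_trans (nonlinearity_le hr c0 ce er sol xe' t)).
  rewrite ler_wpM2r//.
    by rewrite addr_ge0// mulr_ge0 ?(ltW c0)// /heaviside; case: ifP.
  have : eta <= k / 2 by rewrite ge_min lexx.
  by rewrite eE; lra.
- exact: (transfer_equation halpha hd hp hq hr htau c0 ce er sol xe').
Qed.
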